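(* Let $\mathbf{C}^-:=\inf_{F\in\mathcal{H}_{\pi\Delta},F\ne0}\|F\|_{L^2(\mathbb{R},W)}/\|F\|_{L^2(\mathbb{R})}$ and $\mathbf{C}^+:=\sup_{F\in\mathcal{H}_{\pi\Delta},F\ne0}\|F\|_{L^2(\mathbb{R},W)}/\|F\|_{L^2(\mathbb{R})}$, where $W(x)=1+\frac{\sin 2\pi x}{2\pi x}$. (i) For $0<\Delta\le1$: $\mathbf{C}^-=1$ and $\mathbf{C}^+=\sqrt{1+\frac{\Delta}{2}}$. (ii) For $1<\Delta\le2$, let $\eta^+$ and $\eta^-$ be the largest and the smallest real solutions $\eta$ of \[ \left(\tfrac{1}{2}+\tfrac{2-\Delta}{4\eta}\right)\cos\left(\tfrac{\Delta-1}{2\eta}\right)+\sin\left(\tfrac{\Delta-1}{2\eta}\right) = 1. \] Then $\mathbf{C}^-=\sqrt{1+\eta^-}$ and $\mathbf{C}^+=\sqrt{1+\eta^+}$.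
   Context: $\mathcal{H}_{\pi\Delta}$ is the space of entire functions of exponential type at most $\pi\Delta$ that are square-integrable on $\mathbb{R}$; $\|F\|^2_{L^2(\mathbb{R},W)}=\int_{\mathbb{R}}|F(x)|^2W(x)\,dx$. *)

(* Defs.v *)
From Stdlib Require Import Reals.
From Coquelicot Require Import Coquelicot.
Open Scope R_scope.

Definition sinc (x : R) : R := if Req_EM_T x 0 then 1 else sin x / x.

Definition W (x : R) : R := 1 + sinc (2 * PI * x).

Definition entire (F : Complex.C -> Complex.C) : Prop :=
  forall z : Complex.C, ex_derive (K := C_AbsRing) (V := C_NormedModule) F z.

Definition exp_type_le (tau : R) (F : Complex.C -> Complex.C) : Prop :=
  forall eps : R, 0 < eps ->
    exists M : R, forall z : Complex.C, Cmod (F z) <= M * exp ((tau + eps) * Cmod z).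

Definition sqmod (F : Complex.C -> Complex.C) (x : R) : R := (Cmod (F (RtoC x))) ^ 2.

Definition PW (Delta : R) (F : Complex.C -> Complex.C) : Prop :=
  entire F /\ exp_type_le (PI * Delta) F /\
  ex_RInt_gen (sqmod F) (Rbar_locally m_infty) (Rbar_locally p_infty).

Definition L2sq (F : Complex.C -> Complex.C) : R :=
  RInt_gen (sqmod F) (Rbar_locally m_infty) (Rbar_locally p_infty).
Definition L2Wsq (F : Complex.C -> Complex.C) : R :=
  RInt_gen (fun x => sqmod F x * W x) (Rbar_locally m_infty) (Rbar_locally p_infty).

Definition ratios (Delta : R) (r : R) : Prop :=
  exists F : Complex.C -> Complex.C,
    PW Delta F /\ (exists z, F z <> RtoC 0) /\ r = sqrt (L2Wsq F) / sqrt (L2sq F).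

Definition Cminus_is (Delta : R) (c : Rbar) : Prop := is_glb_Rbar (ratios Delta) c.
Definition Cplus_is (Delta : R) (c : Rbar) : Prop := is_lub_Rbar (ratios Delta) c.

Definition eta_eq (Delta eta : R) : Prop :=
  eta <> 0 /\
  (1/2 + (2 - Delta) / (4 * eta)) * cos ((Delta - 1) / (2 * eta))
    + sin ((Delta - 1) / (2 * eta)) = 1.

(* Main.v *)
(**
  Restricted to the real line, a function of the Paley-Wiener space is the Hartley transform
  (kernel cos + sin) of a function supported in [-Delta/2, Delta/2], separately for its real and
  imaginary parts. Since sin(2 pi x)/(2 pi x) is the transform of half the indicator of [-1, 1],
  Plancherel turns the quotient of norms into 1 + Q(f)/N(f), where N is the squared L2 norm on
  [-Delta/2, Delta/2] and Q is the form of the operator T f (t) = 1/2 int_{|s - t| <= 1} f(s) ds.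

  For Delta <= 1 one has Q(f) = (int f)^2 / 2. For Delta > 1 the equation eta f = T f is a
  rotation f'(t) = - f(t - 1) / (2 eta), f'(t - 1) = f(t) / (2 eta) with boundary conditions whose
  determinant is the transcendental equation for eta. If the supremum of the Rayleigh quotient were
  not a root, eta - T would be bounded below there, contradicting maximality; hence the extremal
  values are exactly the extreme roots.

  That the spectrum of F lies in [-Delta/2, Delta/2] is proved for F(r z) J(delta z), with J an
  entire L2 multiplier: this is integrable on R, and by Goursat's theorem its Fourier integral can
  be moved from both real half-lines to the same imaginary half-line, a Gaussian factor controlling
  the sector next to the real axis. Then r -> 1 and delta -> 0.
*)
Require Import Defs.
From Stdlib Require Import Reals Lra Lia Classical ClassicalEpsilon FunctionalExtensionality.
From Coquelicot Require Import Coquelicot.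
Open Scope R_scope.

(** * Continuous functions and their Riemann integrals *)

(** All integrals are Riemann integrals of continuous functions, and this shapes the argument. A
    square-integrable [F] need not be integrable, so its Fourier integral has no direct meaning; the
    multiplier repairs this but raises the exponential type, and the dilation pays for the increase.
    Continuous functions on [[-a, a]], where [2 * a] is Delta, are not complete for the L2 norm, so
    no extremal function is obtained by a limit: it is written down explicitly once its eigenvalue
    is known to be a root. The cas kernel is real and inverts itself up to an odd term that
    integrates to zero, which keeps Plancherel and inversion inside real analysis. The growth
    hypothesis involves [|z|] and not [|Im z|], so near the real axis the oscillating factor alone
    does not control the integrand. Eigenfunctions need not vanish at the end points, whereas
    Plancherel is proved for continuous functions that do, hence the approximation by cut-offs.
    Finally, the quotient of norms makes sense only if a nonzero [F] is nonzero somewhere on the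
    real line; this is derived from the same contour rotation, applied on vertical half-lines. *)

Definition cts (f : R -> R) : Prop := forall x, continuous f x.
Definition cts2 (f : R -> R -> R) : Prop := forall x y, continuity_2d_pt f x y.

Lemma cts_pt (f : R -> R) : cts f -> forall x, continuity_pt f x.
Proof. intros H x; apply continuity_pt_filterlim; exact (H x). Qed.

Lemma cts_of_pt (f : R -> R) : (forall x, continuity_pt f x) -> cts f.
Proof. intros H x; apply continuity_pt_filterlim; exact (H x). Qed.

Lemma cts_ext (f g : R -> R) : (forall x, f x = g x) -> cts f -> cts g.
Proof. intros E H x; apply (continuous_ext f); [exact E | apply H]. Qed.

Lemma cts_const (c : R) : cts (fun _ => c).
Proof. intros x; apply continuous_const. Qed.

Lemma cts_id : cts (fun x => x).
Proof. intros x; apply continuous_id. Qed.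

Lemma cts_plus (f g : R -> R) : cts f -> cts g -> cts (fun x => f x + g x).
Proof. intros Hf Hg x; exact (continuous_plus f g x (Hf x) (Hg x)). Qed.

Lemma cts_minus (f g : R -> R) : cts f -> cts g -> cts (fun x => f x - g x).
Proof. intros Hf Hg x; exact (continuous_minus f g x (Hf x) (Hg x)). Qed.

Lemma cts_opp (f : R -> R) : cts f -> cts (fun x => - f x).
Proof. intros Hf x; exact (continuous_opp f x (Hf x)). Qed.

Lemma cts_mult (f g : R -> R) : cts f -> cts g -> cts (fun x => f x * g x).
Proof. intros Hf Hg x; exact (continuous_mult f g x (Hf x) (Hg x)). Qed.

Lemma cts_comp (f g : R -> R) : cts f -> cts g -> cts (fun x => f (g x)).
Proof. intros Hf Hg x; apply (continuous_comp g f x); auto. Qed.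

Lemma cts_pow (f : R -> R) (n : nat) : cts f -> cts (fun x => f x ^ n).
Proof.
  intros Hf; induction n as [|n IH]; simpl; [apply cts_const|].
  apply cts_mult; assumption.
Qed.

Lemma cts_inv (f : R -> R) : cts f -> (forall x, f x <> 0) -> cts (fun x => / f x).
Proof.
  intros Hf H; apply cts_of_pt; intros x.
  apply continuity_pt_inv; [apply cts_pt; assumption | apply H].
Qed.

Lemma cts_cos (f : R -> R) : cts f -> cts (fun x => cos (f x)).
Proof. apply cts_comp; apply cts_of_pt; exact continuity_cos. Qed.

Lemma cts_sin (f : R -> R) : cts f -> cts (fun x => sin (f x)).
Proof. apply cts_comp; apply cts_of_pt; exact continuity_sin. Qed.

Lemma cts_exp (f : R -> R) : cts f -> cts (fun x => exp (f x)).
Proof.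
  apply cts_comp; apply cts_of_pt; intros x; apply derivable_continuous_pt, derivable_pt_exp.
Qed.

Lemma cts_abs (f : R -> R) : cts f -> cts (fun x => Rabs (f x)).
Proof. apply cts_comp; apply cts_of_pt; exact Rcontinuity_abs. Qed.

Lemma cts_sqrt (f : R -> R) : cts f -> (forall x, 0 <= f x) -> cts (fun x => sqrt (f x)).
Proof.
  intros Hf H; apply cts_of_pt; intros x.
  apply (continuity_pt_comp f sqrt); [apply cts_pt; assumption|].
  apply continuity_pt_sqrt, H.
Qed.

Lemma cts2_const (c : R) : cts2 (fun _ _ => c).
Proof. intros x y; apply continuity_2d_pt_const. Qed.

Lemma cts2_fst (f : R -> R) : cts f -> cts2 (fun x _ => f x).
Proof.
  intros Hf x y.
  apply (continuity_1d_2d_pt_comp f (fun u _ => u));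
    [apply cts_pt; assumption | apply continuity_2d_pt_id1].
Qed.

Lemma cts2_snd (f : R -> R) : cts f -> cts2 (fun _ y => f y).
Proof.
  intros Hf x y.
  apply (continuity_1d_2d_pt_comp f (fun _ v => v));
    [apply cts_pt; assumption | apply continuity_2d_pt_id2].
Qed.

Lemma cts2_plus (f g : R -> R -> R) : cts2 f -> cts2 g -> cts2 (fun x y => f x y + g x y).
Proof. intros Hf Hg x y; apply continuity_2d_pt_plus; auto. Qed.

Lemma cts2_minus (f g : R -> R -> R) : cts2 f -> cts2 g -> cts2 (fun x y => f x y - g x y).
Proof. intros Hf Hg x y; apply continuity_2d_pt_minus; auto. Qed.

Lemma cts2_mult (f g : R -> R -> R) : cts2 f -> cts2 g -> cts2 (fun x y => f x y * g x y).
Proof. intros Hf Hg x y; apply continuity_2d_pt_mult; auto. Qed.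

Lemma cts2_comp (f : R -> R) (g : R -> R -> R) :
  cts f -> cts2 g -> cts2 (fun x y => f (g x y)).
Proof.
  intros Hf Hg x y; apply continuity_1d_2d_pt_comp; auto; apply cts_pt; assumption.
Qed.

Lemma cts2_cos (g : R -> R -> R) : cts2 g -> cts2 (fun x y => cos (g x y)).
Proof. apply cts2_comp, (cts_cos _ cts_id). Qed.

Lemma cts2_sin (g : R -> R -> R) : cts2 g -> cts2 (fun x y => sin (g x y)).
Proof. apply cts2_comp, (cts_sin _ cts_id). Qed.

Lemma cts2_slice (f : R -> R -> R) (x : R) : cts2 f -> cts (fun y => f x y).
Proof.
  intros H; apply cts_of_pt; intros y e He.
  destruct (H x y (mkposreal e He)) as [d Hd].
  exists d; split; [apply cond_pos|]; intros z [_ Hz].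
  apply Hd; [rewrite Rminus_diag, Rabs_R0; apply cond_pos | exact Hz].
Qed.

Lemma cts2_swap (f : R -> R -> R) : cts2 f -> cts2 (fun x y => f y x).
Proof.
  intros H x y e; destruct (H y x e) as [d Hd]; exists d; intros u v Hu Hv.
  apply Hd; assumption.
Qed.

Ltac cts_tac :=
  repeat first
  [ match goal with H : ?P |- ?P => exact H end
  | lazymatch goal with
    | |- cts (fun x => x) => apply cts_id
    | |- cts (fun _ => ?c) => apply cts_const
    | |- cts Ropp => apply (cts_opp _ cts_id)
    | |- cts cos => apply (cts_cos _ cts_id)
    | |- cts sin => apply (cts_sin _ cts_id)
    | |- cts exp => apply (cts_exp _ cts_id)
    | |- cts Rabs => apply (cts_abs _ cts_id)
    | |- cts (Rplus _) => apply (cts_plus _ _ (cts_const _) cts_id)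
    | |- cts (Rminus _) => apply (cts_minus _ _ (cts_const _) cts_id)
    | |- cts (Rmult _) => apply (cts_mult _ _ (cts_const _) cts_id)
    | |- cts (fun x => _ + _) => apply cts_plus
    | |- cts (fun x => _ - _) => apply cts_minus
    | |- cts (fun x => - _) => apply cts_opp
    | |- cts (fun x => _ * _) => apply cts_mult
    | |- cts (fun x => _ / _) => unfold Rdiv; apply cts_mult
    | |- cts (fun x => _ ^ _) => apply cts_pow
    | |- cts (fun x => cos _) => apply cts_cos
    | |- cts (fun x => sin _) => apply cts_sin
    | |- cts (fun x => exp _) => apply cts_exp
    | |- cts (fun x => Rabs _) => apply cts_abs
    | |- cts (fun x => ?f _) => apply (cts_comp f)
    | |- cts2 Rplus => change (cts2 (fun x y => x + y))
    | |- cts2 Rminus => change (cts2 (fun x y => x - y))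
    | |- cts2 Rmult => change (cts2 (fun x y => x * y))
    | |- cts2 (fun _ _ => ?c) => apply cts2_const
    | |- cts2 (fun x _ => @?f x) => apply (cts2_fst f)
    | |- cts2 (fun _ y => @?f y) => apply (cts2_snd f)
    | |- cts2 (fun x y => _ + _) => apply cts2_plus
    | |- cts2 (fun x y => _ - _) => apply cts2_minus
    | |- cts2 (fun x y => _ * _) => apply cts2_mult
    | |- cts2 (fun x y => cos _) => apply cts2_cos
    | |- cts2 (fun x y => sin _) => apply cts2_sin
    | |- cts2 (fun x y => ?f _) => apply (cts2_comp f)
    end ].

(* [RInt] returns its values in [R_CompleteNormedModule], which [ring] does not recognise as [R]. *)
Ltac as_R := match goal with |- @eq _ ?x ?y => change (@eq R x y) end.

Lemma cts_ex_RInt (f : R -> R) (a b : R) : cts f -> ex_RInt f a b.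
Proof. intros H; apply (ex_RInt_continuous f); intros; apply H. Qed.

Lemma cts_is_RInt (f : R -> R) (a b : R) : cts f -> is_RInt f a b (RInt f a b).
Proof. intros H; apply (RInt_correct f), cts_ex_RInt, H. Qed.

Lemma RInt_c_plus (f g : R -> R) (a b : R) : cts f -> cts g ->
  RInt (fun x => f x + g x) a b = RInt f a b + RInt g a b.
Proof. intros Hf Hg; exact (RInt_plus f g a b (cts_ex_RInt _ _ _ Hf) (cts_ex_RInt _ _ _ Hg)). Qed.

Lemma RInt_c_minus (f g : R -> R) (a b : R) : cts f -> cts g ->
  RInt (fun x => f x - g x) a b = RInt f a b - RInt g a b.
Proof. intros Hf Hg; exact (RInt_minus f g a b (cts_ex_RInt _ _ _ Hf) (cts_ex_RInt _ _ _ Hg)). Qed.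

Lemma RInt_c_scal (f : R -> R) (k a b : R) : cts f ->
  RInt (fun x => k * f x) a b = k * RInt f a b.
Proof. intros Hf; exact (RInt_scal f a b k (cts_ex_RInt _ _ _ Hf)). Qed.

Lemma RInt_c_opp (f : R -> R) (a b : R) : cts f ->
  RInt (fun x => - f x) a b = - RInt f a b.
Proof. intros Hf; exact (RInt_opp f a b (cts_ex_RInt _ _ _ Hf)). Qed.

Lemma RInt_c_Chasles (f : R -> R) (a b c : R) : cts f ->
  RInt f a c = RInt f a b + RInt f b c.
Proof.
  intros Hf; symmetry; exact (RInt_Chasles f a b c (cts_ex_RInt _ _ _ Hf) (cts_ex_RInt _ _ _ Hf)).
Qed.

Lemma RInt_c_le (f g : R -> R) (a b : R) : cts f -> cts g -> a <= b ->
  (forall x, a <= x <= b -> f x <= g x) -> RInt f a b <= RInt g a b.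
Proof.
  intros Hf Hg Hab H; apply RInt_le; auto using cts_ex_RInt.
  intros x Hx; apply H; lra.
Qed.

Lemma RInt_c_pos (f : R -> R) (a b : R) : cts f -> a <= b ->
  (forall x, a <= x <= b -> 0 <= f x) -> 0 <= RInt f a b.
Proof.
  intros Hf Hab H; apply RInt_ge_0; auto using cts_ex_RInt.
  intros x Hx; apply H; lra.
Qed.

Lemma RInt_R_const (c a b : R) : RInt (fun _ => c) a b = (b - a) * c.
Proof. exact (RInt_const a b c). Qed.

Lemma RInt_c_swap (f : R -> R) (a b : R) : cts f -> RInt f a b = - RInt f b a.
Proof. intros Hf; symmetry; exact (opp_RInt_swap f b a (cts_ex_RInt _ _ _ Hf)). Qed.

Lemma RInt_c_abs (f : R -> R) (a b : R) : cts f -> a <= b ->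
  Rabs (RInt f a b) <= RInt (fun x => Rabs (f x)) a b.
Proof. intros Hf Hab; apply abs_RInt_le; auto using cts_ex_RInt. Qed.

Lemma RInt_c_abs_le (f g : R -> R) (a b : R) : cts f -> cts g -> a <= b ->
  (forall x, a <= x <= b -> Rabs (f x) <= g x) -> Rabs (RInt f a b) <= RInt g a b.
Proof.
  intros Hf Hg Hab H; eapply Rle_trans; [apply RInt_c_abs; assumption|].
  apply RInt_c_le; auto; cts_tac.
Qed.

Lemma RInt_c_abs_bound (f : R -> R) (a b K : R) : cts f -> a <= b ->
  (forall x, a <= x <= b -> Rabs (f x) <= K) -> Rabs (RInt f a b) <= (b - a) * K.
Proof.
  intros Hf Hab H; rewrite <- RInt_R_const; apply RInt_c_abs_le; auto; cts_tac.
Qed.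

Lemma RInt_R_ext (f g : R -> R) (a b : R) : (forall x, f x = g x) -> RInt f a b = RInt g a b.
Proof. intros H; apply RInt_ext; intros; apply H. Qed.

Lemma RInt_R_ext_in (f g : R -> R) (a b : R) : a <= b ->
  (forall x, a <= x <= b -> f x = g x) -> RInt f a b = RInt g a b.
Proof.
  intros Hab H; apply RInt_ext; intros x Hx; apply H.
  rewrite Rmin_left, Rmax_right in Hx; lra.
Qed.

Lemma is_derive_RInt_c (f : R -> R) (a x : R) : cts f ->
  is_derive (fun y => RInt f a y) x (f x).
Proof.
  intros Hf; apply (is_derive_RInt f (fun y => RInt f a y) a x); [|apply Hf].
  apply filter_forall; intros y; apply cts_is_RInt, Hf.
Qed.

Lemma is_derive_cts (f df : R -> R) : (forall x, is_derive f x (df x)) -> cts f.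
Proof.
  intros H x; apply (ex_derive_continuous f); exists (df x); apply H.
Qed.

Lemma RInt_of_derive (f df : R -> R) (a b : R) :
  (forall x, is_derive f x (df x)) -> cts df -> RInt df a b = f b - f a.
Proof.
  intros H Hc; apply is_RInt_unique; apply (is_RInt_derive f df); intros; auto.
Qed.

Lemma cts_RInt_upper (f : R -> R) (a : R) : cts f -> cts (fun x => RInt f a x).
Proof.
  intros Hf; apply (is_derive_cts _ f); intros x; apply is_derive_RInt_c, Hf.
Qed.

Lemma RInt_by_parts (f g df dg : R -> R) (a b : R) :
  (forall x, is_derive f x (df x)) -> (forall x, is_derive g x (dg x)) ->
  cts df -> cts dg ->
  RInt (fun x => f x * dg x) a b = f b * g b - f a * g a - RInt (fun x => df x * g x) a b.
Proof.
  intros Hf Hg Hdf Hdg.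
  assert (cf := is_derive_cts _ _ Hf); assert (cg := is_derive_cts _ _ Hg).
  assert (E : RInt (fun x => df x * g x + f x * dg x) a b = f b * g b - f a * g a).
  { apply (RInt_of_derive (fun x => f x * g x)); [|cts_tac].
    intros x; apply (is_derive_mult f g); auto; intros; apply Rmult_comm. }
  rewrite RInt_c_plus in E by cts_tac; lra.
Qed.

Lemma RInt_c_comp_lin (f : R -> R) (u v a b : R) : cts f ->
  RInt (fun y => u * f (u * y + v)) a b = RInt f (u * a + v) (u * b + v).
Proof. intros Hf; exact (RInt_comp_lin f u v a b (cts_ex_RInt _ _ _ Hf)). Qed.

Lemma RInt_c_shift (f : R -> R) (v a b : R) : cts f ->
  RInt (fun y => f (y + v)) a b = RInt f (a + v) (b + v).
Proof.
  intros Hf; generalize (RInt_c_comp_lin f 1 v a b Hf); rewrite !Rmult_1_l; intros <-.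
  apply RInt_R_ext; intros x; rewrite !Rmult_1_l; reflexivity.
Qed.

Lemma RInt_c_reflect (f : R -> R) (a b : R) : cts f ->
  RInt (fun y => f (- y)) a b = RInt f (- b) (- a).
Proof.
  intros Hf; generalize (RInt_c_comp_lin f (-1) 0 a b Hf); intros E.
  rewrite (RInt_R_ext _ (fun y => -1 * f (- y))) in E.
  2:{ intros x; replace (-1 * x + 0) with (- x) by ring; reflexivity. }
  rewrite RInt_c_scal in E by cts_tac.
  rewrite (RInt_c_swap f (- b)) by assumption.
  replace (- a) with (-1 * a + 0) by ring; replace (- b) with (-1 * b + 0) by ring.
  lra.
Qed.

Lemma RInt_odd (f : R -> R) (T : R) : cts f -> (forall x, f (- x) = - f x) ->
  RInt f (- T) T = 0.
Proof.
  intros Hf Hodd; generalize (RInt_c_reflect f (- T) T Hf).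
  rewrite (RInt_R_ext _ (fun x => - f x)) by apply Hodd.
  rewrite RInt_c_opp by assumption; rewrite Ropp_involutive; lra.
Qed.

Lemma RInt_even (f : R -> R) (T : R) : cts f -> (forall x, f (- x) = f x) ->
  RInt f (- T) T = 2 * RInt f 0 T.
Proof.
  intros Hf Hev; rewrite (RInt_c_Chasles f (- T) 0 T Hf).
  generalize (RInt_c_reflect f 0 T Hf); rewrite Ropp_0.
  rewrite (RInt_R_ext _ f) by apply Hev; lra.
Qed.

Lemma RInt_zero_outside (f : R -> R) (a b c d : R) : cts f ->
  c <= a <= b -> b <= d -> (forall x, x <= a \/ b <= x -> f x = 0) ->
  RInt f c d = RInt f a b.
Proof.
  intros Hf Hab Hbd H.
  rewrite (RInt_c_Chasles f c a d Hf), (RInt_c_Chasles f a b d Hf).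
  rewrite (RInt_R_ext_in f (fun _ => 0) c a);
    [| lra | intros x Hx; apply H; left; lra].
  rewrite (RInt_R_ext_in f (fun _ => 0) b d);
    [| lra | intros x Hx; apply H; right; lra].
  rewrite !RInt_R_const; lra.
Qed.

Lemma cts_RInt_param (f : R -> R -> R) (c d : R) : cts2 f ->
  cts (fun x => RInt (fun y => f x y) c d).
Proof.
  assert (main : forall c d, c <= d -> cts2 f -> cts (fun x => RInt (fun y => f x y) c d)).
  { intros c' d' Hcd H; apply cts_of_pt; intros x e He.
    (* The added 1 keeps the denominator positive when [c' = d']. *)
    assert (He' : 0 < e / (2 * (d' - c' + 1))) by (apply Rdiv_lt_0_compat; lra).
    destruct (uniform_continuity_2d_1d' f c' d' x (fun y _ => H x y) (mkposreal _ He'))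
      as [del Hd]; simpl in Hd.
    exists del; split; [apply cond_pos|]; intros z [_ Hz].
    unfold R_met, R_dist in *; simpl in *; unfold R_dist in *.
    rewrite <- RInt_c_minus by (apply cts2_slice; assumption).
    apply Rle_lt_trans with ((d' - c') * (e / (2 * (d' - c' + 1)))).
    - apply RInt_c_abs_bound; [apply cts_minus; apply cts2_slice; assumption | assumption |].
      intros y Hy; left.
      assert (Hp := cond_pos del).
      apply Hd; try assumption; try lra.
      + apply Rabs_lt_between in Hz; lra.
      + rewrite Rminus_diag, Rabs_R0; assumption.
    - replace ((d' - c') * (e / (2 * (d' - c' + 1)))) with (e * ((d' - c') / (2 * (d' - c' + 1))))
        by (field; lra).
      rewrite <- (Rmult_1_r e) at 2; apply Rmult_lt_compat_l; [assumption|].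
      apply Rlt_div_l; lra. }
  intros H; destruct (Rle_lt_dec c d) as [Hcd|Hcd]; [apply main; assumption|].
  intros x; apply (continuous_ext (fun x => - RInt (fun y => f x y) d c)).
  - intros y; symmetry; apply RInt_c_swap, cts2_slice, H.
  - apply (cts_opp (fun x => RInt (fun y => f x y) d c)); apply main; [lra | assumption].
Qed.

(** Seen as functions of the upper limit [b], both sides vanish at [a] and have the same derivative;
    differentiation under the integral sign does the rest. *)
Lemma RInt_Fubini (f : R -> R -> R) (a b c d : R) : cts2 f ->
  RInt (fun x => RInt (fun y => f x y) c d) a b =
  RInt (fun y => RInt (fun x => f x y) a b) c d.
Proof.
  intros H.
  assert (Hs := cts2_swap f H).
  set (Phi := fun X => RInt (fun y => RInt (fun x => f x y) a X) c d).
  assert (D1 : forall v u, Derive (fun z => RInt (fun x => f x v) a z) u = f u v).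
  { intros v u; apply is_derive_unique, (is_derive_RInt_c (fun x => f x v)).
    exact (cts2_slice (fun y x => f x y) v Hs). }
  assert (D : forall X, is_derive Phi X (RInt (fun y => f X y) c d)).
  { intros X.
    rewrite (RInt_R_ext _ (fun t => Derive (fun u => RInt (fun x => f x t) a u) X))
      by (intros; rewrite D1; reflexivity).
    apply (is_derive_RInt_param (fun X y => RInt (fun x => f x y) a X)).
    - apply filter_forall; intros u t _; eexists.
      apply (is_derive_RInt_c (fun x => f x t)).
      exact (cts2_slice (fun y x => f x y) t Hs).
    - intros t _; apply (continuity_2d_pt_ext f); [|apply H].
      intros u v; rewrite D1; reflexivity.
    - apply filter_forall; intros y.
      apply cts_ex_RInt, (cts_RInt_param (fun y x => f x y)), Hs. }
  rewrite (RInt_of_derive Phi); [| exact D | apply cts_RInt_param, H].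
  unfold Phi.
  rewrite (RInt_R_ext (fun y => RInt (fun x => f x y) a a) (fun _ => 0))
    by (intros; apply (RInt_point (V := R_CompleteNormedModule))).
  rewrite RInt_R_const; lra.
Qed.

(** * Absolutely convergent improper integrals *)

(** Symmetric cut-offs make this a principal value. Together with a bound [abs_int] it becomes the
    two-sided improper integral, see [abs_int_is_RInt_gen]. *)
Definition is_int (f : R -> R) (l : R) : Prop :=
  forall e, 0 < e -> exists T0, 0 <= T0 /\ forall T, T0 <= T -> Rabs (RInt f (- T) T - l) <= e.

Definition abs_int (f : R -> R) (B : R) : Prop :=
  forall T, 0 <= T -> RInt (fun x => Rabs (f x)) (- T) T <= B.

Lemma Rle_eps (x y : R) : (forall e, 0 < e -> x <= y + e) -> x <= y.
Proof. intros H; apply le_epsilon; intros; apply H; assumption. Qed.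

Lemma is_int_ext (f g : R -> R) (l : R) : (forall x, f x = g x) -> is_int f l -> is_int g l.
Proof.
  intros E H e He; destruct (H e He) as [T0 [p0 H0]]; exists T0; split; auto.
  intros T HT; rewrite <- (RInt_R_ext f) by assumption; apply H0, HT.
Qed.

Lemma is_int_unique (f : R -> R) (l m : R) : is_int f l -> is_int f m -> l = m.
Proof.
  assert (H : forall l m, is_int f l -> is_int f m -> l <= m).
  { clear; intros l m Hf Hg; apply Rle_eps; intros e He.
    destruct (Hf (e / 2)) as [T1 [p1 H1]]; [lra|].
    destruct (Hg (e / 2)) as [T2 [p2 H2]]; [lra|].
    specialize (H1 (Rmax T1 T2) (Rmax_l _ _)); specialize (H2 (Rmax T1 T2) (Rmax_r _ _)).
    apply Rabs_le_between in H1; apply Rabs_le_between in H2; lra. }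
  intros; apply Rle_antisym; auto.
Qed.

Lemma is_int_plus (f g : R -> R) (l m : R) : cts f -> cts g -> is_int f l -> is_int g m ->
  is_int (fun x => f x + g x) (l + m).
Proof.
  intros cf cg Hf Hg e He.
  destruct (Hf (e / 2)) as [T1 [p1 H1]]; [lra|].
  destruct (Hg (e / 2)) as [T2 [p2 H2]]; [lra|].
  exists (Rmax T1 T2); split; [eapply Rle_trans; [exact p1|apply Rmax_l]|].
  intros T HT; rewrite RInt_c_plus by assumption.
  specialize (H1 T (Rle_trans _ _ _ (Rmax_l _ _) HT)).
  specialize (H2 T (Rle_trans _ _ _ (Rmax_r _ _) HT)).
  apply Rabs_le_between in H1; apply Rabs_le_between in H2; apply Rabs_le_between; lra.
Qed.

Lemma is_int_scal (f : R -> R) (k l : R) : cts f -> is_int f l ->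
  is_int (fun x => k * f x) (k * l).
Proof.
  intros cf Hf e He.
  assert (Hk := Rabs_pos k).
  destruct (Hf (e / (Rabs k + 1))) as [T1 [p1 H1]]; [apply Rdiv_lt_0_compat; lra|].
  exists T1; split; auto; intros T HT; rewrite RInt_c_scal by assumption.
  rewrite <- Rmult_minus_distr_l, Rabs_mult.
  apply Rle_trans with ((Rabs k + 1) * (e / (Rabs k + 1))).
  - apply Rmult_le_compat; auto using Rabs_pos; lra.
  - right; field; lra.
Qed.

Lemma is_int_of_is_RInt_gen (f : R -> R) (l : R) : cts f ->
  is_RInt_gen f (Rbar_locally m_infty) (Rbar_locally p_infty) l -> is_int f l.
Proof.
  intros cf H e He.
  specialize (H (fun y => Rabs (y - l) < e)).
  destruct H as [P Q HP HQ H].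
  { exists (mkposreal e He); intros y Hy; exact Hy. }
  destruct HP as [A HA]; destruct HQ as [B HB].
  exists (Rmax 0 (Rmax (1 - A) (B + 1))); split; [apply Rmax_l|].
  intros T HT.
  assert (h1 := Rmax_r 0 (Rmax (1 - A) (B + 1))).
  assert (h2 := Rmax_l (1 - A) (B + 1)); assert (h3 := Rmax_r (1 - A) (B + 1)).
  destruct (H (- T) T) as [y [Hy1 Hy2]]; [apply HA; lra | apply HB; lra |].
  simpl in Hy1; apply (is_RInt_unique f) in Hy1; rewrite Hy1; left; assumption.
Qed.

Lemma RInt_monotone_bounds (f : R -> R) (a b c d : R) : cts f -> (forall x, 0 <= f x) ->
  c <= a <= b -> b <= d -> RInt f a b <= RInt f c d.
Proof.
  intros cf Hp H1 H2.
  rewrite (RInt_c_Chasles f c a d cf), (RInt_c_Chasles f a b d cf).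
  assert (0 <= RInt f c a) by (apply RInt_c_pos; auto; lra).
  assert (0 <= RInt f b d) by (apply RInt_c_pos; auto; lra).
  lra.
Qed.

Lemma increasing_bounded_lim (F : R -> R) (B : R) :
  (forall s t, 0 <= s <= t -> F s <= F t) -> (forall t, 0 <= t -> F t <= B) ->
  exists l, l <= B /\ (forall t, 0 <= t -> F t <= l) /\
    forall e, 0 < e -> exists T0, 0 <= T0 /\ forall T, T0 <= T -> l - e <= F T <= l.
Proof.
  intros Hi Hb.
  destruct (completeness (fun y => exists t, 0 <= t /\ y = F t)) as [l [Hu Hl]].
  - exists B; intros y [t [Ht ->]]; auto.
  - exists (F 0), 0; split; [lra | reflexivity].
  - exists l; split; [apply Hl; intros y [t [Ht ->]]; auto|].
    assert (Hub : forall t, 0 <= t -> F t <= l) by (intros t Ht; apply Hu; exists t; auto).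
    split; [assumption|].
    intros e He.
    destruct (excluded_middle_informative (exists t, 0 <= t /\ l - e < F t)) as [[t [Ht Hlt]]|Hn].
    + exists t; split; auto; intros T HT; split; [|apply Hub; lra].
      apply Rle_trans with (F t); [lra | apply Hi; lra].
    + exfalso; assert (l <= l - e); [|lra].
      apply Hl; intros y [t [Ht ->]]; apply Rnot_lt_le; intros Hlt; apply Hn; exists t; auto.
Qed.

Lemma pos_int_lim (f : R -> R) (B : R) : cts f -> (forall x, 0 <= f x) ->
  (forall T, 0 <= T -> RInt f (- T) T <= B) ->
  exists l, l <= B /\ (forall T, 0 <= T -> RInt f (- T) T <= l) /\ is_int f l.
Proof.
  intros cf Hp Hb.
  destruct (increasing_bounded_lim (fun T => RInt f (- T) T) B) as [l [H1 [H2 H3]]]; auto.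
  - intros s t Hst; apply RInt_monotone_bounds; auto; lra.
  - exists l; repeat split; auto.
    intros e He; destruct (H3 e He) as [T0 [p0 H0]]; exists T0; split; auto.
    intros T HT; specialize (H0 T HT); apply Rabs_le_between; lra.
Qed.

Lemma pos_int_bound (f : R -> R) (l : R) : cts f -> (forall x, 0 <= f x) -> is_int f l ->
  forall a b, a <= b -> RInt f a b <= l.
Proof.
  intros cf Hp H a b Hab; apply Rle_eps; intros e He.
  destruct (H e He) as [T0 [p0 H0]].
  set (T := T0 + Rabs a + Rabs b).
  assert (Ha := Rabs_pos a); assert (Hb := Rabs_pos b).
  assert (Ha' := Rle_abs (- a)); rewrite Rabs_Ropp in Ha'.
  assert (Hb' := Rle_abs b).
  apply Rle_trans with (RInt f (- T) T).
  - apply RInt_monotone_bounds; auto; unfold T; lra.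
  - specialize (H0 T); apply Rabs_le_between in H0; unfold T in *; lra.
Qed.

Lemma pos_int_tail (f : R -> R) (l : R) : cts f -> (forall x, 0 <= f x) -> is_int f l ->
  forall e, 0 < e -> exists T0, 0 <= T0 /\
    forall a b, a <= - T0 -> T0 <= b -> l - e <= RInt f a b <= l.
Proof.
  intros cf Hp H e He; destruct (H e He) as [T0 [p0 H0]].
  exists T0; split; auto; intros a b Ha Hb; split.
  - apply Rle_trans with (RInt f (- T0) T0); [|apply RInt_monotone_bounds; auto; lra].
    specialize (H0 T0 (Rle_refl _)); apply Rabs_le_between in H0; lra.
  - apply (pos_int_bound f l); auto; lra.
Qed.

(** [f] is the difference of the nonnegative functions [|f|] and [|f| - f], whose integrals grow
    with the interval; so the two end points may go to infinity independently. *)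
Lemma abs_int_lim (f : R -> R) (B : R) : cts f -> abs_int f B ->
  exists l, Rabs l <= B /\
    forall e, 0 < e -> exists T0, 0 <= T0 /\
      forall a b, a <= - T0 -> T0 <= b -> Rabs (RInt f a b - l) <= e.
Proof.
  intros cf HB.
  destruct (pos_int_lim (fun x => Rabs (f x)) B) as [p [pB [_ Hp]]]; auto.
  { cts_tac. } { intros; apply Rabs_pos. }
  destruct (pos_int_lim (fun x => Rabs (f x) - f x) (2 * B)) as [q [qB [_ Hq]]].
  { cts_tac. } { intros x; generalize (Rle_abs (f x)); lra. }
  { intros T HT; rewrite RInt_c_minus by cts_tac.
    assert (H := RInt_c_abs f (- T) T cf); specialize (HB T HT).
    assert (H' : - T <= T) by lra; specialize (H H').
    apply Rabs_le_between in H; lra. }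
  exists (p - q); split.
  - apply Rle_eps; intros e He.
    destruct (Hp (e / 2)) as [T1 [p1 H1]]; [lra|].
    destruct (Hq (e / 2)) as [T2 [p2 H2]]; [lra|].
    set (T := T1 + T2).
    specialize (H1 T); specialize (H2 T); unfold T in *.
    specialize (H1 ltac:(lra)); specialize (H2 ltac:(lra)).
    rewrite RInt_c_minus in H2 by cts_tac.
    assert (H := RInt_c_abs f (- (T1 + T2)) (T1 + T2) cf ltac:(lra)).
    specialize (HB (T1 + T2) ltac:(lra)).
    apply Rabs_le_between in H; apply Rabs_le_between in H1; apply Rabs_le_between in H2.
    apply Rabs_le_between; lra.
  - intros e He.
    destruct (pos_int_tail (fun x => Rabs (f x)) p) with (e := e / 2) as [T1 [p1 H1]]; auto; try lra.
    { cts_tac. } { intros; apply Rabs_pos. }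
    destruct (pos_int_tail (fun x => Rabs (f x) - f x) q) with (e := e / 2) as [T2 [p2 H2]]; auto; try lra.
    { cts_tac. } { intros x; generalize (Rle_abs (f x)); lra. }
    exists (T1 + T2); split; [lra|]; intros a b Ha Hb.
    specialize (H1 a b ltac:(lra) ltac:(lra)); specialize (H2 a b ltac:(lra) ltac:(lra)).
    rewrite RInt_c_minus in H2 by cts_tac.
    apply Rabs_le_between; lra.
Qed.

Lemma abs_int_is_RInt_gen (f : R -> R) (B l : R) : cts f -> abs_int f B -> is_int f l ->
  is_RInt_gen f (Rbar_locally m_infty) (Rbar_locally p_infty) l.
Proof.
  intros cf HB Hl; destruct (abs_int_lim f B cf HB) as [l' [_ H]].
  assert (l' = l).
  { apply (is_int_unique f); auto; intros e He; destruct (H e He) as [T0 [p0 H0]].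
    exists T0; split; auto; intros T HT; apply H0; lra. }
  subst l'; intros P [e HP].
  destruct (H (e / 2)) as [T0 [p0 H0]]; [generalize (cond_pos e); lra|].
  exists (fun a => a < - T0) (fun b => T0 < b); [exists (- T0); auto | exists T0; auto|].
  intros a b Ha Hb; exists (RInt f a b); split; [apply cts_is_RInt, cf|].
  apply HP; simpl; specialize (H0 a b ltac:(lra) ltac:(lra)).
  eapply Rle_lt_trans; [exact H0 | generalize (cond_pos e); lra].
Qed.

Lemma abs_int_ex (f : R -> R) (B : R) : cts f -> abs_int f B ->
  exists l, Rabs l <= B /\ is_int f l.
Proof.
  intros cf HB; destruct (abs_int_lim f B cf HB) as [l [Hl H]]; exists l; split; auto.
  intros e He; destruct (H e He) as [T0 [p0 H0]].
  exists T0; split; auto; intros T HT; apply H0; lra.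
Qed.

Lemma abs_int_pos (f : R -> R) (l : R) : cts f -> (forall x, 0 <= f x) -> is_int f l ->
  abs_int f l.
Proof.
  intros cf Hp H T HT; rewrite (RInt_R_ext _ f) by (intros; apply Rabs_pos_eq, Hp).
  apply pos_int_bound; auto; lra.
Qed.

Lemma abs_int_dom (f g : R -> R) (B : R) : cts f -> cts g -> (forall x, Rabs (f x) <= g x) ->
  abs_int g B -> abs_int f B.
Proof.
  intros cf cg H HB T HT; eapply Rle_trans; [|apply HB, HT].
  apply RInt_c_le; try cts_tac; try lra.
  intros x _; eapply Rle_trans; [apply H | apply Rle_abs].
Qed.

Lemma RInt_gen_is_int (f : R -> R) (l : R) : cts f -> (forall x, 0 <= f x) -> is_int f l ->
  RInt_gen f (Rbar_locally m_infty) (Rbar_locally p_infty) = l.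
Proof.
  intros cf Hp H; apply (is_RInt_gen_unique f).
  apply (abs_int_is_RInt_gen f l); auto; apply abs_int_pos; assumption.
Qed.

(** * The Poisson kernel *)

Definition cas (x : R) : R := cos x + sin x.

Lemma cts_cas (f : R -> R) : cts f -> cts (fun x => cas (f x)).
Proof. intros H; unfold cas; cts_tac. Qed.

Lemma cts2_cas (f : R -> R -> R) : cts2 f -> cts2 (fun x y => cas (f x y)).
Proof. intros H; unfold cas; cts_tac. Qed.

Lemma cas_abs (x : R) : Rabs (cas x) <= 2.
Proof.
  unfold cas; generalize (COS_bound x) (SIN_bound x); intros; apply Rabs_le_between; lra.
Qed.

Lemma cas_mult (x y : R) : cas x * cas y = cos (y - x) + sin (x + y).
Proof. unfold cas; rewrite cos_minus, sin_plus; ring. Qed.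

Lemma exp_le_mono (x y : R) : x <= y -> exp x <= exp y.
Proof. intros [H| ->]; [left; apply exp_increasing, H | right; reflexivity]. Qed.

(** Abel's convergence factor: [e] goes to 0 only after the cut-off in [x] has gone to infinity. *)
Definition abel (e x : R) : R := exp (- (e * Rabs x)).

Lemma cts_abel (e : R) : cts (abel e).
Proof. unfold abel; cts_tac. Qed.

Lemma abel_pos (e x : R) : 0 < abel e x.
Proof. apply exp_pos. Qed.

Lemma abel_le_1 (e x : R) : 0 <= e -> abel e x <= 1.
Proof.
  intros He; unfold abel; rewrite <- exp_0; apply exp_le_mono.
  generalize (Rmult_le_pos _ _ He (Rabs_pos x)); lra.
Qed.

(** The cosine transform of [abel e], that is, the Poisson kernel of a half-plane in the
    normalisation of the frequency [2 * PI * v]; its total mass is 1. *)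
Definition poisson (e v : R) : R := 2 * e / (e ^ 2 + (2 * PI * v) ^ 2).

Lemma poisson_den_pos (e v : R) : 0 < e -> 0 < e ^ 2 + (2 * PI * v) ^ 2.
Proof.
  intros He; assert (0 < e ^ 2) by (apply pow_lt; assumption).
  generalize (pow2_ge_0 (2 * PI * v)); lra.
Qed.

Lemma cts_poisson (e : R) : 0 < e -> cts (poisson e).
Proof.
  intros He; unfold poisson, Rdiv; apply cts_mult; [cts_tac|].
  apply cts_inv; [cts_tac|]; intros x; generalize (poisson_den_pos e x He); lra.
Qed.

Lemma poisson_pos (e v : R) : 0 < e -> 0 <= poisson e v.
Proof.
  intros He; unfold poisson; apply Rle_mult_inv_pos; [lra | apply poisson_den_pos, He].
Qed.

Lemma poisson_far (e v d : R) : 0 < e -> 0 < d -> d <= Rabs v -> poisson e v <= e / d ^ 2.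
Proof.
  intros He Hd Hv; unfold poisson.
  assert (d ^ 2 <= v ^ 2) by (rewrite <- (pow2_abs v); apply pow_incr; lra).
  assert (0 < d ^ 2) by (apply pow_lt; assumption).
  assert (0 < e ^ 2) by (apply pow_lt; assumption).
  assert (HPI : 2 <= PI) by (generalize PI2_1; lra).
  apply Rle_trans with (2 * e / (2 * d ^ 2)); [|right; field; lra].
  apply Rmult_le_compat_l; [lra|]; apply Rinv_le_contravar; [lra|].
  replace ((2 * PI * v) ^ 2) with (4 * (PI * PI) * v ^ 2) by ring.
  assert (4 <= PI * PI) by nra. nra.
Qed.

Definition abel_kernel (e T v : R) : R := RInt (fun x => abel e x * cos (2 * PI * x * v)) (- T) T.

(** An explicit primitive yields the Poisson kernel at the end point 0; the only error is the
    boundary term at [T], which carries [exp (- (e * T))]. *)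
Lemma abel_kernel_poisson (e T v : R) : 0 < e -> 0 <= T ->
  Rabs (abel_kernel e T v - poisson e v) <= 4 * exp (- (e * T)) / e.
Proof.
  intros He HT; unfold abel_kernel.
  assert (ca := cts_abel e).
  rewrite RInt_even.
  2: cts_tac.
  2:{ intros x; unfold abel; rewrite Rabs_Ropp.
      replace (2 * PI * - x * v) with (- (2 * PI * x * v)) by ring; rewrite cos_neg; reflexivity. }
  set (c := 2 * PI * v).
  assert (Hd : 0 < e ^ 2 + c ^ 2) by apply (poisson_den_pos e v He).
  rewrite (RInt_R_ext_in _ (fun x => exp (- (e * x)) * cos (c * x))).
  2: lra.
  2:{ intros x Hx; unfold abel, c; rewrite Rabs_pos_eq by lra; f_equal; f_equal; ring. }
  rewrite (RInt_of_derive (fun x => exp (- (e * x)) * (- e * cos (c * x) + c * sin (c * x)) / (e ^ 2 + c ^ 2))).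
  2:{ intros x; auto_derive; [repeat split; nra|]; field; nra. }
  2: cts_tac.
  rewrite !Rmult_0_r, Ropp_0, exp_0, cos_0, sin_0.
  unfold poisson; fold c.
  replace (2 * (exp (- (e * T)) * (- e * cos (c * T) + c * sin (c * T)) / (e ^ 2 + c ^ 2) -
      1 * (- e * 1 + c * 0) / (e ^ 2 + c ^ 2)) - 2 * e / (e ^ 2 + c ^ 2))
    with (2 * exp (- (e * T)) * ((- e * cos (c * T) + c * sin (c * T)) / (e ^ 2 + c ^ 2)))
    by (field; nra).
  assert (Hx := exp_pos (- (e * T))).
  rewrite Rabs_mult, (Rabs_pos_eq (2 * _)) by lra.
  replace (4 * exp (- (e * T)) / e) with (2 * exp (- (e * T)) * (2 / e)) by (field; lra).
  apply Rmult_le_compat_l; [lra|].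
  unfold Rdiv at 1; rewrite Rabs_mult, (Rabs_pos_eq (/ _)) by (left; apply Rinv_0_lt_compat; assumption).
  apply Rle_div_l; [assumption|].
  apply Rle_trans with (e + Rabs c).
  - eapply Rle_trans; [apply Rabs_triang|]; rewrite !Rabs_mult, Rabs_Ropp, (Rabs_pos_eq e) by lra.
    generalize (COS_bound (c * T)) (SIN_bound (c * T)) (Rabs_pos c); intros.
    assert (Rabs (cos (c * T)) <= 1) by (apply Rabs_le_between; lra).
    assert (Rabs (sin (c * T)) <= 1) by (apply Rabs_le_between; lra).
    nra.
  - apply Rle_trans with ((2 * (e ^ 2 + c ^ 2)) / e); [|right; field; lra].
    apply Rle_div_r; [assumption|].
    rewrite <- (pow2_abs c); generalize (Rabs_pos c); nra.
Qed.

(** The primitive is an arctangent, so the mass missing from a window of radius [d] is the distance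
    of [atan] from its limits. *)
Lemma poisson_mass (e s d : R) : 0 < e -> 0 < d ->
  0 <= 1 - RInt (fun t => poisson e (s - t)) (s - d) (s + d) <= e / d.
Proof.
  intros He Hd; assert (HPI := PI_RGT_0).
  assert (cp := cts_poisson e He).
  rewrite (RInt_of_derive (fun t => / PI * atan (2 * PI * (t - s) / e))).
  2:{ intros t; auto_derive; [lra|]; unfold poisson.
      assert (H := poisson_den_pos e (s - t) He); unfold Rsqr.
      field; repeat split; lra. }
  2: cts_tac.
  replace (s + d - s) with d by ring; replace (s - d - s) with (- d) by ring.
  replace (2 * PI * - d / e) with (- (2 * PI * d / e)) by (field; lra).
  rewrite atan_opp.
  set (y := 2 * PI * d / e).
  assert (Hy : 0 < y) by (apply Rdiv_lt_0_compat; [nra | assumption]).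
  assert (A1 : atan y <= PI / 2) by (left; apply atan_bound).
  (* The left side is [atan (/ y)], and [atan z <= z] for positive [z] by the mean value theorem. *)
  assert (A2 : PI / 2 - atan y <= / y).
  { rewrite <- atan_inv by assumption.
    set (z := / y); assert (0 < z) by (apply Rinv_0_lt_compat; assumption).
    destruct (MVT_gen atan 0 z (fun x => / (1 + x ^ 2))) as [c [Hc E]].
    - intros x _; auto_derive; [trivial|]; unfold Rsqr; field; nra.
    - intros x _; apply derivable_continuous_pt, derivable_pt_atan.
    - rewrite atan_0, !Rminus_0_r in E; rewrite E.
      rewrite <- (Rmult_1_l z) at 2; apply Rmult_le_compat_r; [lra|].
      rewrite <- Rinv_1; apply Rinv_le_contravar; nra. }
  assert (E : 1 - (/ PI * atan y - / PI * - atan y) = / PI * (2 * (PI / 2 - atan y))) by (field; lra).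
  rewrite E.
  assert (0 < / PI) by (apply Rinv_0_lt_compat; assumption).
  split; [apply Rmult_le_pos; lra|].
  apply Rle_trans with (/ PI * (2 * / y)); [apply Rmult_le_compat_l; lra|].
  unfold y; replace (/ PI * (2 * / (2 * PI * d / e))) with ((e / d) * / (PI * PI)) by (field; lra).
  rewrite <- (Rmult_1_r (e / d)) at 2; apply Rmult_le_compat_l.
  - left; apply Rdiv_lt_0_compat; assumption.
  - rewrite <- Rinv_1; apply Rinv_le_contravar; [lra|].
    assert (2 <= PI) by (generalize PI2_1; lra); nra.
Qed.

(** Split at distance [d] from [s]. Near [s] the oscillation of [U] costs [eta]; far away the kernel
    is at most [e / d ^ 2], against the L1 bound [B]; the missing mass [e / d] weighs [U s]. No
    bound on the supremum of [U] enters. *)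
Lemma poisson_approx (U : R -> R) (B e d eta s Z : R) : cts U -> 0 < e -> 0 < d ->
  (forall t, Rabs (t - s) <= d -> Rabs (U t - U s) <= eta) ->
  abs_int U B -> Rabs s + d <= Z ->
  Rabs (RInt (fun t => U t * poisson e (s - t)) (- Z) Z - U s)
    <= eta + e / d ^ 2 * B + Rabs (U s) * (e / d).
Proof.
  intros cU He Hd Hosc HB HZ.
  assert (cp := cts_poisson e He).
  assert (Hs1 := Rle_abs s); assert (Hs2 := Rle_abs (- s)); rewrite Rabs_Ropp in Hs2.
  assert (Hs0 := Rabs_pos s).
  assert (ct : cts (fun t => U t * poisson e (s - t))) by cts_tac.
  assert (He2 : 0 < e / d ^ 2) by (apply Rdiv_lt_0_compat; [assumption | apply pow_lt; assumption]).
  assert (Hpi := fun t => poisson_pos e (s - t) He).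
  destruct (poisson_mass e s d He Hd) as [M1 M2].
  set (P := RInt (fun t => poisson e (s - t)) (s - d) (s + d)) in *.
  assert (Heta : 0 <= eta).
  { specialize (Hosc s); rewrite !Rminus_diag, Rabs_R0 in Hosc; apply Hosc; lra. }
  rewrite (RInt_c_Chasles _ (- Z) (s - d) Z ct), (RInt_c_Chasles _ (s - d) (s + d) Z ct).
  assert (far : forall t, d <= Rabs (s - t) -> Rabs (U t * poisson e (s - t)) <= e / d ^ 2 * Rabs (U t)).
  { intros t Ht; rewrite Rabs_mult, (Rabs_pos_eq (poisson e (s - t))) by apply Hpi.
    rewrite Rmult_comm; apply Rmult_le_compat_r; [apply Rabs_pos | apply poisson_far; assumption]. }
  assert (X1 : Rabs (RInt (fun t => U t * poisson e (s - t)) (- Z) (s - d)) <=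
     e / d ^ 2 * RInt (fun t => Rabs (U t)) (- Z) (s - d)).
  { rewrite <- RInt_c_scal by cts_tac; apply RInt_c_abs_le; try cts_tac; try lra.
    intros t Ht; apply far; rewrite Rabs_pos_eq; lra. }
  assert (X3 : Rabs (RInt (fun t => U t * poisson e (s - t)) (s + d) Z) <=
     e / d ^ 2 * RInt (fun t => Rabs (U t)) (s + d) Z).
  { rewrite <- RInt_c_scal by cts_tac; apply RInt_c_abs_le; try cts_tac; try lra.
    intros t Ht; apply far; rewrite Rabs_left1; lra. }
  assert (X2 : Rabs (RInt (fun t => U t * poisson e (s - t)) (s - d) (s + d) - U s * P) <= eta * P).
  { unfold P; rewrite <- !RInt_c_scal by cts_tac; rewrite <- RInt_c_minus by cts_tac.
    apply RInt_c_abs_le; try cts_tac; try lra.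
    intros t Ht; rewrite <- Rmult_minus_distr_r, Rabs_mult, (Rabs_pos_eq (poisson e (s - t))) by apply Hpi.
    apply Rmult_le_compat_r; [apply Hpi | apply Hosc; apply Rabs_le_between; lra]. }
  assert (X4 : RInt (fun t => Rabs (U t)) (- Z) (s - d) + RInt (fun t => Rabs (U t)) (s + d) Z <= B).
  { eapply Rle_trans; [|apply (HB Z); lra].
    assert (ca : cts (fun t => Rabs (U t))) by cts_tac.
    rewrite (RInt_c_Chasles _ (- Z) (s - d) Z ca), (RInt_c_Chasles _ (s - d) (s + d) Z ca).
    assert (0 <= RInt (fun t => Rabs (U t)) (s - d) (s + d)).
    { apply RInt_c_pos; auto; [lra | intros; apply Rabs_pos]. }
    lra. }
  assert (X5 : Rabs (U s * P - U s) <= Rabs (U s) * (e / d)).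
  { replace (U s * P - U s) with (- (U s * (1 - P))) by ring.
    rewrite Rabs_Ropp, Rabs_mult, (Rabs_pos_eq (1 - P)) by assumption.
    apply Rmult_le_compat_l; [apply Rabs_pos | assumption]. }
  assert (X6 : eta * P <= eta) by nra.
  assert (X7 := Rmult_le_compat_l _ _ _ (Rlt_le _ _ He2) X4).
  rewrite Rmult_plus_distr_l in X7.
  apply Rabs_le_between in X1; apply Rabs_le_between in X2; apply Rabs_le_between in X3.
  apply Rabs_le_between in X5; apply Rabs_le_between; lra.
Qed.

(** * Plancherel and inversion for the Hartley transform *)

Definition hartley (f : R -> R) (b x : R) : R :=
  RInt (fun t => f t * cas (2 * PI * x * t)) (- b) b.

Ltac ct := repeat first [progress cts_tac | apply cts_cas | apply cts2_cas].

Lemma cts_hartley (f : R -> R) (b : R) : cts f -> cts (hartley f b).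
Proof.
  intros Hf; apply (cts_RInt_param (fun x t => f t * cas (2 * PI * x * t))); ct.
Qed.

(** By [cas_mult] the product of two kernels is a cosine of the difference plus a sine of the sum;
    the sine is odd in [x] and drops out. What remains is a convolution with an approximate
    identity, so the transform is its own inverse. *)
Lemma hartley_kernel (U : R -> R) (Z e T s : R) : cts U ->
  RInt (fun x => abel e x * hartley U Z x * cas (2 * PI * x * s)) (- T) T =
  RInt (fun t => U t * abel_kernel e T (s - t)) (- Z) Z.
Proof.
  intros cU; assert (ca := cts_abel e).
  unfold hartley.
  rewrite (RInt_R_ext _ (fun x => RInt (fun t =>
     U t * (abel e x * (cas (2 * PI * x * t) * cas (2 * PI * x * s)))) (- Z) Z)).
  2:{ intros x; rewrite (Rmult_comm (abel e x)), Rmult_assoc, Rmult_comm.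
      rewrite <- RInt_c_scal by ct; apply RInt_R_ext; intros t; ring. }
  rewrite RInt_Fubini by ct.
  apply RInt_R_ext; intros t; rewrite RInt_c_scal by ct; f_equal.
  unfold abel_kernel.
  rewrite (RInt_R_ext _ (fun x => abel e x * cos (2 * PI * x * (s - t)) +
     abel e x * sin (2 * PI * x * (t + s)))).
  2:{ intros x; rewrite cas_mult, Rmult_plus_distr_l; do 3 f_equal; ring. }
  rewrite RInt_c_plus by ct.
  rewrite (RInt_odd (fun x => abel e x * sin (2 * PI * x * (t + s)))); [lra | ct |].
  intros x; unfold abel; rewrite Rabs_Ropp.
  replace (2 * PI * - x * (t + s)) with (- (2 * PI * x * (t + s))) by ring.
  rewrite sin_neg; ring.
Qed.

Lemma cts_abel_kernel (e T : R) : cts (abel_kernel e T).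
Proof.
  assert (ca := cts_abel e).
  apply (cts_RInt_param (fun v x => abel e x * cos (2 * PI * x * v))); ct.
Qed.

Lemma hartley_abel_sq (f : R -> R) (b e T : R) : cts f ->
  RInt (fun x => abel e x * hartley f b x ^ 2) (- T) T =
  RInt (fun s => f s * RInt (fun t => f t * abel_kernel e T (s - t)) (- b) b) (- b) b.
Proof.
  intros cf; assert (ca := cts_abel e); assert (ch := cts_hartley f b cf).
  rewrite (RInt_R_ext _ (fun x => RInt (fun s =>
    f s * (abel e x * hartley f b x * cas (2 * PI * x * s))) (- b) b)).
  2:{ intros x.
      rewrite (RInt_R_ext _ (fun s => (abel e x * hartley f b x) * (f s * cas (2 * PI * x * s))))
        by (intros; ring).
      rewrite RInt_c_scal by ct; fold (hartley f b x); ring. }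
  rewrite RInt_Fubini by ct.
  apply RInt_R_ext; intros s; rewrite RInt_c_scal by ct; f_equal.
  apply hartley_kernel, cf.
Qed.

(** Uniform continuity of [f] gives one [eta] for all [s], hence one [e1]. The cut-off [T0] has to
    depend on [e], since the truncation error decays like [exp (- (e * T))]. *)
Lemma hartley_abel_limit (f : R -> R) (b : R) : cts f -> 0 < b ->
  (forall x, x <= - b \/ b <= x -> f x = 0) ->
  forall e0, 0 < e0 -> exists e1, 0 < e1 /\ forall e, 0 < e <= e1 -> exists T0, 0 <= T0 /\
    forall T, T0 <= T ->
    Rabs (RInt (fun x => abel e x * hartley f b x ^ 2) (- T) T - RInt (fun s => f s ^ 2) (- b) b) <= e0.
Proof.
  intros cf Hb Hs e0 He0.
  (* The margin 1 makes room for windows of radius [d <= 1] around every point of [[- b, b]]. *)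
  set (Z := b + 1).
  set (B := RInt (fun x => Rabs (f x)) (- b) b).
  assert (HB : abs_int f B).
  { intros T HT; unfold B; destruct (Rle_lt_dec T b).
    - apply RInt_monotone_bounds; try cts_tac; try lra; intros; apply Rabs_pos.
    - right; apply RInt_zero_outside; try cts_tac; try lra.
      intros x Hx; rewrite Hs by assumption; apply Rabs_R0. }
  assert (HB0 : 0 <= B) by (apply RInt_c_pos; try cts_tac; try lra; intros; apply Rabs_pos).
  (* Three errors of size [eta] will arise: the truncation at [T], the oscillation of [f], and the
     remaining terms [e * K] of [poisson_approx]. Weighted by [|f s|] they integrate to at most
     [3 * eta * B]. *)
  set (eta := e0 / (4 * (B + 1))).
  assert (Heta : 0 < eta) by (apply Rdiv_lt_0_compat; lra).
  assert (Eeta : eta * (B + 1) = e0 / 4) by (unfold eta; field; lra).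
  destruct (@Heine_cor2 f (- Z) Z (fun x _ => cts_pt f cf x) (mkposreal _ Heta)) as [d0 Hd0].
  simpl in Hd0.
  set (d := Rmin 1 (d0 / 2)).
  assert (Hd0p := cond_pos d0).
  assert (Hd : 0 < d) by (apply Rmin_pos; lra).
  assert (Hd1 : d <= 1) by apply Rmin_l.
  assert (Hd2 : d < d0) by (apply Rle_lt_trans with (d0 / 2); [apply Rmin_r | lra]).
  destruct (continuity_ab_maj (fun x => Rabs (f x)) (- b) b) as [xm [Hxm _]]; [lra | |].
  { intros; apply cts_pt; cts_tac. }
  set (Mf := Rabs (f xm)) in Hxm.
  assert (HM0 : 0 <= Mf) by apply Rabs_pos.
  set (K := / d ^ 2 * B + Mf * / d).
  assert (HK : 0 <= K).
  { unfold K; assert (0 < / d ^ 2) by (apply Rinv_0_lt_compat, pow_lt; assumption).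
    assert (0 < / d) by (apply Rinv_0_lt_compat; assumption). nra. }
  exists (eta / (K + 1)); split; [apply Rdiv_lt_0_compat; lra|].
  intros e [He He1].
  assert (HeK : e * K <= eta).
  { apply Rle_trans with (eta / (K + 1) * (K + 1)); [|right; field; lra].
    apply Rmult_le_compat; lra. }
  (* [Q] dominates the factor of [exp (- (e * T))] in the truncation error; [T0] then makes their
     product at most [eta], by [1 + x <= exp x]. *)
  set (Q := 4 / e * (B + 1)).
  assert (HQ : 0 < Q).
  { unfold Q; apply Rmult_lt_0_compat; [apply Rdiv_lt_0_compat; lra | lra]. }
  exists (Rmax 0 (/ e * (Q / eta))); split; [apply Rmax_l|].
  intros T HT.
  assert (HT0 : 0 <= T) by (eapply Rle_trans; [apply Rmax_l | exact HT]).
  assert (HT1 : Q / eta <= e * T).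
  { apply Rle_trans with (e * (/ e * (Q / eta))).
    - right; field; lra.
    - apply Rmult_le_compat_l; [lra|]; eapply Rle_trans; [apply Rmax_r | exact HT]. }
  assert (HexpT : exp (- (e * T)) * Q <= eta).
  { rewrite exp_Ropp.
    assert (HT2 : Q <= e * T * eta) by (apply (proj1 (Rle_div_l Q (e * T) eta Heta)); exact HT1).
    assert (He' := exp_ineq1_le (e * T)).
    assert (0 < exp (e * T)) by apply exp_pos.
    apply Rmult_le_reg_l with (exp (e * T)); [assumption|].
    rewrite <- Rmult_assoc, Rinv_r, Rmult_1_l by lra. nra. }
  assert (ck := cts_abel_kernel e T).
  assert (cc : cts (fun s => RInt (fun t => f t * abel_kernel e T (s - t)) (- b) b)).
  { apply (cts_RInt_param (fun s t => f t * abel_kernel e T (s - t))); ct. }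
  rewrite hartley_abel_sq by assumption.
  rewrite <- RInt_c_minus by ct.
  apply Rle_trans with (RInt (fun s => (3 * eta) * Rabs (f s)) (- b) b).
  2:{ rewrite RInt_c_scal by cts_tac; fold B; nra. }
  apply RInt_c_abs_le; try cts_tac; try lra.
  intros s Hsb.
  replace (f s * RInt (fun t => f t * abel_kernel e T (s - t)) (- b) b - f s ^ 2)
    with ((RInt (fun t => f t * abel_kernel e T (s - t)) (- b) b - f s) * f s) by ring.
  rewrite Rabs_mult; apply Rmult_le_compat_r; [apply Rabs_pos|].
  assert (cp := cts_poisson e He).
  assert (X1 : Rabs (RInt (fun t => f t * abel_kernel e T (s - t)) (- b) b
      - RInt (fun t => f t * poisson e (s - t)) (- b) b) <= eta).
  { rewrite <- RInt_c_minus by cts_tac.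
    apply Rle_trans with (RInt (fun t => (4 * exp (- (e * T)) / e) * Rabs (f t)) (- b) b).
    - apply RInt_c_abs_le; try cts_tac; try lra.
      intros t _; rewrite <- Rmult_minus_distr_l, Rabs_mult, Rmult_comm.
      apply Rmult_le_compat_r; [apply Rabs_pos | apply abel_kernel_poisson; assumption].
    - rewrite RInt_c_scal by cts_tac; fold B.
      eapply Rle_trans; [|exact HexpT]; unfold Q.
      assert (0 < exp (- (e * T))) by apply exp_pos.
      assert (0 < / e) by (apply Rinv_0_lt_compat; assumption).
      unfold Rdiv.
      assert (0 <= exp (- (e * T)) * / e) by nra.
      nra. }
  assert (X2 : RInt (fun t => f t * poisson e (s - t)) (- b) b
     = RInt (fun t => f t * poisson e (s - t)) (- Z) Z).
  { symmetry; apply RInt_zero_outside; try cts_tac; unfold Z; try lra.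
    intros x Hx; rewrite Hs by assumption; ring. }
  rewrite X2 in X1.
  assert (X3 := poisson_approx f B e d eta s Z cf He Hd).
  assert (X4 : Rabs s <= b) by (apply Rabs_le_between; lra).
  specialize (X3 ltac:(intros t Ht; left; apply Hd0;
    [apply Rabs_le_between in Ht; unfold Z; lra | unfold Z; lra | lra]) HB ltac:(unfold Z; lra)).
  assert (X5 : e / d ^ 2 * B + Rabs (f s) * (e / d) <= e * K).
  { assert (Rabs (f s) <= Mf) by (apply Hxm; lra).
    unfold K, Rdiv; rewrite Rmult_plus_distr_l.
    assert (0 < e * / d) by (apply Rmult_lt_0_compat; [assumption | apply Rinv_0_lt_compat; assumption]).
    nra. }
  apply Rabs_le_between in X1; apply Rabs_le_between in X3; apply Rabs_le_between; lra.
Qed.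

(** For a nonnegative integrand Abel summability implies convergence: on a fixed interval the Abel
    factor is undone at the price [exp (e * T')], which tends to 1, and the reverse inequality is
    [abel e x <= 1]. *)
Theorem hartley_plancherel (f : R -> R) (b : R) : cts f -> 0 < b ->
  (forall x, x <= - b \/ b <= x -> f x = 0) ->
  is_int (fun x => hartley f b x ^ 2) (RInt (fun s => f s ^ 2) (- b) b).
Proof.
  intros cf Hb Hs.
  assert (ch := cts_hartley f b cf).
  set (N := RInt (fun s => f s ^ 2) (- b) b).
  assert (HN : 0 <= N) by (apply RInt_c_pos; try cts_tac; try lra; intros; apply pow2_ge_0).
  assert (Hlim := hartley_abel_limit f b cf Hb Hs).
  assert (Hq : forall x, 0 <= hartley f b x ^ 2) by (intros; apply pow2_ge_0).
  assert (ca := cts_abel).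
  assert (Hup : forall T', 0 <= T' -> RInt (fun x => hartley f b x ^ 2) (- T') T' <= N).
  { intros T' HT'; apply Rle_eps; intros e' He'.
    (* Since [e0 <= 1], the product [(1 + e0) * (N + e0)] is at most [N + e0 * (N + 2)], hence at
       most [N + e']. The factor [1 + e0] will bound [exp (e * T')]. *)
    set (e0 := Rmin 1 (e' / (N + 2))).
    assert (h1 : e0 <= 1) by apply Rmin_l.
    assert (h2 : e0 * (N + 2) <= e').
    { apply Rle_trans with (e' / (N + 2) * (N + 2)); [|right; field; lra].
      apply Rmult_le_compat_r; [lra | apply Rmin_r]. }
    assert (h3 : 0 < e0) by (apply Rmin_pos; [lra | apply Rdiv_lt_0_compat; lra]).
    destruct (Hlim e0 h3) as [e1 [He1 H1]].
    set (e := Rmin e1 (ln (1 + e0) / (T' + 1))).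
    assert (Hln : 0 < ln (1 + e0)) by (rewrite <- ln_1; apply ln_increasing; lra).
    assert (He : 0 < e) by (apply Rmin_pos; [lra | apply Rdiv_lt_0_compat; lra]).
    destruct (H1 e) as [T0 [p0 H0]]; [split; [assumption | apply Rmin_l]|].
    set (T := T0 + T').
    specialize (H0 T ltac:(unfold T; lra)).
    assert (Hex : e * T' <= ln (1 + e0)).
    { apply Rle_trans with (ln (1 + e0) / (T' + 1) * (T' + 1)); [|right; field; lra].
      apply Rmult_le_compat; try lra; apply Rmin_r. }
    assert (Hexp : exp (e * T') <= 1 + e0).
    { rewrite <- (exp_ln (1 + e0)) by lra; apply exp_le_mono, Hex. }
    assert (Y1 : RInt (fun x => hartley f b x ^ 2) (- T') T'
       <= exp (e * T') * RInt (fun x => abel e x * hartley f b x ^ 2) (- T') T').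
    { rewrite <- RInt_c_scal by (specialize (ca e); cts_tac).
      apply RInt_c_le; try (specialize (ca e); cts_tac); try lra.
      intros x Hx; rewrite <- Rmult_assoc.
      rewrite <- (Rmult_1_l (hartley f b x ^ 2)) at 1; apply Rmult_le_compat_r; [apply Hq|].
      unfold abel; rewrite <- exp_plus, <- exp_0; apply exp_le_mono.
      assert (Rabs x <= T') by (apply Rabs_le_between; lra).
      nra. }
    assert (Y2 : RInt (fun x => abel e x * hartley f b x ^ 2) (- T') T'
      <= RInt (fun x => abel e x * hartley f b x ^ 2) (- T) T).
    { apply RInt_monotone_bounds; try (specialize (ca e); cts_tac); unfold T; try lra.
      intros x; apply Rmult_le_pos; [left; apply abel_pos | apply Hq]. }
    assert (Y3 : 0 <= RInt (fun x => abel e x * hartley f b x ^ 2) (- T') T').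
    { apply RInt_c_pos; try (specialize (ca e); cts_tac); try lra.
      intros x _; apply Rmult_le_pos; [left; apply abel_pos | apply Hq]. }
    apply Rabs_le_between in H0; fold N in H0.
    assert (0 < exp (e * T')) by apply exp_pos.
    nra. }
  destruct (pos_int_lim (fun x => hartley f b x ^ 2) N) as [l [l1 [l2 l3]]]; auto; [cts_tac|].
  assert (N <= l).
  { apply Rle_eps; intros e0 He0.
    destruct (Hlim e0 He0) as [e1 [He1 H1]].
    destruct (H1 e1) as [T0 [p0 H0]]; [lra|].
    specialize (H0 T0 (Rle_refl _)); apply Rabs_le_between in H0; fold N in H0.
    assert (RInt (fun x => abel e1 x * hartley f b x ^ 2) (- T0) T0
      <= RInt (fun x => hartley f b x ^ 2) (- T0) T0).
    { apply RInt_c_le; try (specialize (ca e1); cts_tac); try lra.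
      intros x _; rewrite <- (Rmult_1_l (hartley f b x ^ 2)) at 2.
      apply Rmult_le_compat_r; [apply Hq | apply abel_le_1; lra]. }
    specialize (l2 T0 p0); lra. }
  replace N with l by lra; assumption.
Qed.

Lemma hartley_plus (f g : R -> R) (b x : R) : cts f -> cts g ->
  hartley (fun t => f t + g t) b x = hartley f b x + hartley g b x.
Proof.
  intros cf cg; unfold hartley; rewrite <- RInt_c_plus by ct.
  apply RInt_R_ext; intros; ring.
Qed.

Lemma hartley_minus (f g : R -> R) (b x : R) : cts f -> cts g ->
  hartley (fun t => f t - g t) b x = hartley f b x - hartley g b x.
Proof.
  intros cf cg; unfold hartley; rewrite <- RInt_c_minus by ct.
  apply RInt_R_ext; intros; ring.
Qed.

(** Polarisation of [hartley_plancherel]. *)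
Lemma hartley_parseval (f g : R -> R) (b : R) : cts f -> cts g -> 0 < b ->
  (forall x, x <= - b \/ b <= x -> f x = 0) -> (forall x, x <= - b \/ b <= x -> g x = 0) ->
  is_int (fun x => hartley f b x * hartley g b x) (RInt (fun s => f s * g s) (- b) b).
Proof.
  intros cf cg Hb Hf Hg.
  assert (chf := cts_hartley f b cf); assert (chg := cts_hartley g b cg).
  assert (H1 := hartley_plancherel (fun t => f t + g t) b ltac:(cts_tac) Hb
     ltac:(intros x Hx; cbv beta; rewrite Hf, Hg by assumption; ring)).
  assert (H2 := hartley_plancherel (fun t => f t - g t) b ltac:(cts_tac) Hb
     ltac:(intros x Hx; cbv beta; rewrite Hf, Hg by assumption; ring)).
  apply (is_int_scal _ (/ 4)) in H1;
    [|apply cts_pow, cts_hartley; cts_tac].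
  apply (is_int_scal _ (- / 4)) in H2;
    [|apply cts_pow, cts_hartley; cts_tac].
  assert (ch1 := cts_hartley (fun t => f t + g t) b ltac:(cts_tac)).
  assert (ch2 := cts_hartley (fun t => f t - g t) b ltac:(cts_tac)).
  assert (H3 := fun c1 c2 => is_int_plus _ _ _ _ c1 c2 H1 H2).
  specialize (H3 ltac:(cts_tac) ltac:(cts_tac)).
  rewrite <- !RInt_c_scal, <- RInt_c_plus in H3 by cts_tac.
  rewrite (RInt_R_ext (fun s => f s * g s) (fun x => / 4 * (f x + g x) ^ 2 + - / 4 * (f x - g x) ^ 2))
    by (intros; field).
  apply (is_int_ext (fun x => / 4 * hartley (fun t => f t + g t) b x ^ 2
     + - / 4 * hartley (fun t => f t - g t) b x ^ 2)); [|exact H3].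
  intros x; rewrite hartley_plus, hartley_minus by assumption; field.
Qed.

(** * The weight on the transform side: averaging over intervals of length 2 *)

Lemma sinc_RInt (y : R) : sinc y = / 2 * RInt (fun u => cos (y * u)) (-1) 1.
Proof.
  unfold sinc; destruct (Req_EM_T y 0) as [-> | Hy].
  - rewrite (RInt_R_ext _ (fun _ => 1)) by (intros; rewrite Rmult_0_l; apply cos_0).
    rewrite RInt_R_const; field.
  - rewrite (RInt_of_derive (fun u => sin (y * u) / y)).
    + replace (y * -1) with (- y) by ring; rewrite Rmult_1_r, sin_neg; field; assumption.
    + intros u; auto_derive; [trivial|]; field; assumption.
    + ct.
Qed.

(** The average of cosines passes smoothly through 0, so the removable singularity needs no separate
    treatment; the bound by 1 comes from the same formula. *)
Lemma cts_sinc : cts sinc.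
Proof.
  apply (cts_ext (fun y => / 2 * RInt (fun u => cos (y * u)) (-1) 1)).
  - intros y; symmetry; apply sinc_RInt.
  - apply (cts_mult (fun _ => / 2) (fun y => RInt (fun u => cos (y * u)) (-1) 1)); [cts_tac|].
    apply (cts_RInt_param (fun y u => cos (y * u))); ct.
Qed.

Lemma sinc_abs (y : R) : Rabs (sinc y) <= 1.
Proof.
  rewrite sinc_RInt, Rabs_mult, Rabs_pos_eq by lra.
  assert (Rabs (RInt (fun u => cos (y * u)) (-1) 1) <= (1 - -1) * 1).
  { apply RInt_c_abs_bound; [ct | lra|].
    intros x _; generalize (COS_bound (y * x)); intros; apply Rabs_le_between; lra. }
  lra.
Qed.

Definition ave (f : R -> R) (t : R) : R := / 2 * RInt f (t - 1) (t + 1).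

Lemma ave_RInt (f : R -> R) (t : R) : cts f -> ave f t = / 2 * RInt (fun u => f (t + u)) (-1) 1.
Proof.
  intros cf; unfold ave; f_equal.
  rewrite (RInt_R_ext (fun u => f (t + u)) (fun u => f (u + t))) by (intros; rewrite Rplus_comm; reflexivity).
  rewrite RInt_c_shift by assumption; f_equal; ring.
Qed.

Lemma cts_ave (f : R -> R) : cts f -> cts (ave f).
Proof.
  intros cf; apply (cts_ext (fun t => / 2 * RInt (fun u => f (t + u)) (-1) 1)).
  - intros y; symmetry; apply ave_RInt, cf.
  - apply (cts_mult (fun _ => / 2) (fun t => RInt (fun u => f (t + u)) (-1) 1)); [cts_tac|].
    apply (cts_RInt_param (fun t u => f (t + u))); ct.
Qed.

Lemma ave_zero (f : R -> R) (b t : R) : (forall x, x <= - b \/ b <= x -> f x = 0) ->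
  t <= - (b + 1) \/ b + 1 <= t -> ave f t = 0.
Proof.
  intros H Ht; unfold ave; rewrite (RInt_R_ext_in _ (fun _ => 0)).
  - rewrite RInt_R_const; ring.
  - lra.
  - intros x Hx; apply H; lra.
Qed.

(** Convolution theorem. The interval is longer by 1 at each end, so that every translate of the
    support by [u] in [[-1, 1]] fits and the limits return to [- b] and [b] after the shift. The cas
    kernel is not multiplicative, but the term that spoils this is odd in [u] and integrates to
    zero. *)
Lemma hartley_ave (f : R -> R) (b x : R) : cts f -> 0 < b ->
  (forall x, x <= - b \/ b <= x -> f x = 0) ->
  hartley (ave f) (b + 1) x = sinc (2 * PI * x) * hartley f b x.
Proof.
  intros cf Hb Hs; assert (ca := cts_ave f cf); unfold hartley.
  rewrite (RInt_R_ext _ (fun t => RInt (fun u => / 2 * (f (t + u) * cas (2 * PI * x * t))) (-1) 1)).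
  2:{ intros t; rewrite RInt_c_scal by ct; rewrite ave_RInt by assumption.
      rewrite Rmult_assoc; f_equal; rewrite Rmult_comm, <- RInt_c_scal by ct.
      apply RInt_R_ext; intros; ring. }
  rewrite RInt_Fubini by ct.
  rewrite (RInt_R_ext_in _ (fun u => RInt (fun t => / 2 * (f t * cas (2 * PI * x * (t - u)))) (- b) b)).
  2: lra.
  2:{ intros u Hu.
      rewrite (RInt_R_ext _ (fun t => / 2 * (f (t + u) * cas (2 * PI * x * (t + u - u)))))
        by (intros t; do 3 f_equal; ring).
      rewrite (RInt_c_shift (fun t => / 2 * (f t * cas (2 * PI * x * (t - u))))) by ct.
      apply RInt_zero_outside; [ct | lra | lra |].
      intros t Ht; rewrite Hs by assumption; ring. }
  rewrite RInt_Fubini by ct.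
  rewrite <- RInt_c_scal by ct.
  apply RInt_R_ext; intros t.
  rewrite sinc_RInt.
  rewrite (RInt_R_ext _ (fun u => (/ 2 * f t * cas (2 * PI * x * t)) * cos (2 * PI * x * u) +
    (/ 2 * f t * (sin (2 * PI * x * t) - cos (2 * PI * x * t))) * sin (2 * PI * x * u))).
  2:{ intros u; unfold cas; rewrite (Rmult_minus_distr_l (2 * PI * x)), cos_minus, sin_minus; ring. }
  rewrite RInt_c_plus, !RInt_c_scal by ct.
  assert (O : RInt (fun u => sin (2 * PI * x * u)) (-1) 1 = 0).
  { apply (RInt_odd (fun u => sin (2 * PI * x * u)) 1); [ct|].
    intros u; rewrite <- sin_neg; f_equal; ring. }
  rewrite O; ring.
Qed.

Lemma hartley_wider (f : R -> R) (b c x : R) : cts f -> 0 < b <= c ->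
  (forall x, x <= - b \/ b <= x -> f x = 0) -> hartley f c x = hartley f b x.
Proof.
  intros cf Hb Hs; unfold hartley; apply RInt_zero_outside; [ct | lra | lra |].
  intros t Ht; rewrite Hs by assumption; ring.
Qed.

Lemma cts_W : cts W.
Proof. assert (c := cts_sinc); unfold W; cts_tac. Qed.

Lemma W_bounds (x : R) : 0 <= W x <= 2.
Proof. unfold W; generalize (sinc_abs (2 * PI * x)); intros H; apply Rabs_le_between in H; lra. Qed.

(** [W] is 1 plus [sinc]: Plancherel treats the first summand, and Parseval the second, on the wider
    interval that contains the support of [ave f]. *)
Theorem hartley_W (f : R -> R) (b : R) : cts f -> 0 < b ->
  (forall x, x <= - b \/ b <= x -> f x = 0) ->
  is_int (fun x => hartley f b x ^ 2 * W x)
    (RInt (fun s => f s ^ 2) (- b) b + RInt (fun s => f s * ave f s) (- b) b).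
Proof.
  intros cf Hb Hs.
  assert (cs := cts_sinc); assert (ch := cts_hartley f b cf); assert (ca := cts_ave f cf).
  apply (is_int_ext (fun x => hartley f b x ^ 2 + hartley f (b + 1) x * hartley (ave f) (b + 1) x)).
  { intros x; rewrite hartley_ave, (hartley_wider f b (b + 1)) by (assumption || lra).
    unfold W; ring. }
  apply is_int_plus; [cts_tac | | |].
  - apply cts_mult; apply cts_hartley; assumption.
  - apply hartley_plancherel; assumption.
  - rewrite <- (RInt_zero_outside (fun s => f s * ave f s) (- b) b (- (b + 1)) (b + 1)).
    + apply hartley_parseval; auto; try lra.
      * intros x Hx; apply Hs; lra.
      * intros x Hx; apply (ave_zero f b); assumption.
    + cts_tac.
    + lra.
    + lra.
    + intros x Hx; rewrite Hs by assumption; ring.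
Qed.

(** * Inversion for integrable functions *)

Lemma RInt_symm_diff (f g : R -> R) (Z Z' : R) : cts f -> cts g -> 0 <= Z <= Z' ->
  (forall x, Rabs (f x) <= g x) ->
  Rabs (RInt f (- Z') Z' - RInt f (- Z) Z) <= RInt g (- Z') Z' - RInt g (- Z) Z.
Proof.
  intros cf cg HZ H.
  rewrite (RInt_c_Chasles f (- Z') (- Z) Z' cf), (RInt_c_Chasles f (- Z) Z Z' cf).
  rewrite (RInt_c_Chasles g (- Z') (- Z) Z' cg), (RInt_c_Chasles g (- Z) Z Z' cg).
  assert (H1 : Rabs (RInt f (- Z') (- Z)) <= RInt g (- Z') (- Z))
    by (apply RInt_c_abs_le; auto; lra).
  assert (H2 : Rabs (RInt f Z Z') <= RInt g Z Z') by (apply RInt_c_abs_le; auto; lra).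
  apply Rabs_le_between in H1; apply Rabs_le_between in H2; apply Rabs_le_between; lra.
Qed.

(** The tail of the integral of [2 * |U|] dominates all truncation errors at once, so the
    convergence is uniform in [t] and the limit inherits continuity. *)
Lemma hartley_transform (U : R -> R) (B : R) : cts U -> abs_int U B ->
  exists h : R -> R, cts h /\ (forall t, is_int (fun x => U x * cas (2 * PI * t * x)) (h t)) /\
    forall e, 0 < e -> exists Z0, 0 <= Z0 /\ forall Z t, Z0 <= Z -> Rabs (h t - hartley U Z t) <= e.
Proof.
  intros cU HB.
  assert (cabs : cts (fun x => Rabs (U x))) by cts_tac.
  assert (cint : forall t, cts (fun x => U x * cas (2 * PI * t * x))) by (intros; ct).
  assert (Hdom : forall t x, Rabs (U x * cas (2 * PI * t * x)) <= 2 * Rabs (U x)).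
  { intros t x; rewrite Rabs_mult, Rmult_comm.
    apply Rmult_le_compat_r; [apply Rabs_pos | apply cas_abs]. }
  assert (Hex : forall t, exists l, is_int (fun x => U x * cas (2 * PI * t * x)) l).
  { intros t; destruct (abs_int_ex (fun x => U x * cas (2 * PI * t * x)) (2 * B)) as [l [_ Hl]].
    - apply cint.
    - apply (abs_int_dom _ (fun x => 2 * Rabs (U x))); [apply cint | cts_tac | apply Hdom |].
      intros T HT.
      rewrite (RInt_R_ext _ (fun x => 2 * Rabs (U x)))
        by (intros; apply Rabs_pos_eq; generalize (Rabs_pos (U x)); lra).
      rewrite RInt_c_scal by cts_tac; specialize (HB T HT); lra.
    - exists l; assumption. }
  set (h := fun t => proj1_sig (constructive_indefinite_description _ (Hex t))).
  assert (Hh : forall t, is_int (fun x => U x * cas (2 * PI * t * x)) (h t)).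
  { intros t; unfold h; apply (proj2_sig (constructive_indefinite_description _ (Hex t))). }
  assert (Hunif : forall e, 0 < e -> exists Z0, 0 <= Z0 /\
     forall Z t, Z0 <= Z -> Rabs (h t - hartley U Z t) <= e).
  { intros e He.
    destruct (pos_int_lim (fun x => Rabs (U x)) B) as [l [_ [Hl1 Hl2]]]; auto.
    { intros; apply Rabs_pos. }
    destruct (Hl2 (e / 4)) as [Z0 [pZ0 HZ0]]; [lra|].
    exists Z0; split; [assumption|]; intros Z t HZ.
    apply Rle_eps; intros e' He'.
    destruct (Hh t e' He') as [Z1 [pZ1 HZ1]].
    set (Z' := Z + Z1); specialize (HZ1 Z' ltac:(unfold Z'; lra)).
    assert (X := RInt_symm_diff (fun x => U x * cas (2 * PI * t * x)) (fun x => 2 * Rabs (U x)) Z Z'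
       (cint t) ltac:(cts_tac) ltac:(unfold Z'; lra) (Hdom t)).
    rewrite !RInt_c_scal in X by cts_tac.
    assert (Y1 := HZ0 Z HZ); assert (Y2 := Hl1 Z' ltac:(unfold Z'; lra)).
    fold (hartley U Z t) in X; fold (hartley U Z' t) in X, HZ1.
    apply Rabs_le_between in X; apply Rabs_le_between in Y1; apply Rabs_le_between in HZ1.
    apply Rabs_le_between; lra. }
  exists h; repeat split; auto.
  apply cts_of_pt; intros t e He.
  destruct (Hunif (e / 4)) as [Z [pZ HZ]]; [lra|].
  destruct (cts_pt _ (cts_hartley U Z cU) t (e / 4)) as [d [Hd Hdd]]; [lra|].
  exists d; split; [assumption|]; intros y Hy; specialize (Hdd y Hy).
  simpl in *; unfold R_dist in *.
  assert (H1 := HZ Z t (Rle_refl _)); assert (H2 := HZ Z y (Rle_refl _)).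
  apply Rabs_le_between in H1; apply Rabs_le_between in H2.
  apply Rabs_lt_between in Hdd; apply Rabs_lt_between; lra.
Qed.

(** [h] is the transform of [U], which the hypothesis makes vanish off [(- a, a)]. The Abel means
    [I e] of the inverse integral tend to [U x] by the Poisson kernel, and to [hartley h a x]
    because the support of [h] is bounded. *)
Theorem hartley_inversion (U : R -> R) (B a : R) : cts U -> abs_int U B -> 0 < a ->
  (forall t, a <= Rabs t -> is_int (fun x => U x * cas (2 * PI * t * x)) 0) ->
  exists h, cts h /\ (forall t, t <= - a \/ a <= t -> h t = 0) /\ forall x, U x = hartley h a x.
Proof.
  intros cU HB Ha H0.
  destruct (hartley_transform U B cU HB) as [h [ch [Hh Hunif]]].
  assert (HB0 : 0 <= B).
  { eapply Rle_trans; [|apply (HB 0 (Rle_refl _))].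
    apply RInt_c_pos; [cts_tac | lra | intros; apply Rabs_pos]. }
  assert (hz : forall t, t <= - a \/ a <= t -> h t = 0).
  { intros t Ht; apply (is_int_unique (fun x => U x * cas (2 * PI * t * x))); [apply Hh|].
    apply H0; destruct Ht; [rewrite Rabs_left1 by lra | rewrite Rabs_pos_eq by lra]; lra. }
  exists h; repeat split; auto.
  intros x.
  set (I := fun e => RInt (fun t => abel e t * h t * cas (2 * PI * t * x)) (- a) a).
  assert (ca := cts_abel).
  (* for fixed e the cut-off A >= a of the dual variable is immaterial, so it can be sent to infinity *)
  assert (step : forall e d eta, 0 < e -> 0 < d ->
    (forall t, Rabs (t - x) <= d -> Rabs (U t - U x) <= eta) ->
    Rabs (I e - U x) <= eta + e / d ^ 2 * B + Rabs (U x) * (e / d)).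
  { intros e d eta He Hd Hosc; apply Rle_eps; intros e' He'.
    assert (cp := cts_poisson e He).
    set (A := Rmax a (/ e * (4 * B / e / (e' / 2)))).
    assert (HA : a <= A) by apply Rmax_l.
    assert (HeA : 4 * B / e / (e' / 2) <= e * A).
    { apply Rle_trans with (e * (/ e * (4 * B / e / (e' / 2)))); [right; field; lra|].
      apply Rmult_le_compat_l; [lra | apply Rmax_r]. }
    assert (HexpA : exp (- (e * A)) * (4 * B / e) <= e' / 2).
    { rewrite exp_Ropp.
      assert (HT2 : 4 * B / e <= e * A * (e' / 2)).
      { apply (proj1 (Rle_div_l (4 * B / e) (e * A) (e' / 2) ltac:(lra))); exact HeA. }
      assert (E1 := exp_ineq1_le (e * A)); assert (E2 := exp_pos (e * A)).
      apply Rmult_le_reg_l with (exp (e * A)); [assumption|].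
      rewrite <- Rmult_assoc, Rinv_r, Rmult_1_l by lra. nra. }
    destruct (Hunif (e' / 2 / (4 * A))) as [Z0 [pZ0 HZ0]]; [apply Rdiv_lt_0_compat; lra|].
    set (Z := Z0 + Rabs x + d).
    assert (Hx0 := Rabs_pos x).
    assert (ck := cts_abel_kernel e A).
    specialize (ca e).
    assert (chU := cts_hartley U Z cU).
    assert (E1 : I e = RInt (fun t => abel e t * h t * cas (2 * PI * t * x)) (- A) A).
    { symmetry; apply RInt_zero_outside; [ct | lra | lra |].
      intros t Ht; rewrite hz by assumption; ring. }
    assert (X1 : Rabs (I e - RInt (fun t => abel e t * hartley U Z t * cas (2 * PI * t * x)) (- A) A)
       <= e' / 2).
    { rewrite E1, <- RInt_c_minus by ct.
      eapply Rle_trans; [apply (RInt_c_abs_bound _ (- A) A (2 * (e' / 2 / (4 * A)))) |].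
      - ct.
      - lra.
      - intros t _.
        replace (abel e t * h t * cas (2 * PI * t * x) - abel e t * hartley U Z t * cas (2 * PI * t * x))
          with (abel e t * (cas (2 * PI * t * x) * (h t - hartley U Z t))) by ring.
        rewrite !Rabs_mult, (Rabs_pos_eq (abel e t)) by (left; apply abel_pos).
        apply Rle_trans with (1 * (2 * (e' / 2 / (4 * A)))); [|right; apply Rmult_1_l].
        apply Rmult_le_compat; [left; apply abel_pos | | apply abel_le_1; lra |].
        + apply Rmult_le_pos; apply Rabs_pos.
        + apply Rmult_le_compat; try apply Rabs_pos; [apply cas_abs | apply HZ0; unfold Z; lra].
      - right; field; lra. }
    rewrite hartley_kernel in X1 by assumption.
    assert (X2 : Rabs (RInt (fun t => U t * abel_kernel e A (x - t)) (- Z) Z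
        - RInt (fun t => U t * poisson e (x - t)) (- Z) Z) <= e' / 2).
    { rewrite <- RInt_c_minus by cts_tac.
      apply Rle_trans with (RInt (fun t => (4 * exp (- (e * A)) / e) * Rabs (U t)) (- Z) Z).
      - apply RInt_c_abs_le; try cts_tac; try (unfold Z; lra).
        intros t _; rewrite <- Rmult_minus_distr_l, Rabs_mult, Rmult_comm.
        apply Rmult_le_compat_r; [apply Rabs_pos | apply abel_kernel_poisson; lra].
      - rewrite RInt_c_scal by cts_tac.
        eapply Rle_trans; [|exact HexpA].
        replace (exp (- (e * A)) * (4 * B / e)) with (4 * exp (- (e * A)) / e * B) by (field; lra).
        apply Rmult_le_compat_l; [|apply HB; unfold Z; lra].
        apply Rle_mult_inv_pos; [generalize (exp_pos (- (e * A))); lra | assumption]. }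
    assert (X3 := poisson_approx U B e d eta x Z cU He Hd Hosc HB ltac:(unfold Z; lra)).
    apply Rabs_le_between in X1; apply Rabs_le_between in X2; apply Rabs_le_between in X3.
    apply Rabs_le_between; lra. }
  apply cond_eq; intros eps Heps.
  (* On [[- a, a]] the Abel factor differs from 1 by at most [e * a]. *)
  assert (Hlim : exists e1, 0 < e1 /\ forall e, 0 < e <= e1 -> Rabs (I e - hartley h a x) <= eps / 4).
  { set (K := RInt (fun t => Rabs (h t)) (- a) a).
    assert (HK : 0 <= K) by (apply RInt_c_pos; [cts_tac | lra | intros; apply Rabs_pos]).
    exists (eps / 4 / (2 * a * (K + 1))); split.
    { apply Rdiv_lt_0_compat; [lra|]; apply Rmult_lt_0_compat; lra. }
    intros e [He1 He2]; specialize (ca e); unfold I, hartley.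
    rewrite <- RInt_c_minus by ct.
    apply Rle_trans with (RInt (fun t => (2 * (e * a)) * Rabs (h t)) (- a) a).
    - apply RInt_c_abs_le; try ct; try lra.
      intros t Ht.
      replace (abel e t * h t * cas (2 * PI * t * x) - h t * cas (2 * PI * x * t))
        with ((abel e t - 1) * cas (2 * PI * t * x) * h t)
        by (replace (2 * PI * x * t) with (2 * PI * t * x) by ring; ring).
      rewrite Rabs_mult; apply Rmult_le_compat_r; [apply Rabs_pos|].
      rewrite Rabs_mult, (Rmult_comm 2 (e * a)).
      apply Rmult_le_compat; try apply Rabs_pos; [|apply cas_abs].
      assert (Rabs t <= a) by (apply Rabs_le_between; lra).
      assert (A1 := abel_le_1 e t ltac:(lra)).
      assert (A2 := exp_ineq1_le (- (e * Rabs t))); fold (abel e t) in A2.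
      apply Rabs_le_between; split; nra.
    - rewrite RInt_c_scal by cts_tac; fold K.
      apply Rle_trans with (eps / 4 / (2 * a * (K + 1)) * (2 * a * (K + 1))); [|right; field; lra].
      replace (2 * (e * a) * K) with (e * (2 * a * K)) by ring.
      apply Rmult_le_compat; try lra; nra. }
  destruct Hlim as [e1 [He1 H1]].
  destruct (cts_pt U cU x (eps / 8)) as [d0 [Hd0 Hd]]; [lra|].
  set (d := d0 / 2).
  assert (Hdp : 0 < d) by (unfold d; lra).
  set (K := / d ^ 2 * B + Rabs (U x) * / d).
  assert (HK : 0 <= K).
  { unfold K; assert (0 < / d ^ 2) by (apply Rinv_0_lt_compat, pow_lt; assumption).
    assert (0 < / d) by (apply Rinv_0_lt_compat; assumption).
    generalize (Rabs_pos (U x)); nra. }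
  set (e := Rmin e1 (eps / 8 / (K + 1))).
  assert (He : 0 < e) by (apply Rmin_pos; [assumption | apply Rdiv_lt_0_compat; lra]).
  assert (HeK : e * K <= eps / 8).
  { apply Rle_trans with (eps / 8 / (K + 1) * (K + 1)); [|right; field; lra].
    apply Rmult_le_compat; try lra; apply Rmin_r. }
  specialize (H1 e (conj He (Rmin_l _ _))).
  assert (X := step e d (eps / 8) He Hdp).
  specialize (X ltac:(intros t Ht; destruct (Req_dec t x) as [-> | Hne];
    [rewrite Rminus_diag, Rabs_R0; lra
    | left; apply Hd; split; [split; [exact Logic.I | auto] | simpl; unfold R_dist, d in *; lra]])).
  assert (e / d ^ 2 * B + Rabs (U x) * (e / d) = e * K) by (unfold K; field; lra).
  apply Rabs_le_between in X; apply Rabs_le_between in H1; apply Rabs_lt_between; lra.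
Qed.

(** * The spectrum of the averaging operator on an interval *)

(** Applied both to the L2 product and to the form in [rayleigh_sup]. The latter is only known to be
    semidefinite, so [C = 0] has to be covered. *)
Lemma quadratic_discriminant (A B C : R) : 0 <= C -> (forall l, 0 <= A + 2 * l * B + l ^ 2 * C) ->
  B ^ 2 <= A * C.
Proof.
  intros HC0 H.
  destruct (Req_dec C 0) as [-> | HC].
  - destruct (Req_dec B 0) as [-> | HB]; [lra|].
    (* With [C = 0] the expression is affine in [l]; this [l] gives it the value [-1]. *)
    exfalso; specialize (H (- (A + 1) / (2 * B))).
    replace (A + 2 * (- (A + 1) / (2 * B)) * B + (- (A + 1) / (2 * B)) ^ 2 * 0) with (-1) in H
      by (field; assumption).
    lra.
  - specialize (H (- B / C)).
    replace (A + 2 * (- B / C) * B + (- B / C) ^ 2 * C) with ((A * C - B ^ 2) / C) in H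
      by (field; assumption).
    assert (E : 0 <= (A * C - B ^ 2) / C * C) by (apply Rmult_le_pos; lra).
    replace ((A * C - B ^ 2) / C * C) with (A * C - B ^ 2) in E by (field; assumption).
    lra.
Qed.

Lemma RInt_Cauchy_Schwarz (f g : R -> R) (a b : R) : cts f -> cts g -> a <= b ->
  RInt (fun t => f t * g t) a b ^ 2 <= RInt (fun t => f t ^ 2) a b * RInt (fun t => g t ^ 2) a b.
Proof.
  intros cf cg Hab; apply quadratic_discriminant.
  - apply RInt_c_pos; [cts_tac | assumption | intros; apply pow2_ge_0].
  - intros l; rewrite <- !RInt_c_scal by cts_tac; rewrite <- !RInt_c_plus by cts_tac.
    apply RInt_c_pos; [cts_tac | assumption |].
    intros x _; replace (f x ^ 2 + 2 * l * (f x * g x) + l ^ 2 * g x ^ 2) with ((f x + l * g x) ^ 2) by ring.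
    apply pow2_ge_0.
Qed.

Lemma RInt_c_pos_strict (g : R -> R) (a b x0 : R) : cts g -> a < b -> a <= x0 <= b ->
  (forall x, 0 <= g x) -> 0 < g x0 -> 0 < RInt g a b.
Proof.
  intros cg Hab Hx Hg H0.
  destruct (cts_pt g cg x0 (g x0 / 2)) as [d [Hd H]]; [lra|].
  simpl in H; unfold R_dist in H.
  assert (near : forall x, Rabs (x - x0) < d -> g x0 / 2 <= g x).
  { intros x Hxd; destruct (Req_dec x x0) as [-> | Hne]; [lra|].
    specialize (H x (conj (conj Logic.I (not_eq_sym Hne)) Hxd)).
    apply Rabs_lt_between in H; lra. }
  set (c := Rmax a (x0 - d / 2)); set (e := Rmin b (x0 + d / 2)).
  assert (Hc1 : a <= c) by apply Rmax_l; assert (Hc2 : x0 - d / 2 <= c) by apply Rmax_r.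
  assert (He1 : e <= b) by apply Rmin_l; assert (He2 : e <= x0 + d / 2) by apply Rmin_r.
  assert (Hce : c < e).
  { unfold c, e; apply Rmax_lub_lt; apply Rmin_glb_lt; lra. }
  apply Rlt_le_trans with (RInt g c e).
  - apply Rlt_le_trans with ((e - c) * (g x0 / 2)); [apply Rmult_lt_0_compat; lra|].
    rewrite <- RInt_R_const; apply RInt_c_le; [cts_tac | assumption | lra |].
    intros x Hxx; apply near; apply Rabs_lt_between; lra.
  - apply RInt_monotone_bounds; auto; lra.
Qed.

Lemma is_derive_shift (F : R -> R) (c t l : R) : is_derive F (t - c) l ->
  is_derive (fun x => F (x - c)) t l.
Proof.
  intros H.
  assert (H1 : is_derive (fun x => x - c) t 1) by (auto_derive; [trivial | ring]).
  assert (D := is_derive_comp F (fun x => x - c) t l 1 H H1).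
  replace l with (scal 1 l) by exact (Rmult_1_l l); exact D.
Qed.

(** The nearest point of [[- a, a]]. Clamping the limits of an integral restricts the integrand to
    [[- a, a]] while the function itself stays continuous on the line, so a jump at the end points
    costs nothing. *)
Definition clamp (a x : R) : R := Rmax (- a) (Rmin a x).

Lemma cts_max (f : R -> R) (c : R) : cts f -> cts (fun x => Rmax c (f x)).
Proof.
  intros cf; apply (cts_ext (fun x => / 2 * (c + f x + Rabs (c - f x)))); [|cts_tac].
  intros y; unfold Rmax, Rabs; destruct (Rle_dec c (f y)), (Rcase_abs (c - f y)); lra.
Qed.

Lemma cts_min (f : R -> R) (c : R) : cts f -> cts (fun x => Rmin c (f x)).
Proof.
  intros cf; apply (cts_ext (fun x => / 2 * (c + f x - Rabs (c - f x)))); [|cts_tac].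
  intros y; unfold Rmin, Rabs; destruct (Rle_dec c (f y)), (Rcase_abs (c - f y)); lra.
Qed.

Lemma cts_clamp (a : R) (f : R -> R) : cts f -> cts (fun x => clamp a (f x)).
Proof. intros cf; apply (cts_max (fun x => Rmin a (f x))), cts_min, cf. Qed.

Lemma clamp_id (a x : R) : - a <= x <= a -> clamp a x = x.
Proof. intros H; unfold clamp; rewrite Rmin_right, Rmax_right; lra. Qed.

Lemma clamp_ge (a x : R) : 0 <= a <= x -> clamp a x = a.
Proof. intros H; unfold clamp; rewrite Rmin_left, Rmax_right; lra. Qed.

Lemma clamp_le (a x : R) : 0 <= a -> x <= - a -> clamp a x = - a.
Proof. intros H H'; unfold clamp; rewrite Rmin_right, Rmax_left; lra. Qed.

Lemma clamp_range (a x : R) : 0 <= a -> - a <= clamp a x <= a.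
Proof.
  intros H; unfold clamp; split; [apply Rmax_l|].
  apply Rmax_lub; [lra | apply Rmin_l].
Qed.

(* The compression of [ave] to functions living on [-a, a]. *)
Definition Top (a : R) (f : R -> R) (t : R) : R :=
  / 2 * RInt f (clamp a (t - 1)) (clamp a (t + 1)).

Lemma cts_Top (a : R) (f : R -> R) : cts f -> cts (Top a f).
Proof.
  intros cf; apply (cts_ext (fun t => / 2 * (RInt f 0 (clamp a (t + 1)) - RInt f 0 (clamp a (t - 1))))).
  - intros t; unfold Top.
    rewrite (RInt_c_Chasles f 0 (clamp a (t - 1)) (clamp a (t + 1)) cf); simpl; lra.
  - assert (cG := cts_RInt_upper f 0 cf).
    apply cts_mult; [cts_tac|].
    apply cts_minus; apply (cts_comp (fun y => RInt f 0 y)); try assumption; apply cts_clamp; cts_tac.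
Qed.

Lemma Top_lin (a : R) (f g : R -> R) (l m t : R) : cts f -> cts g ->
  Top a (fun x => l * f x + m * g x) t = l * Top a f t + m * Top a g t.
Proof.
  intros cf cg; unfold Top; rewrite RInt_c_plus, !RInt_c_scal by cts_tac; ring.
Qed.

Lemma Top_abs (a : R) (f : R -> R) (t : R) : cts f -> 0 <= a ->
  Rabs (Top a f t) <= / 2 * RInt (fun x => Rabs (f x)) (- a) a.
Proof.
  intros cf Ha; unfold Top; rewrite Rabs_mult, Rabs_pos_eq by lra.
  apply Rmult_le_compat_l; [lra|].
  assert (H1 := clamp_range a (t - 1) Ha); assert (H2 := clamp_range a (t + 1) Ha).
  assert (H3 : clamp a (t - 1) <= clamp a (t + 1)).
  { unfold clamp; apply Rle_max_compat_l, Rle_min_compat_l; lra. }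
  eapply Rle_trans; [apply RInt_c_abs; assumption|].
  apply RInt_monotone_bounds; [cts_tac | intros; apply Rabs_pos | lra | lra].
Qed.

(** * Norm, quadratic form and symmetry of the compressed operator *)

Definition Nrm (a : R) (f : R -> R) : R := RInt (fun t => f t ^ 2) (- a) a.
Definition Qf (a : R) (f : R -> R) : R := RInt (fun t => f t * Top a f t) (- a) a.

Lemma Nrm_pos (a : R) (f : R -> R) : cts f -> 0 <= a -> 0 <= Nrm a f.
Proof. intros; apply RInt_c_pos; [cts_tac | lra | intros; apply pow2_ge_0]. Qed.

Lemma RInt_abs_sq (a : R) (f : R -> R) : cts f -> 0 <= a ->
  RInt (fun x => Rabs (f x)) (- a) a ^ 2 <= 2 * a * Nrm a f.
Proof.
  intros cf Ha.
  assert (H := RInt_Cauchy_Schwarz (fun x => Rabs (f x)) (fun _ => 1) (- a) a ltac:(cts_tac)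
    ltac:(cts_tac) ltac:(lra)).
  rewrite (RInt_R_ext (fun t => Rabs (f t) * 1) (fun x => Rabs (f x))) in H by (intros; ring).
  rewrite (RInt_R_ext (fun t => Rabs (f t) ^ 2) (fun x => f x ^ 2)) in H by (intros; apply pow2_abs).
  rewrite RInt_R_const in H; unfold Nrm; simpl in *; lra.
Qed.

(** Cauchy-Schwarz bounds the square of [T f] pointwise by [a / 2 * Nrm a f]; over the length
    [2 * a] this gives the factor [a ^ 2 <= 1]. *)
Lemma Nrm_Top (a : R) (f : R -> R) : cts f -> 0 <= a <= 1 -> Nrm a (Top a f) <= Nrm a f.
Proof.
  intros cf Ha; assert (cT := cts_Top a f cf).
  assert (HN := Nrm_pos a f cf ltac:(lra)).
  assert (H := RInt_abs_sq a f cf ltac:(lra)).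
  apply Rle_trans with (RInt (fun _ => / 4 * (2 * a * Nrm a f)) (- a) a).
  - apply RInt_c_le; [cts_tac | cts_tac | lra |].
    intros t _; rewrite <- pow2_abs.
    apply Rle_trans with ((/ 2 * RInt (fun x => Rabs (f x)) (- a) a) ^ 2).
    + apply pow_incr; split; [apply Rabs_pos | apply Top_abs; [assumption | lra]].
    + rewrite Rpow_mult_distr; simpl in *; lra.
  - rewrite RInt_R_const; nra.
Qed.

(** Expand the nonnegative norms of [f + T f] and [f - T f] and insert [Nrm_Top]. *)
Lemma Qf_bound (a : R) (f : R -> R) : cts f -> 0 <= a <= 1 -> Rabs (Qf a f) <= Nrm a f.
Proof.
  intros cf Ha; assert (cT := cts_Top a f cf).
  assert (H := Nrm_Top a f cf Ha).
  assert (E1 : RInt (fun t => (f t + Top a f t) ^ 2) (- a) a = Nrm a f + 2 * Qf a f + Nrm a (Top a f)).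
  { unfold Nrm, Qf; rewrite <- RInt_c_scal, <- !RInt_c_plus by cts_tac.
    apply RInt_R_ext; intros; ring. }
  assert (E2 : RInt (fun t => (f t - Top a f t) ^ 2) (- a) a = Nrm a f - 2 * Qf a f + Nrm a (Top a f)).
  { unfold Nrm, Qf; rewrite <- RInt_c_scal, <- RInt_c_minus, <- !RInt_c_plus by cts_tac.
    apply RInt_R_ext; intros; ring. }
  assert (0 <= RInt (fun t => (f t + Top a f t) ^ 2) (- a) a)
    by (apply RInt_c_pos; [cts_tac | lra | intros; apply pow2_ge_0]).
  assert (0 <= RInt (fun t => (f t - Top a f t) ^ 2) (- a) a)
    by (apply RInt_c_pos; [cts_tac | lra | intros; apply pow2_ge_0]).
  apply Rabs_le_between; lra.
Qed.

(** Both limits are clamped here. For [a <= / 2] this zone is all of [[- a, a]] and [T] has rank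
    one; for larger [a] it is the middle one of three zones, between those of [Top_left] and
    [Top_right]. *)
Lemma Top_small (a : R) (f : R -> R) (t : R) : cts f -> 0 <= a -> a - 1 <= t <= 1 - a ->
  Top a f t = / 2 * RInt f (- a) a.
Proof.
  intros cf Ha Ht; unfold Top; rewrite clamp_le by lra; rewrite clamp_ge by lra; reflexivity.
Qed.

Lemma Top_right (a : R) (f : R -> R) (t : R) : 0 <= a <= 1 -> 1 - a <= t <= a ->
  Top a f t = / 2 * RInt f (t - 1) a.
Proof.
  intros Ha Ht; unfold Top; rewrite (clamp_ge a (t + 1)) by lra.
  rewrite clamp_id by lra; reflexivity.
Qed.

Lemma Top_left (a : R) (f : R -> R) (t : R) : 0 <= a <= 1 -> - a <= t <= a - 1 ->
  Top a f t = / 2 * RInt f (- a) (t + 1).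
Proof.
  intros Ha Ht; unfold Top; rewrite (clamp_le a (t - 1)) by lra.
  rewrite clamp_id by lra; reflexivity.
Qed.

(** [main] evaluates the pairing through primitives: integration by parts on the right zone,
    followed by a translation by 1, carries that contribution to the left zone. The resulting
    expression is symmetric in [f] and [g]. *)
Lemma Top_symm (a : R) (f g : R -> R) : / 2 < a <= 1 -> cts f -> cts g ->
  RInt (fun t => f t * Top a g t) (- a) a = RInt (fun t => g t * Top a f t) (- a) a.
Proof.
  intros Ha.
  set (P := fun (f : R -> R) x => RInt f (- a) x).
  set (X := fun f g => RInt (fun t => f t * P g (t + 1)) (- a) (a - 1)).
  assert (main : forall f g, cts f -> cts g -> RInt (fun t => f t * Top a g t) (- a) a =
     / 2 * (X f g + X g f - P g a * P f (a - 1) + P g a * P f a - P f a * P g (a - 1))).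
  { clear f g; intros f g cf cg.
    assert (cT := cts_Top a g cg).
    assert (cPf : cts (P f)) by (apply cts_RInt_upper, cf).
    assert (cPg : cts (P g)) by (apply cts_RInt_upper, cg).
    rewrite (RInt_c_Chasles _ (- a) (a - 1) a), (RInt_c_Chasles _ (a - 1) (1 - a) a) by cts_tac.
    rewrite (RInt_R_ext_in _ (fun t => / 2 * (f t * P g (t + 1))) (- a) (a - 1)); [| lra |].
    2:{ intros t Ht; rewrite Top_left by lra; unfold P; ring. }
    rewrite (RInt_R_ext_in _ (fun t => (/ 2 * P g a) * f t) (a - 1) (1 - a)); [| lra |].
    2:{ intros t Ht; rewrite Top_small by (assumption || lra); unfold P; ring. }
    rewrite (RInt_R_ext_in _ (fun t => / 2 * P g a * f t - / 2 * (P g (t - 1) * f t)) (1 - a) a); [| lra |].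
    2:{ intros t Ht; rewrite Top_right by lra; unfold P.
        rewrite (RInt_c_Chasles g (- a) (t - 1) a cg); ring. }
    rewrite RInt_c_minus, !RInt_c_scal by cts_tac.
    rewrite (RInt_by_parts (fun t => P g (t - 1)) (P f) (fun t => g (t - 1)) f).
    2:{ intros t; apply is_derive_shift, is_derive_RInt_c, cg. }
    2:{ intros t; apply (is_derive_RInt_c f (- a) t cf). }
    2: cts_tac.
    2: cts_tac.
    rewrite (RInt_R_ext (fun x => g (x - 1) * P f x) (fun x => (fun y => g y * P f (y + 1)) (x + -1))).
    2:{ intros x; cbv beta; f_equal; f_equal; ring. }
    rewrite (RInt_c_shift (fun y => g y * P f (y + 1))) by cts_tac.
    replace (1 - a + -1) with (- a) by ring; replace (a + -1) with (a - 1) by ring.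
    replace (1 - a - 1) with (- a) by ring.
    fold (X g f) (X f g).
    assert (E0 : P g (- a) = 0) by (unfold P; apply (RInt_point (V := R_CompleteNormedModule))).
    rewrite E0.
    assert (E1 : RInt f (a - 1) (1 - a) = P f (1 - a) - P f (a - 1)).
    { unfold P; rewrite (RInt_c_Chasles f (- a) (a - 1) (1 - a) cf); simpl; lra. }
    assert (E2 : RInt f (1 - a) a = P f a - P f (1 - a)).
    { unfold P; rewrite (RInt_c_Chasles f (- a) (1 - a) a cf); simpl; lra. }
    rewrite E1, E2; simpl; ring. }
  intros cf cg; rewrite !main by assumption; as_R; ring.
Qed.

(** * The eigenvalue equation as a boundary value problem on [[1 - a, a]] *)

Section Kernel.

Variables (a mu : R).
Hypothesis Ha : / 2 < a <= 1.
Hypothesis Hmu : mu <> 0.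

Let w := / (2 * mu).
(** The angle turned across [[1 - a, a]], whose length is [2 * a - 1]. Likewise [ka] is [w] times
    the length [2 * (1 - a)] of the middle zone, on which the eigenfunction is constant. *)
Let th := w * (2 * a - 1).
Let ka := 2 * w * (1 - a).

(* The determinant of the boundary conditions for the rotation [R' = - w L], [L' = w R] solved by
   [R t = f t] and [L t = f (t - 1)], in terms of the values [p] and [q] of [R] and [L] at [1 - a]. *)
Let det := (sin th - 1) * (1 - sin th) - cos th * (cos th - 1 - ka).

(** Modulo [sin ^ 2 + cos ^ 2 = 1], [det] is twice the difference of the two sides of the
    equation. *)
Lemma det_eta_eq : eta_eq (2 * a) mu <-> det = 0.
Proof.
  unfold eta_eq, det.
  replace ((2 * a - 1) / (2 * mu)) with th by (unfold th, w; field; assumption).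
  replace ((2 - 2 * a) / (4 * mu)) with (ka / 2) by (unfold ka, w; field; assumption).
  assert (H := sin2_cos2 th); unfold Rsqr in H.
  split; [intros [_ E] | intros E; split; [assumption|]]; nra.
Qed.

Lemma eigenfunction : det = 0 -> exists f, cts f /\ 0 < Nrm a f /\ Qf a f = mu * Nrm a f.
Proof.
  intros Hdet.
  (* A null vector of the boundary matrix. If [cos th] vanishes, [det = 0] forces [sin th = 1], and
     [(0, 1)] works; otherwise [(cos th, 1 - sin th)] solves the first row and [det = 0] is the
     second. *)
  assert (Hpq : exists p q, (p <> 0 \/ q <> 0) /\ p * (sin th - 1) + q * cos th = 0 /\
    p * (cos th - 1 - ka) + q * (1 - sin th) = 0).
  { unfold det in Hdet; destruct (Req_dec (cos th) 0) as [Hc | Hc].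
    - exists 0, 1; rewrite Hc in *; repeat split; [right; lra | lra | nra].
    - exists (cos th), (1 - sin th); repeat split; [left; assumption | ring | lra]. }
  destruct Hpq as [p [q [Hnz [E1 E2]]]].
  set (Rr := fun t => p * cos (w * (t - (1 - a))) - q * sin (w * (t - (1 - a)))).
  set (Ll := fun t => p * sin (w * (t - (1 - a))) + q * cos (w * (t - (1 - a)))).
  assert (cR : cts Rr) by (unfold Rr; cts_tac).
  assert (cL : cts Ll) by (unfold Ll; cts_tac).
  assert (R0 : Rr (1 - a) = p) by (unfold Rr; rewrite Rminus_diag, Rmult_0_r, cos_0, sin_0; ring).
  assert (L0 : Ll (1 - a) = q) by (unfold Ll; rewrite Rminus_diag, Rmult_0_r, cos_0, sin_0; ring).
  assert (Eth : w * (a - (1 - a)) = th) by (unfold th; ring).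
  assert (R1 : Rr a = p + ka * p - q) by (unfold Rr; rewrite Eth; lra).
  assert (L1 : Ll a = p) by (unfold Ll; rewrite Eth; lra).
  assert (IL : forall s t, w * RInt Ll s t = Rr s - Rr t).
  { intros s t; rewrite <- RInt_c_scal by assumption.
    rewrite (RInt_of_derive (fun t => - Rr t)); [as_R; ring | | cts_tac].
    intros x; unfold Rr, Ll; auto_derive; [trivial | unfold Rminus; ring]. }
  assert (IR : forall s t, w * RInt Rr s t = Ll t - Ll s).
  { intros s t; rewrite <- RInt_c_scal by assumption.
    rewrite (RInt_of_derive Ll); [as_R; ring | | cts_tac].
    intros x; unfold Rr, Ll; auto_derive; [trivial | unfold Rminus; ring]. }
  (* One formula glues the three zones: outside its own zone each summand is frozen at the value
     [p], by [R0] and [L1], and the subtracted [p] removes it. *)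
  set (v := fun t => Rr (Rmax (1 - a) t) + Ll (Rmin (a - 1) t + 1) - p).
  assert (cv : cts v).
  { unfold v; apply cts_minus; [apply cts_plus | cts_tac].
    - apply (cts_comp Rr); [assumption | apply cts_max; cts_tac].
    - apply (cts_comp Ll); [assumption | apply cts_plus; [apply cts_min | ]; cts_tac]. }
  assert (vr : forall t, 1 - a <= t -> v t = Rr t).
  { intros t Ht; unfold v; rewrite Rmax_right, Rmin_left by lra.
    replace (a - 1 + 1) with a by ring; lra. }
  assert (vl : forall t, t <= a - 1 -> v t = Ll (t + 1)).
  { intros t Ht; unfold v; rewrite Rmax_left, Rmin_right by lra; lra. }
  assert (vm : forall t, a - 1 <= t <= 1 - a -> v t = p).
  { intros t Ht; unfold v; rewrite Rmax_left, Rmin_left by lra.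
    replace (a - 1 + 1) with a by ring; lra. }
  (* [v] is going to be [T f], so the eigenfunction is [v / mu], and [/ mu = 2 * w]. *)
  set (f := fun t => 2 * w * v t).
  assert (cf : cts f) by (unfold f; cts_tac).
  assert (Hw : 2 * w * mu = 1) by (unfold w; field; assumption).
  assert (Iv : forall s t, / 2 * RInt f s t = w * RInt v s t).
  { intros s t; unfold f; rewrite RInt_c_scal by assumption; simpl; lra. }
  assert (Ir : forall t, 1 - a <= t -> w * RInt v (1 - a) t = Ll t - q).
  { intros t Ht; rewrite (RInt_R_ext_in v Rr) by (try assumption; intros; apply vr; lra).
    rewrite IR; lra. }
  assert (Il : forall s t, s <= t <= a - 1 -> w * RInt v s t = Rr (s + 1) - Rr (t + 1)).
  { intros s t Ht; rewrite (RInt_R_ext_in v (fun t => Ll (t + 1))) by (try lra; intros; apply vl; lra).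
    rewrite RInt_c_shift by assumption; apply IL. }
  assert (Im : w * RInt v (a - 1) (1 - a) = ka * p).
  { rewrite (RInt_R_ext_in v (fun _ => p)) by (try lra; intros; apply vm; lra).
    rewrite RInt_R_const; unfold ka; ring. }
  (* Splitting the integral of [v] at the zone boundaries [a - 1] and [1 - a] leaves the wanted
     value plus constants, which cancel by [R1] and [L1]. *)
  assert (TE : forall t, - a <= t <= a -> Top a f t = v t).
  { intros t Ht.
    destruct (Rle_lt_dec (1 - a) t) as [H1|H1]; [|destruct (Rle_lt_dec t (a - 1)) as [H2|H2]].
    - rewrite Top_right, Iv, vr by lra.
      rewrite (RInt_c_Chasles v (t - 1) (a - 1) a cv), (RInt_c_Chasles v (a - 1) (1 - a) a cv).
      rewrite !Rmult_plus_distr_l, Im, Ir, Il by lra.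
      replace (t - 1 + 1) with t by ring; replace (a - 1 + 1) with a by ring; lra.
    - rewrite Top_left, Iv, vl by lra.
      rewrite (RInt_c_Chasles v (- a) (a - 1) _ cv), (RInt_c_Chasles v (a - 1) (1 - a) _ cv).
      rewrite !Rmult_plus_distr_l, Im, Ir, Il by lra.
      replace (- a + 1) with (1 - a) by ring; replace (a - 1 + 1) with a by ring; lra.
    - rewrite Top_small, Iv, vm by (assumption || lra).
      rewrite (RInt_c_Chasles v (- a) (a - 1) _ cv), (RInt_c_Chasles v (a - 1) (1 - a) _ cv).
      rewrite !Rmult_plus_distr_l, Im, Ir, Il by lra.
      replace (- a + 1) with (1 - a) by ring; replace (a - 1 + 1) with a by ring; lra. }
  exists f; repeat split; [assumption | |].
  (* [v] takes the values [p] at [1 - a] and [q] at [- a], and these are not both zero. *)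
  - assert (Hx : exists x0, - a <= x0 <= a /\ v x0 <> 0).
    { destruct Hnz as [Hp | Hq].
      - exists (1 - a); split; [lra|]; rewrite vr by lra; rewrite R0; assumption.
      - exists (- a); split; [lra|]; rewrite vl by lra; replace (- a + 1) with (1 - a) by ring.
        rewrite L0; assumption. }
    destruct Hx as [x0 [Hx0 Hv0]].
    apply (RInt_c_pos_strict _ (- a) a x0); [cts_tac | lra | assumption | intros; apply pow2_ge_0 |].
    apply pow2_gt_0; unfold f; intros E; apply Hv0.
    replace (v x0) with (mu * (2 * w * v x0)) 
      by (transitivity (2 * w * mu * v x0); [ring | rewrite Hw; ring]).
    rewrite E; ring.
  - unfold Qf, Nrm; rewrite <- RInt_c_scal by cts_tac.
    apply RInt_R_ext_in; [lra|]; intros t Ht; rewrite TE by assumption.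
    replace (v t) with (mu * f t); [ring|].
    unfold f; transitivity (2 * w * mu * v t); [ring | rewrite Hw; ring].
Qed.

(** Put [h = mu f - T f]. The values of [T f] on the two outer zones solve the rotation with forcing
    [w * h], so up to multiples of the L1 norm [K] of [h] they are determined by [p] and [q]. The
    boundary conditions are a linear system for [p] and [q] with right-hand side of order [K],
    solvable since [det <> 0]. Hence [T f], and with it [f], is controlled by [h]. *)
Lemma resolvent_bound : det <> 0 -> exists c, 0 < c /\
  forall f, cts f -> c * Nrm a f <= Nrm a (fun t => mu * f t - Top a f t).
Proof.
  intros Hdet.
  assert (Hw : 2 * w * mu = 1) by (unfold w; field; assumption).
  set (aw := Rabs w).
  assert (Haw : 0 <= aw) by apply Rabs_pos.
  set (k2 := Rabs (cos th - 1 - ka)).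
  assert (Hk2 : 0 <= k2) by apply Rabs_pos.
  (* Coefficients from Cramer's rule at [pdet] and [qdet]: [r2] is at most [2 * aw * K], [r3 - r1]
     at most [3 * aw * K], and [1 - sin th] at most 2. *)
  set (Cp := / Rabs det * (2 * (2 * aw) + 3 * aw)).
  set (Cq := / Rabs det * (2 * (3 * aw) + 2 * aw * k2)).
  assert (Hdi : 0 < / Rabs det) by (apply Rinv_0_lt_compat, Rabs_pos_lt, Hdet).
  assert (HCp : 0 <= Cp) by (apply Rmult_le_pos; [lra | lra]).
  assert (HCq : 0 <= Cq) by (apply Rmult_le_pos; [lra | nra]).
  set (C2 := Cp + Cq + 2 * aw).
  (* From [(h + T f) ^ 2 <= 2 * (h ^ 2 + (C2 * K) ^ 2)], integrated over a length [2 * a], with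
     [K ^ 2 <= 2 * a * Nrm a h]. *)
  set (C := 2 / mu ^ 2 * (1 + 2 * a * C2 ^ 2 * (2 * a))).
  assert (Hmu2 : 0 < mu ^ 2) by (apply pow2_gt_0; assumption).
  assert (HC : 0 < C).
  { apply Rmult_lt_0_compat; [apply Rdiv_lt_0_compat; lra|].
    assert (0 <= C2 ^ 2) by apply pow2_ge_0; nra. }
  exists (/ C); split; [apply Rinv_0_lt_compat; assumption|].
  intros f cf.
  assert (cT := cts_Top a f cf).
  set (h := fun t => mu * f t - Top a f t).
  assert (ch : cts h) by (unfold h; cts_tac).
  apply (Rmult_le_reg_l C); [assumption|].
  rewrite <- Rmult_assoc, Rinv_r, Rmult_1_l by lra.
  set (K := RInt (fun t => Rabs (h t)) (- a) a).
  assert (HK : 0 <= K) by (apply RInt_c_pos; [cts_tac | lra | intros; apply Rabs_pos]).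
  assert (HK2 : K ^ 2 <= 2 * a * Nrm a h) by (apply RInt_abs_sq; [assumption | lra]).
  assert (fE : forall t, f t = 2 * w * (h t + Top a f t)).
  { intros t; unfold h; transitivity (2 * w * mu * f t); [rewrite Hw; ring | ring]. }
  (* On [[1 - a, a]] these are [T f] at [s] and at [s - 1]; together they describe [T f] on both
     outer zones. *)
  set (Rr := fun s => / 2 * RInt f (s - 1) a).
  set (Ll := fun s => / 2 * RInt f (- a) s).
  assert (dR : forall s, is_derive Rr s (- (/ 2 * f (s - 1)))).
  { intros s; unfold Rr.
    apply (is_derive_ext (fun s => / 2 * RInt f 0 a - / 2 * RInt f 0 (s - 1))).
    - intros t; rewrite (RInt_c_Chasles f 0 (t - 1) a cf); as_R; simpl; ring.
    - assert (D := is_derive_shift (fun y => RInt f 0 y) 1 s _ (is_derive_RInt_c f 0 (s - 1) cf)).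
      assert (D1 := is_derive_minus (fun _ => / 2 * RInt f 0 a) (fun t => / 2 * RInt f 0 (t - 1)) s _ _
        (is_derive_const _ _) (is_derive_scal _ s (/ 2) _ D)).
      replace (- (/ 2 * f (s - 1))) with (minus zero (/ 2 * f (s - 1)));
        [exact D1 | unfold minus, plus, opp, zero; simpl; ring]. }
  assert (dL : forall s, is_derive Ll s (/ 2 * f s)).
  { intros s; apply (is_derive_scal (fun y => RInt f (- a) y) s (/ 2)), is_derive_RInt_c, cf. }
  assert (cR := is_derive_cts _ _ dR); assert (cL := is_derive_cts _ _ dL).
  set (cc := fun s => cos (w * (s - (1 - a)))); set (ss := fun s => sin (w * (s - (1 - a)))).
  assert (dc : forall s, is_derive cc s (- w * ss s))
    by (intros s; unfold cc, ss; auto_derive; [trivial | unfold Rminus; ring]).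
  assert (ds : forall s, is_derive ss s (w * cc s))
    by (intros s; unfold cc, ss; auto_derive; [trivial | unfold Rminus; ring]).
  assert (cc' := is_derive_cts _ _ dc); assert (cs' := is_derive_cts _ _ ds).
  assert (bc : forall s, Rabs (cc s) <= 1)
    by (intros s; generalize (COS_bound (w * (s - (1 - a)))); intros; apply Rabs_le_between; assumption).
  assert (bs : forall s, Rabs (ss s) <= 1)
    by (intros s; generalize (SIN_bound (w * (s - (1 - a)))); intros; apply Rabs_le_between; assumption).
  assert (Hrot : forall s, cc s ^ 2 + ss s ^ 2 = 1).
  { intros s; unfold cc, ss; generalize (sin2_cos2 (w * (s - (1 - a)))); unfold Rsqr; lra. }
  assert (fR : forall s, 1 - a <= s <= a -> / 2 * f s = w * h s + w * Rr s).
  { intros s Hs; rewrite fE, Top_right by lra; unfold Rr; as_R; simpl; lra. }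
  assert (fL : forall s, 1 - a <= s <= a -> / 2 * f (s - 1) = w * h (s - 1) + w * Ll s).
  { intros s Hs; rewrite fE, Top_left by lra; unfold Ll; replace (s - 1 + 1) with s by ring; lra. }
  set (p := Rr (1 - a)); set (q := Ll (1 - a)).
  assert (c0 : cc (1 - a) = 1) by (unfold cc; rewrite Rminus_diag, Rmult_0_r; apply cos_0).
  assert (s0 : ss (1 - a) = 0) by (unfold ss; rewrite Rminus_diag, Rmult_0_r; apply sin_0).
  (* Shifted by 1, the first integral runs over [[- a, s - 1]], which does not overlap [[1 - a, s]];
     a single [K] therefore pays for both. *)
  assert (Hh : forall s, 1 - a <= s <= a ->
    RInt (fun t => aw * Rabs (h (t - 1)) + aw * Rabs (h t)) (1 - a) s <= aw * K).
  { intros s Hs; rewrite RInt_c_plus, !RInt_c_scal by cts_tac.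
    rewrite <- Rmult_plus_distr_l; apply Rmult_le_compat_l; [assumption|].
    rewrite (RInt_R_ext _ (fun t => (fun y => Rabs (h y)) (t + -1)))
      by (intros; cbv beta; do 2 f_equal; ring).
    assert (cah : cts (fun y => Rabs (h y))) by cts_tac.
    rewrite (RInt_c_shift (fun y => Rabs (h y))) by assumption.
    unfold K; rewrite (RInt_c_Chasles _ (- a) (s + -1) a cah), (RInt_c_Chasles _ (s + -1) (1 - a) a cah),
      (RInt_c_Chasles _ (1 - a) s a cah).
    replace (1 - a + -1) with (- a) by ring.
    assert (0 <= RInt (fun y => Rabs (h y)) (s + -1) (1 - a))
      by (apply RInt_c_pos; [assumption | lra | intros; apply Rabs_pos]).
    assert (0 <= RInt (fun y => Rabs (h y)) s a)
      by (apply RInt_c_pos; [assumption | lra | intros; apply Rabs_pos]).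
    simpl in *; lra. }
  assert (bnd : forall c1 c2 x y, Rabs c1 <= 1 -> Rabs c2 <= 1 ->
     Rabs (w * (c1 * x + c2 * y)) <= aw * Rabs x + aw * Rabs y).
  { intros c1 c2 x y H1 H2; rewrite Rabs_mult; fold aw; rewrite <- Rmult_plus_distr_l.
    apply Rmult_le_compat_l; [assumption|].
    eapply Rle_trans; [apply Rabs_triang|]; rewrite !Rabs_mult.
    generalize (Rabs_pos x) (Rabs_pos y); intros; nra. }
  (* In the rotating frame the homogeneous terms cancel and the derivative contains [h] only:
     variation of constants. *)
  assert (HA : forall s, 1 - a <= s <= a -> Rabs (cc s * Rr s + ss s * Ll s - p) <= aw * K).
  { intros s Hs; eapply Rle_trans; [|apply (Hh s Hs)].
    assert (E := RInt_of_derive (fun s => cc s * Rr s + ss s * Ll s)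
      (fun s => - w * ss s * Rr s + cc s * (- (/ 2 * f (s - 1))) + (w * cc s * Ll s + ss s * (/ 2 * f s)))
      (1 - a) s).
    cbv beta in E; rewrite c0, s0, Rmult_1_l, Rmult_0_l, Rplus_0_r in E; fold p in E.
    rewrite <- E; [| | cts_tac].
    2:{ intros x; apply (is_derive_plus (fun s => cc s * Rr s) (fun s => ss s * Ll s));
        [apply (is_derive_mult cc Rr) | apply (is_derive_mult ss Ll)]; auto; intros; apply Rmult_comm. }
    rewrite (RInt_R_ext_in _ (fun t => w * (- cc t * h (t - 1) + ss t * h t))); [|lra|].
    2:{ intros x Hx; rewrite (fR x), (fL x) by lra; ring. }
    apply RInt_c_abs_le; [cts_tac | cts_tac | lra |].
    intros x Hx; apply bnd; [rewrite Rabs_Ropp; apply bc | apply bs]. }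
  assert (HB : forall s, 1 - a <= s <= a -> Rabs (cc s * Ll s - ss s * Rr s - q) <= aw * K).
  { intros s Hs; eapply Rle_trans; [|apply (Hh s Hs)].
    assert (E := RInt_of_derive (fun s => cc s * Ll s - ss s * Rr s)
      (fun s => - w * ss s * Ll s + cc s * (/ 2 * f s) - (w * cc s * Rr s + ss s * (- (/ 2 * f (s - 1)))))
      (1 - a) s).
    cbv beta in E; rewrite c0, s0, Rmult_1_l, Rmult_0_l, Rminus_0_r in E; fold q in E.
    rewrite <- E; [| | cts_tac].
    2:{ intros x; apply (is_derive_minus (fun s => cc s * Ll s) (fun s => ss s * Rr s));
        [apply (is_derive_mult cc Ll) | apply (is_derive_mult ss Rr)]; auto; intros; apply Rmult_comm. }
    rewrite (RInt_R_ext_in _ (fun t => w * (ss t * h (t - 1) + cc t * h t))); [|lra|].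
    2:{ intros x Hx; rewrite (fR x), (fL x) by lra; ring. }
    apply RInt_c_abs_le; [cts_tac | cts_tac | lra |].
    intros x Hx; apply bnd; [apply bs | apply bc]. }
  assert (two : forall c1 c2 x y, Rabs c1 <= 1 -> Rabs c2 <= 1 -> Rabs x <= aw * K -> Rabs y <= aw * K ->
     Rabs (c1 * x + c2 * y) <= 2 * aw * K).
  { intros c1 c2 x y H1 H2 H3 H4; eapply Rle_trans; [apply Rabs_triang|]; rewrite !Rabs_mult.
    generalize (Rabs_pos x) (Rabs_pos y) (Rabs_pos c1) (Rabs_pos c2); intros; nra. }
  assert (HR : forall s, 1 - a <= s <= a -> Rabs (Rr s - (p * cc s - q * ss s)) <= 2 * aw * K).
  { intros s Hs.
    replace (Rr s - (p * cc s - q * ss s)) with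
      (cc s * (cc s * Rr s + ss s * Ll s - p) + - ss s * (cc s * Ll s - ss s * Rr s - q)).
    2:{ transitivity ((cc s ^ 2 + ss s ^ 2) * Rr s - (p * cc s - q * ss s)); [ring | rewrite Hrot; ring]. }
    apply two; auto; rewrite Rabs_Ropp; apply bs. }
  assert (HL : forall s, 1 - a <= s <= a -> Rabs (Ll s - (p * ss s + q * cc s)) <= 2 * aw * K).
  { intros s Hs.
    replace (Ll s - (p * ss s + q * cc s)) with
      (ss s * (cc s * Rr s + ss s * Ll s - p) + cc s * (cc s * Ll s - ss s * Rr s - q)).
    2:{ transitivity ((cc s ^ 2 + ss s ^ 2) * Ll s - (p * ss s + q * cc s)); [ring | rewrite Hrot; ring]. }
    apply two; auto. }
  assert (ca : cc a = cos th) by (unfold cc, th; f_equal; ring).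
  assert (sa : ss a = sin th) by (unfold ss, th; f_equal; ring).
  set (r1 := Rr a - (p * cc a - q * ss a)); set (r2 := Ll a - (p * ss a + q * cc a)).
  assert (Hr1 : Rabs r1 <= 2 * aw * K) by (apply HR; lra).
  assert (Hr2 : Rabs r2 <= 2 * aw * K) by (apply HL; lra).
  set (r3 := w * RInt h (a - 1) (1 - a)).
  assert (Hr3 : Rabs r3 <= aw * K).
  { unfold r3; rewrite Rabs_mult; fold aw; apply Rmult_le_compat_l; [assumption|].
    eapply Rle_trans; [apply RInt_c_abs; [assumption | lra]|].
    apply RInt_monotone_bounds; [cts_tac | intros; apply Rabs_pos | lra | lra]. }
  assert (pE : p = / 2 * RInt f (- a) a).
  { unfold p, Rr; replace (1 - a - 1) with (- a) by ring; reflexivity. }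
  assert (bL : Ll a = p) by (rewrite pE; reflexivity).
  (* The integral of [f] over [[- a, a]], cut into its three zones; on the middle one [T f] is the
     constant [p], up to the forcing [r3]. *)
  assert (bR : Rr a + q = p + ka * p + r3).
  { assert (M : / 2 * RInt f (a - 1) (1 - a) = r3 + ka * p).
    { rewrite (RInt_R_ext_in f (fun t => 2 * w * h t + 2 * w * p)); [|lra|].
      2:{ intros t Ht; rewrite fE, Top_small, pE by (assumption || lra); ring. }
      rewrite RInt_c_plus, RInt_c_scal, RInt_R_const by cts_tac.
      unfold r3, ka; as_R; simpl; field. }
    assert (S1 := RInt_c_Chasles f (- a) (a - 1) a cf).
    assert (S2 := RInt_c_Chasles f (a - 1) (1 - a) a cf).
    assert (S3 := RInt_c_Chasles f (- a) (a - 1) (1 - a) cf).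
    unfold Rr, q, Ll; simpl in *; lra. }
  assert (row1 : p * (sin th - 1) + q * cos th = - r2) by (unfold r2; rewrite sa, ca, bL; ring).
  assert (row2 : p * (cos th - 1 - ka) + q * (1 - sin th) = r3 - r1).
  { unfold r1; rewrite sa, ca; lra. }
  assert (Sb : 0 <= 1 - sin th <= 2) by (generalize (SIN_bound th); lra).
  assert (Cb : Rabs (cos th) <= 1) by (generalize (COS_bound th); intros; apply Rabs_le_between; lra).
  assert (pdet : p * det = - r2 * (1 - sin th) - cos th * (r3 - r1)).
  { unfold det; rewrite <- row2; replace (- r2) with (p * (sin th - 1) + q * cos th) by exact row1; ring. }
  assert (qdet : q * det = (sin th - 1) * (r3 - r1) + r2 * (cos th - 1 - ka)).
  { unfold det; rewrite <- row2; replace r2 with (- (p * (sin th - 1) + q * cos th)) by (rewrite row1; ring).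
    ring. }
  assert (H31 : Rabs (r3 - r1) <= 3 * aw * K).
  { apply Rabs_le_between in Hr1; apply Rabs_le_between in Hr3; apply Rabs_le_between; lra. }
  assert (HaK : 0 <= aw * K) by (apply Rmult_le_pos; assumption).
  assert (Bp : Rabs p <= Cp * K).
  { unfold Cp; replace p with (/ det * (p * det)) by (field; assumption).
    rewrite Rabs_mult, Rabs_inv, Rmult_assoc; apply Rmult_le_compat_l; [lra|].
    rewrite pdet; eapply Rle_trans; [apply Rabs_triang|].
    rewrite Rabs_Ropp, !Rabs_mult, Rabs_Ropp, (Rabs_pos_eq (1 - sin th)) by lra.
    generalize (Rabs_pos r2) (Rabs_pos (r3 - r1)) (Rabs_pos (cos th)); intros; nra. }
  assert (Bq : Rabs q <= Cq * K).
  { unfold Cq; replace q with (/ det * (q * det)) by (field; assumption).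
    rewrite Rabs_mult, Rabs_inv, Rmult_assoc; apply Rmult_le_compat_l; [lra|].
    rewrite qdet; eapply Rle_trans; [apply Rabs_triang|].
    rewrite !Rabs_mult; fold k2; rewrite (Rabs_left1 (sin th - 1)) by lra.
    assert (Rabs r2 * k2 <= 2 * aw * K * k2) by (apply Rmult_le_compat_r; assumption).
    assert (- (sin th - 1) * Rabs (r3 - r1) <= 2 * (3 * aw * K)).
    { apply Rmult_le_compat; [lra | apply Rabs_pos | lra | assumption]. }
    lra. }
  assert (Bv : forall t, - a <= t <= a -> Rabs (Top a f t) <= C2 * K).
  { intros t Ht; unfold C2.
    assert (comb : forall c1 c2 X, Rabs c1 <= 1 -> Rabs c2 <= 1 -> Rabs (X - (p * c1 + q * c2)) <= 2 * aw * K ->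
      Rabs X <= (Cp + Cq + 2 * aw) * K).
    { intros c1 c2 X H1 H2 H3; replace X with (p * c1 + (q * c2 + (X - (p * c1 + q * c2)))) by ring.
      eapply Rle_trans; [apply Rabs_triang|]; eapply Rle_trans; [apply Rplus_le_compat_l, Rabs_triang|].
      rewrite !Rabs_mult.
      generalize (Rabs_pos p) (Rabs_pos q); intros; nra. }
    destruct (Rle_lt_dec (1 - a) t) as [H1|H1]; [|destruct (Rle_lt_dec t (a - 1)) as [H2|H2]].
    - rewrite Top_right by lra; apply (comb (cc t) (- ss t)); [apply bc | rewrite Rabs_Ropp; apply bs |].
      replace (p * cc t + q * - ss t) with (p * cc t - q * ss t) by ring; apply (HR t); lra.
    - rewrite Top_left by lra; apply (comb (ss (t + 1)) (cc (t + 1))); [apply bs | apply bc |].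
      apply (HL (t + 1)); lra.
    - rewrite Top_small, <- pE by (assumption || lra).
      eapply Rle_trans; [exact Bp|]; apply Rmult_le_compat_r; lra. }
  apply Rle_trans with (RInt (fun t => 2 / mu ^ 2 * (h t ^ 2) + 2 / mu ^ 2 * (C2 * K) ^ 2) (- a) a).
  - apply RInt_c_le; [cts_tac | cts_tac | lra |].
    intros t Ht; specialize (Bv t Ht).
    assert (Hv2 : Top a f t ^ 2 <= (C2 * K) ^ 2).
    { rewrite <- (pow2_abs (Top a f t)); apply pow_incr; split; [apply Rabs_pos | assumption]. }
    rewrite fE, <- Rmult_plus_distr_l.
    replace ((2 * w * (h t + Top a f t)) ^ 2) with (/ mu ^ 2 * (h t + Top a f t) ^ 2)
      by (unfold w; field; assumption).
    replace (2 / mu ^ 2 * (h t ^ 2 + (C2 * K) ^ 2)) with (/ mu ^ 2 * (2 * (h t ^ 2 + (C2 * K) ^ 2)))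
      by (field; assumption).
    apply Rmult_le_compat_l; [left; apply Rinv_0_lt_compat; assumption|].
    generalize (pow2_ge_0 (h t - Top a f t)); nra.
  - rewrite RInt_c_plus, RInt_c_scal, RInt_R_const by cts_tac; fold (Nrm a h).
    unfold C; rewrite Rpow_mult_distr.
    replace ((a - - a) * (2 / mu ^ 2 * (C2 ^ 2 * K ^ 2))) with (2 / mu ^ 2 * (2 * a * C2 ^ 2 * K ^ 2)) by ring.
    rewrite <- Rmult_plus_distr_l.
    rewrite (Rmult_assoc (2 / mu ^ 2) (1 + 2 * a * C2 ^ 2 * (2 * a)) (Nrm a h)).
    apply Rmult_le_compat_l; [left; apply Rdiv_lt_0_compat; lra|].
    assert (0 <= 2 * a * C2 ^ 2) by (apply Rmult_le_pos; [lra | apply pow2_ge_0]).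
    assert (2 * a * C2 ^ 2 * K ^ 2 <= 2 * a * C2 ^ 2 * (2 * a * Nrm a h)) by (apply Rmult_le_compat_l; assumption).
    lra.
Qed.

End Kernel.

(** * The extreme values of the Rayleigh quotient are roots *)

Lemma Nrm_lin (a : R) (f g : R -> R) (l m : R) : cts f -> cts g ->
  Nrm a (fun t => l * f t + m * g t) =
  l ^ 2 * Nrm a f + 2 * (l * m) * RInt (fun t => f t * g t) (- a) a + m ^ 2 * Nrm a g.
Proof.
  intros cf cg; unfold Nrm; rewrite <- !RInt_c_scal, <- !RInt_c_plus by cts_tac.
  apply RInt_R_ext; intros; ring.
Qed.

Lemma Qf_lin (a : R) (f g : R -> R) (l m : R) : / 2 < a <= 1 -> cts f -> cts g ->
  Qf a (fun t => l * f t + m * g t) =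
  l ^ 2 * Qf a f + 2 * (l * m) * RInt (fun t => g t * Top a f t) (- a) a + m ^ 2 * Qf a g.
Proof.
  intros Ha cf cg; assert (cTf := cts_Top a f cf); assert (cTg := cts_Top a g cg).
  transitivity (l ^ 2 * Qf a f + (l * m) * RInt (fun t => g t * Top a f t) (- a) a
    + ((l * m) * RInt (fun t => f t * Top a g t) (- a) a + m ^ 2 * Qf a g)).
  - unfold Qf; rewrite <- !RInt_c_scal, <- !RInt_c_plus by cts_tac.
    apply RInt_R_ext; intros t; rewrite Top_lin by assumption; ring.
  - rewrite (Top_symm a f g) by assumption; ring.
Qed.

Lemma Nrm_scal (a : R) (f : R -> R) (l : R) : cts f -> Nrm a (fun t => l * f t) = l ^ 2 * Nrm a f.
Proof.
  intros cf; unfold Nrm; rewrite <- RInt_c_scal by cts_tac; apply RInt_R_ext; intros; ring.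
Qed.

Lemma Qf_scal (a : R) (f : R -> R) (l : R) : cts f -> Qf a (fun t => l * f t) = l ^ 2 * Qf a f.
Proof.
  intros cf; assert (cT := cts_Top a f cf); unfold Qf; rewrite <- RInt_c_scal by cts_tac.
  apply RInt_R_ext; intros t; unfold Top; rewrite RInt_c_scal by assumption; ring.
Qed.

(* At the supremum [M] of the Rayleigh quotient the form [M N - s Q] is nonnegative, so by
   Cauchy-Schwarz it dominates [N (M f - s T f)]; were [M - s T] bounded below, [M] would not be
   the least upper bound. *)
Lemma rayleigh_sup (a s : R) : / 2 < a <= 1 -> s = 1 \/ s = -1 ->
  exists M, (forall f, cts f -> s * Qf a f <= M * Nrm a f) /\
    (M <> 0 -> eta_eq (2 * a) (s * M)).
Proof.
  intros Ha Hs.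
  assert (Hss : s * s = 1) by (destruct Hs; subst; ring).
  assert (Has : Rabs s = 1) by (destruct Hs; subst; unfold Rabs; destruct Rcase_abs; lra).
  assert (HQs : forall f, cts f -> s * Qf a f <= Nrm a f).
  { intros f cf; eapply Rle_trans; [apply Rle_abs|]; rewrite Rabs_mult, Has, Rmult_1_l.
    apply Qf_bound; [assumption | lra]. }
  destruct (completeness (fun m => exists f, cts f /\ Nrm a f = 1 /\ m = s * Qf a f)) as [M [Hu Hl]].
  - exists 1; intros m [f [cf [Hf ->]]]; rewrite <- Hf; apply HQs, cf.
  (* A constant of norm one shows that the set is inhabited. *)
  - set (l := / sqrt (2 * a)).
    exists (s * Qf a (fun _ => l * 1)), (fun _ => l * 1); repeat split; [cts_tac|].
    rewrite (Nrm_scal a (fun _ => 1)) by cts_tac.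
    unfold Nrm; rewrite RInt_R_const; unfold l.
    replace ((/ sqrt (2 * a)) ^ 2) with (/ (sqrt (2 * a) * sqrt (2 * a))).
    2:{ simpl; rewrite Rmult_1_r, Rinv_mult; reflexivity. }
    rewrite sqrt_sqrt by lra; field; lra.
  - assert (HM : forall f, cts f -> s * Qf a f <= M * Nrm a f).
    { intros f cf; assert (HN := Nrm_pos a f cf ltac:(lra)).
      destruct HN as [HN | HN].
      - set (l := / sqrt (Nrm a f)).
        assert (Hl2 : l ^ 2 = / Nrm a f).
        { unfold l; simpl; rewrite Rmult_1_r, <- Rinv_mult, sqrt_sqrt by lra; reflexivity. }
        assert (Hub := Hu (s * Qf a (fun t => l * f t))).
        rewrite Qf_scal, Hl2 in Hub by assumption.
        apply Rmult_le_reg_l with (/ Nrm a f); [apply Rinv_0_lt_compat; assumption|].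
        replace (/ Nrm a f * (M * Nrm a f)) with M by (field; lra).
        replace (/ Nrm a f * (s * Qf a f)) with (s * (/ Nrm a f * Qf a f)) by ring.
        apply Hub; exists (fun t => l * f t); repeat split; [cts_tac | |].
        + rewrite Nrm_scal, Hl2 by assumption; field; lra.
        + rewrite Qf_scal, Hl2 by assumption; reflexivity.
      - specialize (HQs f cf); rewrite <- HN in *; lra. }
    exists M; split; [assumption|].
    intros HM0.
    assert (HsM : s * M <> 0) by (apply Rmult_integral_contrapositive; split; [intros E; subst s; lra | assumption]).
    apply (det_eta_eq a (s * M) HsM).
    apply NNPP; intros Hdet.
    destruct (resolvent_bound a (s * M) Ha HsM Hdet) as [c [Hc Hres]].
    set (C := Rabs M + 1).
    assert (HC : 0 < C) by (unfold C; generalize (Rabs_pos M); lra).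
    (* This strict positivity would leave room to lower [M] by [c / C]. *)
    assert (key : forall f, cts f -> c * Nrm a f <= C * (M * Nrm a f - s * Qf a f)).
    { intros f cf; assert (cT := cts_Top a f cf).
      eapply Rle_trans; [apply Hres, cf|].
      set (g := fun t => s * M * f t - Top a f t).
      assert (cg : cts g) by (unfold g; cts_tac).
      assert (HNg := Nrm_pos a g cg ltac:(lra)).
      assert (cTg := cts_Top a g cg).
      assert (Bg : M * Nrm a g - s * Qf a g <= C * Nrm a g).
      { assert (X := Qf_bound a g cg ltac:(lra)).
        assert (- (s * Qf a g) <= Nrm a g).
        { eapply Rle_trans; [|exact X].
          eapply Rle_trans; [apply Rle_abs|]; rewrite Rabs_Ropp, Rabs_mult, Has; lra. }
        generalize (Rle_abs M); unfold C; intros; nra. }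
      assert (Eg : Nrm a g = s * M * RInt (fun t => f t * g t) (- a) a
        - RInt (fun t => g t * Top a f t) (- a) a).
      { unfold Nrm; rewrite <- RInt_c_scal, <- RInt_c_minus by cts_tac.
        apply RInt_R_ext; intros t; unfold g at 1; simpl; unfold g; ring. }
      (* Cauchy-Schwarz for the semidefinite form [M N - s Q]: its polar form at [f] and
         [g = s M f - T f] is exactly [s * Nrm a g], by the symmetry of [T]. *)
      assert (D : Nrm a g ^ 2 <= (M * Nrm a f - s * Qf a f) * (M * Nrm a g - s * Qf a g)).
      { replace (Nrm a g ^ 2) with ((s * Nrm a g) ^ 2) by (transitivity ((s * s) * Nrm a g ^ 2); [ring | rewrite Hss; ring]).
        apply quadratic_discriminant; [specialize (HM g cg); lra|].
        intros l.
        assert (X := HM (fun t => 1 * f t + l * g t) ltac:(cts_tac)).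
        rewrite Nrm_lin, Qf_lin in X by assumption.
        assert (Es : s * Nrm a g = M * RInt (fun t => f t * g t) (- a) a
          - s * RInt (fun t => g t * Top a f t) (- a) a).
        { rewrite Eg; transitivity ((s * s) * (M * RInt (fun t => f t * g t) (- a) a)
            - s * RInt (fun t => g t * Top a f t) (- a) a); [ring | rewrite Hss; ring]. }
        rewrite Es; simpl in *; lra. }
      specialize (HM f cf).
      destruct HNg as [HNg | HNg].
      - apply Rmult_le_reg_l with (Nrm a g); [assumption|].
        replace (Nrm a g * Nrm a g) with (Nrm a g ^ 2) by ring.
        eapply Rle_trans; [exact D|].
        replace (Nrm a g * (C * (M * Nrm a f - s * Qf a f))) with ((M * Nrm a f - s * Qf a f) * (C * Nrm a g)) by ring.
        apply Rmult_le_compat_l; lra.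
      - change (Nrm a g <= C * (M * Nrm a f - s * Qf a f)); rewrite <- HNg.
        apply Rmult_le_pos; lra. }
    assert (M <= M - c / C); [|assert (0 < c / C) by (apply Rdiv_lt_0_compat; assumption); lra].
    apply Hl; intros m [f [cf [Hf ->]]].
    specialize (key f cf); rewrite Hf, !Rmult_1_r in key.
    apply Rmult_le_reg_l with C; [assumption|].
    replace (C * (M - c / C)) with (C * M - c) by (field; lra); lra.
Qed.

Lemma root_eigenfunction (a eta : R) : / 2 < a <= 1 -> eta_eq (2 * a) eta ->
  exists f, cts f /\ 0 < Nrm a f /\ Qf a f = eta * Nrm a f.
Proof.
  intros Ha H; assert (H0 : eta <> 0) by apply H.
  apply (eigenfunction a eta Ha H0), (det_eta_eq a eta H0), H.
Qed.

(** [rayleigh_sup] identifies a root only at a nonzero value, so the two suprema must be known not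
    to vanish. Two explicit roots, one of each sign, provide this, because every root is a Rayleigh
    quotient. *)
Lemma spectral_bounds (a : R) : / 2 < a <= 1 -> exists eta_p eta_m,
  eta_eq (2 * a) eta_p /\ (forall eta, eta_eq (2 * a) eta -> eta <= eta_p) /\
  eta_eq (2 * a) eta_m /\ (forall eta, eta_eq (2 * a) eta -> eta_m <= eta) /\
  forall f, cts f -> eta_m * Nrm a f <= Qf a f <= eta_p * Nrm a f.
Proof.
  intros Ha.
  assert (HPI := PI_RGT_0).
  destruct (rayleigh_sup a 1 Ha (or_introl eq_refl)) as [M [HM HM0]].
  destruct (rayleigh_sup a (-1) Ha (or_intror eq_refl)) as [m [Hm Hm0]].
  assert (root_le : forall eta, eta_eq (2 * a) eta -> - m <= eta <= M).
  { intros eta H; destruct (root_eigenfunction a eta Ha H) as [f [cf [HN HQ]]].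
    specialize (HM f cf); specialize (Hm f cf); rewrite HQ in *; split; nra. }
  (* The angle is [PI / 2], where the cosine vanishes and the sine is 1, whatever [a] is. *)
  assert (rp : eta_eq (2 * a) ((2 * a - 1) / PI)).
  { split; [apply Rmult_integral_contrapositive; split; [lra | apply Rinv_neq_0_compat; lra]|].
    replace ((2 * a - 1) / (2 * ((2 * a - 1) / PI))) with (PI / 2) by (field; lra).
    rewrite cos_PI2, sin_PI2; ring. }
  (* The negative counterpart, with angle [- 3 * PI / 2]. *)
  assert (rm : eta_eq (2 * a) (- ((2 * a - 1) / (3 * PI)))).
  { split.
    - apply Ropp_neq_0_compat, Rmult_integral_contrapositive; split; [lra | apply Rinv_neq_0_compat; lra].
    - replace ((2 * a - 1) / (2 * - ((2 * a - 1) / (3 * PI)))) with (- (3 * (PI / 2))) by (field; lra).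
      rewrite cos_neg, sin_neg, cos_3PI2, sin_3PI2; ring. }
  assert (X1 := root_le _ rp); assert (X2 := root_le _ rm).
  assert (0 < (2 * a - 1) / PI) by (apply Rdiv_lt_0_compat; lra).
  assert (0 < (2 * a - 1) / (3 * PI)) by (apply Rdiv_lt_0_compat; lra).
  exists M, (- m).
  rewrite Rmult_1_l in HM0; replace (-1 * m) with (- m) in Hm0 by ring.
  split; [apply HM0; lra|]; split; [intros; apply root_le; assumption|].
  split; [apply Hm0; lra|]; split; [intros; apply root_le; assumption|].
  intros f cf; specialize (HM f cf); specialize (Hm f cf); lra.
Qed.

(** * The rank-one case, and functions that vanish at the end points *)

Lemma Qf_small (a : R) (f : R -> R) : 0 < a <= / 2 -> cts f ->
  Qf a f = / 2 * RInt f (- a) a ^ 2.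
Proof.
  intros Ha cf; unfold Qf.
  rewrite (RInt_R_ext_in _ (fun t => (/ 2 * RInt f (- a) a) * f t)); [|lra|].
  - rewrite RInt_c_scal by assumption; simpl; as_R; ring.
  - intros t Ht; rewrite Top_small by (assumption || lra); ring.
Qed.

(** Here [T] has the single nonzero eigenvalue [a], with the constants as eigenfunctions; the upper
    bound is Cauchy-Schwarz against 1. *)
Lemma Qf_small_bounds (a : R) (f : R -> R) : 0 < a <= / 2 -> cts f ->
  0 * Nrm a f <= Qf a f <= a * Nrm a f.
Proof.
  intros Ha cf; rewrite Qf_small by assumption.
  assert (H := RInt_Cauchy_Schwarz f (fun _ => 1) (- a) a cf ltac:(cts_tac) ltac:(lra)).
  rewrite (RInt_R_ext (fun t => f t * 1) f) in H by (intros; ring).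
  rewrite RInt_R_const in H; fold (Nrm a f) in H.
  generalize (pow2_ge_0 (RInt f (- a) a)); simpl in *; lra.
Qed.

Lemma ave_Top (a : R) (f : R -> R) (t : R) : 0 < a <= 1 -> cts f ->
  (forall x, x <= - a \/ a <= x -> f x = 0) -> ave f t = Top a f t.
Proof.
  intros Ha cf Hz; unfold ave, Top; f_equal.
  assert (P : forall y, RInt f 0 y = RInt f 0 (clamp a y)).
  { intros y; rewrite (RInt_c_Chasles f 0 (clamp a y) y cf).
    assert (E : RInt f (clamp a y) y = 0); [|rewrite E; simpl; lra].
    destruct (Rle_lt_dec a y); [|destruct (Rle_lt_dec y (- a))].
    - rewrite clamp_ge by lra; rewrite (RInt_R_ext_in f (fun _ => 0)); [|lra|].
      + rewrite RInt_R_const; as_R; ring.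
      + intros x Hx; apply Hz; right; lra.
    - rewrite clamp_le by lra; rewrite RInt_c_swap by assumption.
      rewrite (RInt_R_ext_in f (fun _ => 0)); [|lra|].
      + rewrite RInt_R_const; as_R; ring.
      + intros x Hx; apply Hz; left; lra.
    - rewrite clamp_id by lra; apply (RInt_point (V := R_CompleteNormedModule)). }
  assert (X1 := RInt_c_Chasles f 0 (t - 1) (t + 1) cf).
  assert (X2 := RInt_c_Chasles f 0 (clamp a (t - 1)) (clamp a (t + 1)) cf).
  rewrite (P (t - 1)), (P (t + 1)) in X1; simpl in *; lra.
Qed.

Lemma hartley_W_Qf (a : R) (f : R -> R) : 0 < a <= 1 -> cts f ->
  (forall x, x <= - a \/ a <= x -> f x = 0) ->
  is_int (fun x => hartley f a x ^ 2) (Nrm a f) /\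
  is_int (fun x => hartley f a x ^ 2 * W x) (Nrm a f + Qf a f).
Proof.
  intros Ha cf Hz; split; [apply hartley_plancherel; auto; lra|].
  replace (Qf a f) with (RInt (fun s => f s * ave f s) (- a) a).
  - apply hartley_W; auto; lra.
  - apply RInt_R_ext; intros t; rewrite (ave_Top a) by assumption; reflexivity.
Qed.

(* An eigenfunction may jump at the end points; a linear cut-off near them repairs this. *)
Lemma cutoff_approx (a : R) (f : R -> R) : 0 < a <= 1 -> cts f -> forall e, 0 < e ->
  exists g, cts g /\ (forall x, x <= - a \/ a <= x -> g x = 0) /\
    Rabs (Nrm a g - Nrm a f) <= e /\ Rabs (Qf a g - Qf a f) <= e.
Proof.
  intros Ha cf e He.
  destruct (continuity_ab_maj (fun x => Rabs (f x)) (- a) a) as [xm [Hxm _]]; [lra | |].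
  { intros; apply cts_pt; cts_tac. }
  set (K := Rabs (f xm) + 1).
  assert (HK : forall x, - a <= x <= a -> Rabs (f x) <= K) by (intros x Hx; specialize (Hxm x Hx); unfold K; lra).
  assert (HK0 : 0 < K) by (unfold K; generalize (Rabs_pos (f xm)); lra).
  assert (HK2 : 0 < K ^ 2) by (apply pow_lt; assumption).
  (* Both errors turn out to be at most [2 * K ^ 2 * D], where [D <= 2 * d] is the mass removed by
     the cut-off; hence the factor 4. *)
  set (d := Rmin (a / 2) (e / (4 * K ^ 2))).
  assert (Hd0 : 0 < d) by (apply Rmin_pos; [lra | apply Rdiv_lt_0_compat; lra]).
  assert (Hd1 : d <= a / 2) by apply Rmin_l.
  assert (Hd2 : d * (4 * K ^ 2) <= e).
  { apply Rle_trans with (e / (4 * K ^ 2) * (4 * K ^ 2)); [|right; field; lra].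
    apply Rmult_le_compat_r; [lra | apply Rmin_r]. }
  set (x := fun t => Rmax 0 (Rmin 1 ((a - Rabs t) / d))).
  assert (cx : cts x).
  { apply (cts_max (fun t => Rmin 1 ((a - Rabs t) / d))), cts_min; cts_tac. }
  assert (x01 : forall t, 0 <= x t <= 1).
  { intros t; unfold x; split; [apply Rmax_l | apply Rmax_lub; [lra | apply Rmin_l]]. }
  assert (xz : forall t, a <= Rabs t -> x t = 0).
  { intros t Ht; unfold x; rewrite Rmax_left; [reflexivity|].
    eapply Rle_trans; [apply Rmin_r|].
    assert (0 < / d) by (apply Rinv_0_lt_compat; assumption).
    unfold Rdiv; nra. }
  assert (x1 : forall t, Rabs t <= a - d -> x t = 1).
  { intros t Ht; unfold x.
    assert (1 <= (a - Rabs t) / d) by (apply Rle_div_r; lra).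
    rewrite Rmin_left, Rmax_right; lra. }
  set (g := fun t => x t * f t).
  assert (cg : cts g) by (unfold g; cts_tac).
  set (D := RInt (fun t => 1 - x t) (- a) a).
  assert (HD : 0 <= D <= 2 * d).
  { unfold D; split.
    - apply RInt_c_pos; [cts_tac | lra |]; intros t _; specialize (x01 t); lra.
    - assert (cc : cts (fun t => 1 - x t)) by cts_tac.
      rewrite (RInt_c_Chasles _ (- a) (- (a - d)) a cc), (RInt_c_Chasles _ (- (a - d)) (a - d) a cc).
      rewrite (RInt_R_ext_in (fun t => 1 - x t) (fun _ => 0) (- (a - d)) (a - d)).
      + assert (Y1 := RInt_c_le (fun t => 1 - x t) (fun _ => 1) (- a) (- (a - d)) cc ltac:(cts_tac) ltac:(lra)
          ltac:(intros t _; specialize (x01 t); lra)).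
        assert (Y2 := RInt_c_le (fun t => 1 - x t) (fun _ => 1) (a - d) a cc ltac:(cts_tac) ltac:(lra)
          ltac:(intros t _; specialize (x01 t); lra)).
        rewrite RInt_R_const in *; simpl in *; lra.
      + lra.
      + intros t Ht; rewrite x1; [ring | apply Rabs_le_between; lra]. }
  assert (cTf := cts_Top a f cf); assert (cTg := cts_Top a g cg).
  exists g; repeat split; [assumption | | |].
  - intros t Ht; unfold g; rewrite xz; [ring|].
    destruct Ht; [rewrite Rabs_left1 | rewrite Rabs_pos_eq]; lra.
  - unfold Nrm; rewrite <- RInt_c_minus by cts_tac.
    apply Rle_trans with (RInt (fun t => (2 * K ^ 2) * (1 - x t)) (- a) a).
    + apply RInt_c_abs_le; [cts_tac | cts_tac | lra |].
      intros t Ht; unfold g.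
      replace ((x t * f t) ^ 2 - f t ^ 2) with (- ((1 + x t) * (1 - x t) * f t ^ 2)) by ring.
      specialize (x01 t).
      rewrite Rabs_Ropp, Rabs_mult, (Rabs_pos_eq (f t ^ 2)) by apply pow2_ge_0.
      rewrite Rabs_pos_eq by (apply Rmult_le_pos; lra).
      assert (f t ^ 2 <= K ^ 2) by (rewrite <- pow2_abs; apply pow_incr; split; [apply Rabs_pos | apply HK, Ht]).
      assert (0 <= f t ^ 2) by apply pow2_ge_0.
      replace (2 * K ^ 2 * (1 - x t)) with (2 * (1 - x t) * K ^ 2) by ring.
      apply Rmult_le_compat; try lra; nra.
    + rewrite RInt_c_scal by cts_tac; fold D; nra.
  - unfold Qf; rewrite <- RInt_c_minus by cts_tac.
    assert (Tg : forall t, Rabs (Top a g t - Top a f t) <= / 2 * (K * D)).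
    { intros t.
      replace (Top a g t - Top a f t) with (Top a (fun u => 1 * g u + -1 * f u) t)
        by (rewrite Top_lin by assumption; ring).
      eapply Rle_trans; [apply Top_abs; [cts_tac | lra]|].
      apply Rmult_le_compat_l; [lra|]; unfold D; rewrite <- RInt_c_scal by cts_tac.
      apply RInt_c_le; [cts_tac | cts_tac | lra |].
      intros u Hu; unfold g; replace (1 * (x u * f u) + -1 * f u) with (- (f u * (1 - x u))) by ring.
      specialize (x01 u); rewrite Rabs_Ropp, Rabs_mult, (Rabs_pos_eq (1 - x u)) by lra.
      apply Rmult_le_compat_r; [lra | apply HK, Hu]. }
    assert (Tf : forall t, Rabs (Top a f t) <= K).
    { intros t; eapply Rle_trans; [apply Top_abs; [assumption | lra]|].
      assert (RInt (fun y => Rabs (f y)) (- a) a <= RInt (fun _ => K) (- a) a)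
        by (apply RInt_c_le; [cts_tac | cts_tac | lra | exact HK]).
      rewrite RInt_R_const in *; simpl in *; nra. }
    (* Change the argument of [T] first, which is small everywhere, then the outer factor, which is
       small only in the integral. *)
    apply Rle_trans with (RInt (fun t => K * (/ 2 * (K * D)) + K * K * (1 - x t)) (- a) a).
    + apply RInt_c_abs_le; [cts_tac | cts_tac | lra |].
      intros t Ht.
      replace (g t * Top a g t - f t * Top a f t)
        with (g t * (Top a g t - Top a f t) + - (f t * Top a f t * (1 - x t))) by (unfold g; ring).
      specialize (x01 t); specialize (Tg t); specialize (Tf t); specialize (HK t Ht).
      assert (gK : Rabs (g t) <= K).
      { unfold g; rewrite Rabs_mult, Rabs_pos_eq by lra; generalize (Rabs_pos (f t)); nra. }
      eapply Rle_trans; [apply Rabs_triang|].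
      rewrite Rabs_Ropp, !Rabs_mult, (Rabs_pos_eq (1 - x t)) by lra.
      apply Rplus_le_compat.
      * apply Rmult_le_compat; auto using Rabs_pos.
      * apply Rmult_le_compat_r; [lra|]; apply Rmult_le_compat; auto using Rabs_pos.
    + rewrite RInt_c_plus, RInt_R_const by cts_tac.
      rewrite (RInt_c_scal (fun t => 1 - x t)) by cts_tac; fold D.
      assert (K * K * D <= K * K * (2 * d)) by (apply Rmult_le_compat_l; nra).
      assert (a * (K * K * D) <= 1 * (K * K * D)) by (apply Rmult_le_compat_r; nra).
      lra.
Qed.

(** * Complex differentiability and complex-valued integrals *)

Open Scope C_scope.

Lemma RtoC_m1 : RtoC (-1) = - RtoC 1.
Proof. unfold RtoC, Copp; simpl; f_equal; ring. Qed.

(** Differentiability as linear approximation, without a quotient: the form in which Goursat's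
    argument uses it. *)
Definition cdiff (F : C -> C) (z : C) : Prop :=
  exists l : C, forall e, (0 < e)%R -> exists d, (0 < d)%R /\
    forall w, (Cmod (w - z) < d)%R -> (Cmod (F w - F z - l * (w - z)) <= e * Cmod (w - z))%R.

Definition ccont (F : C -> C) (z : C) : Prop :=
  forall e, (0 < e)%R -> exists d, (0 < d)%R /\
    forall w, (Cmod (w - z) < d)%R -> (Cmod (F w - F z) < e)%R.

Lemma ex_derive_cdiff (F : C -> C) (z : C) :
  ex_derive (K := C_AbsRing) (V := C_NormedModule) F z <-> cdiff F z.
Proof.
  split.
  - intros [l [_ H]]; exists l; intros e He.
    specialize (H z (fun P HP => HP) (mkposreal e He)).
    destruct H as [d Hd]; exists d; split; [apply cond_pos|].
    intros w Hw; specialize (Hd w Hw).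
    change (Cmod (minus (minus (F w) (F z)) (scal (minus w z) l)) <= e * Cmod (minus w z))%R in Hd.
    replace (F w - F z - l * (w - z)) with (minus (minus (F w) (F z)) (scal (minus w z) l));
      [exact Hd|].
    change (F w + - F z + - ((w + - z) * l) = F w - F z - l * (w - z)); ring.
  - intros [l H]; exists l; split; [apply is_linear_scal_l|].
    intros x Hx e.
    assert (Ex : z = x).
    { apply (is_filter_lim_locally_unique (K := C_AbsRing) (V := AbsRing_NormedModule C_AbsRing)); exact Hx. }
    subst x.
    destruct (H e (cond_pos e)) as [d [Hd Hd']].
    exists (mkposreal d Hd); intros w Hw; specialize (Hd' w Hw).
    change (Cmod (minus (minus (F w) (F z)) (scal (minus w z) l)) <= e * Cmod (minus w z))%R.
    replace (minus (minus (F w) (F z)) (scal (minus w z) l)) with (F w - F z - l * (w - z));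
      [exact Hd'|].
    change (F w - F z - l * (w - z) = F w + - F z + - ((w + - z) * l)); ring.
Qed.

Lemma cdiff_ccont (F : C -> C) (z : C) : cdiff F z -> ccont F z.
Proof.
  intros [l H] e He.
  destruct (H 1%R Rlt_0_1) as [d [Hd Hd']].
  assert (Hl := Cmod_ge_0 l).
  exists (Rmin d (e / (2 + Cmod l))); split.
  { apply Rmin_pos; [assumption | apply Rdiv_lt_0_compat; lra]. }
  intros w Hw.
  assert (Hw1 := Rlt_le_trans _ _ _ Hw (Rmin_l _ _)); assert (Hw2 := Rlt_le_trans _ _ _ Hw (Rmin_r _ _)).
  specialize (Hd' w Hw1).
  replace (F w - F z) with ((F w - F z - l * (w - z)) + l * (w - z)) by ring.
  eapply Rle_lt_trans; [apply Cmod_triangle|]; rewrite Cmod_mult.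
  assert (Hp := Cmod_ge_0 (w - z)).
  apply Rle_lt_trans with ((1 + Cmod l) * Cmod (w - z))%R; [lra|].
  apply Rle_lt_trans with ((1 + Cmod l) * (e / (2 + Cmod l)))%R.
  - apply Rmult_le_compat_l; lra.
  - replace ((1 + Cmod l) * (e / (2 + Cmod l)))%R with (e * ((1 + Cmod l) / (2 + Cmod l)))%R by (field; lra).
    rewrite <- (Rmult_1_r e) at 2; apply Rmult_lt_compat_l; [assumption|].
    apply Rlt_div_l; lra.
Qed.

Lemma cdiff_const (c z : C) : cdiff (fun _ => c) z.
Proof.
  exists 0; intros e He; exists 1%R; split; [lra|]; intros w _.
  replace (c - c - 0 * (w - z)) with (RtoC 0) by ring; rewrite Cmod_0.
  apply Rmult_le_pos; [lra | apply Cmod_ge_0].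
Qed.

Lemma cdiff_id (z : C) : cdiff (fun w => w) z.
Proof.
  exists 1; intros e He; exists 1%R; split; [lra|]; intros w _.
  replace (w - z - 1 * (w - z)) with (RtoC 0) by ring; rewrite Cmod_0.
  apply Rmult_le_pos; [lra | apply Cmod_ge_0].
Qed.

Lemma cdiff_plus (F G : C -> C) (z : C) : cdiff F z -> cdiff G z -> cdiff (fun w => F w + G w) z.
Proof.
  intros [l Hl] [m Hm]; exists (l + m); intros e He.
  destruct (Hl (e / 2)%R) as [d1 [p1 H1]]; [lra|].
  destruct (Hm (e / 2)%R) as [d2 [p2 H2]]; [lra|].
  exists (Rmin d1 d2); split; [apply Rmin_pos; assumption|]; intros w Hw.
  specialize (H1 w (Rlt_le_trans _ _ _ Hw (Rmin_l _ _))); specialize (H2 w (Rlt_le_trans _ _ _ Hw (Rmin_r _ _))).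
  replace (F w + G w - (F z + G z) - (l + m) * (w - z))
    with ((F w - F z - l * (w - z)) + (G w - G z - m * (w - z))) by ring.
  eapply Rle_trans; [apply Cmod_triangle|]; lra.
Qed.

Lemma cdiff_mult (F G : C -> C) (z : C) : cdiff F z -> cdiff G z -> cdiff (fun w => F w * G w) z.
Proof.
  intros HF HG.
  assert (cG := cdiff_ccont G z HG).
  destruct HF as [l Hl]; destruct HG as [m Hm].
  exists (l * G z + F z * m); intros e He.
  assert (g0 := Cmod_ge_0 (G z)); assert (f0 := Cmod_ge_0 (F z)); assert (l0 := Cmod_ge_0 l).
  set (K := (1 + Cmod (G z) + Cmod (F z) + Cmod l)%R).
  set (e' := Rmin 1 (e / (3 * K))%R).
  assert (He' : (0 < e')%R) by (apply Rmin_pos; [lra | apply Rdiv_lt_0_compat; unfold K; lra]).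
  assert (He1 : (e' <= 1)%R) by apply Rmin_l.
  assert (HeK : (e' * K <= e / 3)%R).
  { apply Rle_trans with (e / (3 * K) * K)%R; [apply Rmult_le_compat_r; [unfold K; lra | apply Rmin_r]|].
    right; field; unfold K; lra. }
  destruct (Hl e' He') as [d1 [p1 H1]].
  destruct (Hm e' He') as [d2 [p2 H2]].
  destruct (cG e' He') as [d3 [p3 H3]].
  exists (Rmin d1 (Rmin d2 d3)); split; [repeat apply Rmin_pos; assumption|]; intros w Hw.
  assert (Hw1 := Rlt_le_trans _ _ _ Hw (Rmin_l _ _)); assert (Hw' := Rlt_le_trans _ _ _ Hw (Rmin_r _ _)).
  specialize (H1 w Hw1); specialize (H2 w (Rlt_le_trans _ _ _ Hw' (Rmin_l _ _))).
  specialize (H3 w (Rlt_le_trans _ _ _ Hw' (Rmin_r _ _))).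
  replace (F w * G w - F z * G z - (l * G z + F z * m) * (w - z))
    with ((F w - F z - l * (w - z)) * G w + (l * (w - z) * (G w - G z) + F z * (G w - G z - m * (w - z)))) by ring.
  assert (hw := Cmod_ge_0 (w - z)).
  assert (Gw : (Cmod (G w) <= 1 + Cmod (G z))%R).
  { replace (G w) with ((G w - G z) + G z) by ring; eapply Rle_trans; [apply Cmod_triangle|]; lra. }
  eapply Rle_trans; [apply Cmod_triangle|]; eapply Rle_trans; [apply Rplus_le_compat_l, Cmod_triangle|].
  rewrite !Cmod_mult.
  set (h := Cmod (w - z)) in *.
  assert (T1 : (Cmod (F w - F z - l * (w - z)) * Cmod (G w) <= e' * h * (1 + Cmod (G z)))%R)
    by (apply Rmult_le_compat; auto using Cmod_ge_0).
  assert (T2 : (Cmod l * h * Cmod (G w - G z) <= Cmod l * h * e')%R)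
    by (apply Rmult_le_compat_l; [apply Rmult_le_pos; assumption | lra]).
  assert (T3 : (Cmod (F z) * Cmod (G w - G z - m * (w - z)) <= Cmod (F z) * (e' * h))%R)
    by (apply Rmult_le_compat_l; assumption).
  assert (T4 : (e' * K * h <= e / 3 * h)%R) by (apply Rmult_le_compat_r; assumption).
  unfold K in T4; nra.
Qed.

Lemma cdiff_comp (F g : C -> C) (z : C) : cdiff F (g z) -> cdiff g z -> cdiff (fun w => F (g w)) z.
Proof.
  intros [l Hl] Hg; assert (cg := cdiff_ccont g z Hg); destruct Hg as [m Hm].
  exists (l * m); intros e He.
  assert (l0 := Cmod_ge_0 l); assert (m0 := Cmod_ge_0 m).
  destruct (Hl (e / (2 * (1 + Cmod m)))%R) as [d1 [p1 H1]]; [apply Rdiv_lt_0_compat; lra|].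
  set (e2 := Rmin 1 (e / (2 * (1 + Cmod l)))%R).
  assert (He2 : (0 < e2)%R) by (apply Rmin_pos; [lra | apply Rdiv_lt_0_compat; lra]).
  assert (He21 : (e2 <= 1)%R) by apply Rmin_l.
  assert (He2l : (Cmod l * e2 <= e / 2)%R).
  { apply Rle_trans with ((1 + Cmod l) * (e / (2 * (1 + Cmod l))))%R; [|right; field; lra].
    apply Rmult_le_compat; try lra; apply Rmin_r. }
  destruct (Hm e2 He2) as [d2 [p2 H2]].
  destruct (cg d1 p1) as [d3 [p3 H3]].
  exists (Rmin d2 d3); split; [apply Rmin_pos; assumption|]; intros w Hw.
  specialize (H2 w (Rlt_le_trans _ _ _ Hw (Rmin_l _ _))).
  specialize (H3 w (Rlt_le_trans _ _ _ Hw (Rmin_r _ _))).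
  specialize (H1 (g w) H3).
  assert (hw := Cmod_ge_0 (w - z)).
  assert (Hgw : (Cmod (g w - g z) <= (1 + Cmod m) * Cmod (w - z))%R).
  { replace (g w - g z) with ((g w - g z - m * (w - z)) + m * (w - z)) by ring.
    eapply Rle_trans; [apply Cmod_triangle|]; rewrite Cmod_mult; nra. }
  replace (F (g w) - F (g z) - l * m * (w - z))
    with ((F (g w) - F (g z) - l * (g w - g z)) + l * (g w - g z - m * (w - z))) by ring.
  eapply Rle_trans; [apply Cmod_triangle|]; rewrite Cmod_mult.
  assert (T1 : (e / (2 * (1 + Cmod m)) * Cmod (g w - g z) <= e / 2 * Cmod (w - z))%R).
  { apply Rle_trans with (e / (2 * (1 + Cmod m)) * ((1 + Cmod m) * Cmod (w - z)))%R; [|right; field; lra].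
    apply Rmult_le_compat_l; [left; apply Rdiv_lt_0_compat; lra | assumption]. }
  assert (T2 : (Cmod l * Cmod (g w - g z - m * (w - z)) <= Cmod l * (e2 * Cmod (w - z)))%R)
    by (apply Rmult_le_compat_l; assumption).
  assert (T3 : (Cmod l * e2 * Cmod (w - z) <= e / 2 * Cmod (w - z))%R) by (apply Rmult_le_compat_r; assumption).
  lra.
Qed.

(** * Complex-valued functions of a real variable and their integrals *)

Definition ccts (g : R -> C) : Prop := cts (fun t => Re (g t)) /\ cts (fun t => Im (g t)).

Lemma ccts_const (c : C) : ccts (fun _ => c).
Proof. split; apply cts_const. Qed.

Lemma ccts_RtoC (f : R -> R) : cts f -> ccts (fun t => RtoC (f t)).
Proof. intros H; split; [exact H | apply (cts_const 0)]. Qed.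

Lemma ccts_plus (f g : R -> C) : ccts f -> ccts g -> ccts (fun t => f t + g t).
Proof.
  intros [f1 f2] [g1 g2]; split; simpl.
  - exact (cts_plus _ _ f1 g1).
  - exact (cts_plus _ _ f2 g2).
Qed.

Lemma ccts_opp (f : R -> C) : ccts f -> ccts (fun t => - f t).
Proof.
  intros [f1 f2]; split; simpl.
  - exact (cts_opp _ f1).
  - exact (cts_opp _ f2).
Qed.

Lemma ccts_minus (f g : R -> C) : ccts f -> ccts g -> ccts (fun t => f t - g t).
Proof. intros Hf Hg; apply ccts_plus; [assumption | apply ccts_opp; assumption]. Qed.

Lemma ccts_mult (f g : R -> C) : ccts f -> ccts g -> ccts (fun t => f t * g t).
Proof.
  intros [f1 f2] [g1 g2]; split; simpl.
  - exact (cts_minus _ _ (cts_mult _ _ f1 g1) (cts_mult _ _ f2 g2)).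
  - exact (cts_plus _ _ (cts_mult _ _ f1 g2) (cts_mult _ _ f2 g1)).
Qed.

Lemma Cmod_le_sum (z : C) : (Cmod z <= Rabs (Re z) + Rabs (Im z))%R.
Proof.
  unfold Cmod; rewrite <- (sqrt_Rsqr (Rabs (Re z) + Rabs (Im z))).
  - apply sqrt_le_1_alt; unfold Rsqr, Re, Im; rewrite <- (pow2_abs (fst z)), <- (pow2_abs (snd z)).
    generalize (Rabs_pos (fst z)) (Rabs_pos (snd z)); intros; nra.
  - generalize (Rabs_pos (Re z)) (Rabs_pos (Im z)); lra.
Qed.

Lemma Re_le_Cmod (z : C) : (Rabs (Re z) <= Cmod z)%R.
Proof. eapply Rle_trans; [apply Rmax_l | apply (Rmax_Cmod z)]. Qed.

Lemma Im_le_Cmod (z : C) : (Rabs (Im z) <= Cmod z)%R.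
Proof. eapply Rle_trans; [apply Rmax_r | apply (Rmax_Cmod z)]. Qed.

Lemma ccts_comp (F : C -> C) (g : R -> C) : (forall z, ccont F z) -> ccts g -> ccts (fun t => F (g t)).
Proof.
  intros HF [g1 g2].
  assert (key : forall t e, (0 < e)%R -> exists d, (0 < d)%R /\
    forall s, (Rabs (s - t) < d)%R -> (Cmod (F (g s) - F (g t)) < e)%R).
  { intros t e He; destruct (HF (g t) e He) as [d [pd Hd]].
    destruct (cts_pt _ g1 t (d / 2)%R) as [d1 [p1 H1]]; [lra|].
    destruct (cts_pt _ g2 t (d / 2)%R) as [d2 [p2 H2]]; [lra|].
    simpl in H1, H2; unfold R_dist in H1, H2.
    exists (Rmin d1 d2); split; [apply Rmin_pos; assumption|]; intros s Hs; apply Hd.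
    destruct (Req_dec s t) as [-> | Hne].
    { replace (g t - g t) with (RtoC 0) by ring; rewrite Cmod_0; assumption. }
    specialize (H1 s (conj (conj Logic.I (not_eq_sym Hne)) (Rlt_le_trans _ _ _ Hs (Rmin_l _ _)))).
    specialize (H2 s (conj (conj Logic.I (not_eq_sym Hne)) (Rlt_le_trans _ _ _ Hs (Rmin_r _ _)))).
    eapply Rle_lt_trans; [apply Cmod_le_sum|].
    unfold Re, Im in *; simpl.
    replace (fst (g s) + - fst (g t))%R with (fst (g s) - fst (g t))%R by ring.
    replace (snd (g s) + - snd (g t))%R with (snd (g s) - snd (g t))%R by ring.
    lra. }
  split; apply cts_of_pt; intros t e He; destruct (key t e He) as [d [pd Hd]]; exists d;
    (split; [assumption|]); intros s [_ Hs]; simpl in Hs |- *; unfold R_dist in *; specialize (Hd s Hs).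
  - eapply Rle_lt_trans; [|exact Hd]; exact (Re_le_Cmod (F (g s) - F (g t))).
  - eapply Rle_lt_trans; [|exact Hd]; exact (Im_le_Cmod (F (g s) - F (g t))).
Qed.

Lemma cts_Cmod (g : R -> C) : ccts g -> cts (fun t => Cmod (g t)).
Proof.
  intros [g1 g2]; unfold Cmod; apply cts_sqrt.
  - unfold Re, Im in *; cts_tac.
  - intros t; generalize (pow2_ge_0 (fst (g t))) (pow2_ge_0 (snd (g t))); lra.
Qed.

Definition CI (g : R -> C) (a b : R) : C := (RInt (fun t => Re (g t)) a b, RInt (fun t => Im (g t)) a b).

Lemma CI_ext (f g : R -> C) (a b : R) : (forall t, f t = g t) -> CI f a b = CI g a b.
Proof. intros H; unfold CI; f_equal; apply RInt_R_ext; intros; rewrite H; reflexivity. Qed.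

Lemma CI_plus (f g : R -> C) (a b : R) : ccts f -> ccts g ->
  CI (fun t => f t + g t) a b = CI f a b + CI g a b.
Proof.
  intros [f1 f2] [g1 g2]; unfold CI, Cplus; simpl; f_equal; apply RInt_c_plus; assumption.
Qed.

Lemma CI_scal (c : C) (f : R -> C) (a b : R) : ccts f -> CI (fun t => c * f t) a b = c * CI f a b.
Proof.
  intros [f1 f2]; unfold CI, Cmult; simpl; unfold Re, Im in *; f_equal.
  - rewrite RInt_c_minus by cts_tac; rewrite !RInt_c_scal by assumption; reflexivity.
  - rewrite RInt_c_plus by cts_tac; rewrite !RInt_c_scal by assumption; reflexivity.
Qed.

Lemma CI_minus (f g : R -> C) (a b : R) : ccts f -> ccts g ->
  CI (fun t => f t - g t) a b = CI f a b - CI g a b.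
Proof.
  intros Hf Hg; rewrite (CI_ext _ (fun t => f t + (-1) * g t)) by (intros; ring).
  rewrite CI_plus, CI_scal; [ring | assumption | assumption |].
  apply ccts_mult; [apply ccts_const | assumption].
Qed.

Lemma CI_const (c : C) (a b : R) : CI (fun _ => c) a b = RtoC (b - a) * c.
Proof. unfold CI, Cmult, RtoC; simpl; rewrite !RInt_R_const; unfold Re, Im; f_equal; ring. Qed.

Lemma CI_Chasles (g : R -> C) (a b c : R) : ccts g -> CI g a c = CI g a b + CI g b c.
Proof.
  intros [g1 g2]; unfold CI, Cplus; simpl.
  rewrite (RInt_c_Chasles _ a b c g1), (RInt_c_Chasles _ a b c g2); reflexivity.
Qed.

Lemma CI_comp_lin (g : R -> C) (u v a b : R) : ccts g ->
  CI (fun y => RtoC u * g (u * y + v)%R) a b = CI g (u * a + v) (u * b + v).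
Proof.
  intros [g1 g2]; unfold CI; f_equal.
  - rewrite <- RInt_c_comp_lin by assumption; apply RInt_R_ext; intros; simpl; unfold Re; ring.
  - rewrite <- RInt_c_comp_lin by assumption; apply RInt_R_ext; intros; simpl; unfold Im; ring.
Qed.

(** Real and imaginary parts are estimated separately. The factor 2 is harmless: these bounds serve
    only for smallness and for exponential types. *)
Lemma CI_bound (g : R -> C) (h : R -> R) (a b : R) : ccts g -> cts h -> (a <= b)%R ->
  (forall t, a <= t <= b -> Cmod (g t) <= h t)%R -> (Cmod (CI g a b) <= 2 * RInt h a b)%R.
Proof.
  intros [g1 g2] ch Hab H; eapply Rle_trans; [apply Cmod_le_sum|]; unfold CI; simpl.
  assert (H1 : (Rabs (RInt (fun t => Re (g t)) a b) <= RInt h a b)%R).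
  { apply RInt_c_abs_le; auto; intros t Ht; eapply Rle_trans; [apply Re_le_Cmod | apply H, Ht]. }
  assert (H2 : (Rabs (RInt (fun t => Im (g t)) a b) <= RInt h a b)%R).
  { apply RInt_c_abs_le; auto; intros t Ht; eapply Rle_trans; [apply Im_le_Cmod | apply H, Ht]. }
  lra.
Qed.

Lemma CI_bound_const (g : R -> C) (K a b : R) : ccts g -> (a <= b)%R ->
  (forall t, a <= t <= b -> Cmod (g t) <= K)%R -> (Cmod (CI g a b) <= 2 * ((b - a) * K))%R.
Proof.
  intros cg Hab H; rewrite <- RInt_R_const; apply CI_bound; auto; apply cts_const.
Qed.

(** * Goursat's theorem for triangles *)

Definition path (a b : C) (t : R) : C := a + RtoC t * (b - a).

Definition seg (F : C -> C) (a b : C) : C := (b - a) * CI (fun t => F (path a b t)) 0 1.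

Lemma ccts_path (a b : C) : ccts (path a b).
Proof.
  unfold path; apply ccts_plus; [apply ccts_const|].
  apply ccts_mult; [apply ccts_RtoC, cts_id | apply ccts_const].
Qed.

Lemma ccts_along (F : C -> C) (a b : C) : (forall z, ccont F z) -> ccts (fun t => F (path a b t)).
Proof. intros H; apply ccts_comp; [assumption | apply ccts_path]. Qed.

Lemma seg_rev (F : C -> C) (a b : C) : (forall z, ccont F z) -> seg F b a = - seg F a b.
Proof.
  intros H; unfold seg.
  assert (E := CI_comp_lin (fun t => F (path a b t)) (-1) 1 0 1 (ccts_along F a b H)).
  replace (-1 * 0 + 1)%R with 1%R in E by ring; replace (-1 * 1 + 1)%R with 0%R in E by ring.
  rewrite (CI_ext _ (fun y => RtoC (-1) * F (path b a y))) in E.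
  2:{ intros t; do 2 f_equal; unfold path; rewrite RtoC_plus, RtoC_mult, RtoC_m1; ring. }
  rewrite CI_scal in E by (apply ccts_along, H).
  assert (E2 := CI_Chasles (fun t => F (path a b t)) 0 1 0 (ccts_along F a b H)).
  assert (E3 : CI (fun t => F (path a b t)) 0 0 = 0).
  { unfold CI, RtoC; f_equal; apply (RInt_point (V := R_CompleteNormedModule)). }
  rewrite E3, <- E in E2.
  set (X := CI (fun y => F (path b a y)) 0 1) in *; set (Y := CI (fun y => F (path a b y)) 0 1) in *.
  assert (EX : X = Y).
  { replace X with (Y - (Y + RtoC (-1) * X)) by (rewrite RtoC_m1; ring).
    rewrite <- E2; ring. }
  rewrite EX; ring.
Qed.

Lemma seg_mid (F : C -> C) (a b : C) : (forall z, ccont F z) ->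
  seg F a b = seg F a ((a + b) / 2) + seg F ((a + b) / 2) b.
Proof.
  intros H; unfold seg.
  assert (H2 : RtoC 2 <> 0) by (intros E; apply RtoC_inj in E; lra).
  assert (Eh : RtoC (/ 2) = / RtoC 2) by (rewrite RtoC_inv; [reflexivity | lra]).
  assert (E1 := CI_comp_lin (fun t => F (path a b t)) (/ 2) 0 0 1 (ccts_along F a b H)).
  assert (E2 := CI_comp_lin (fun t => F (path a b t)) (/ 2) (/ 2) 0 1 (ccts_along F a b H)).
  replace (/ 2 * 0 + 0)%R with 0%R in E1 by ring; replace (/ 2 * 1 + 0)%R with (/ 2)%R in E1 by ring.
  replace (/ 2 * 0 + / 2)%R with (/ 2)%R in E2 by ring; replace (/ 2 * 1 + / 2)%R with 1%R in E2 by field.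
  rewrite (CI_ext _ (fun y => RtoC (/ 2) * F (path a ((a + b) / 2) y))) in E1.
  2:{ intros t; do 2 f_equal; unfold path; rewrite RtoC_plus, RtoC_mult, Eh; field; assumption. }
  rewrite (CI_ext _ (fun y => RtoC (/ 2) * F (path ((a + b) / 2) b y))) in E2.
  2:{ intros t; do 2 f_equal; unfold path; rewrite RtoC_plus, RtoC_mult, Eh; field; assumption. }
  rewrite CI_scal in E1 by (apply ccts_along, H).
  rewrite CI_scal in E2 by (apply ccts_along, H).
  rewrite (CI_Chasles (fun t => F (path a b t)) 0 (/ 2) 1 (ccts_along F a b H)).
  rewrite <- E1, <- E2, Eh; field; assumption.
Qed.

Lemma seg_bound (F : C -> C) (a b : C) (K : R) : (forall z, ccont F z) ->
  (forall t, (0 <= t <= 1)%R -> (Cmod (F (path a b t)) <= K)%R) ->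
  (Cmod (seg F a b) <= 2 * Cmod (b - a) * K)%R.
Proof.
  intros H HK; unfold seg; rewrite Cmod_mult.
  assert (X := CI_bound_const (fun t => F (path a b t)) K 0 1 (ccts_along F a b H) Rle_0_1 HK).
  generalize (Cmod_ge_0 (b - a)); intros; nra.
Qed.

Definition tri (F : C -> C) (a b c : C) : C := seg F a b + seg F b c + seg F c a.

Lemma tri_split (F : C -> C) (a b c : C) : (forall z, ccont F z) ->
  tri F a b c = tri F a ((a + b) / 2) ((c + a) / 2) + tri F ((a + b) / 2) b ((b + c) / 2)
    + tri F ((c + a) / 2) ((b + c) / 2) c + tri F ((b + c) / 2) ((c + a) / 2) ((a + b) / 2).
Proof.
  intros H; unfold tri.
  rewrite (seg_mid F a b H), (seg_mid F b c H), (seg_mid F c a H).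
  rewrite (seg_rev F ((c + a) / 2) ((b + c) / 2) H), (seg_rev F ((b + c) / 2) ((a + b) / 2) H),
    (seg_rev F ((a + b) / 2) ((c + a) / 2) H).
  ring.
Qed.

Definition perim (a b c : C) : R := (Cmod (b - a) + Cmod (c - b) + Cmod (a - c))%R.

Lemma perim_half (a b c a' b' c' : C) :
  b' - a' = (b - a) / 2 -> c' - b' = (c - b) / 2 -> a' - c' = (a - c) / 2 ->
  perim a' b' c' = (perim a b c / 2)%R.
Proof.
  assert (H2 : RtoC 2 <> 0) by (intros E; apply RtoC_inj in E; lra).
  intros E1 E2 E3; unfold perim; rewrite E1, E2, E3, !Cmod_div, Cmod_R, Rabs_pos_eq by (assumption || lra).
  field.
Qed.

Lemma Cmod_sym (z w : C) : Cmod (z - w) = Cmod (w - z).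
Proof. replace (z - w) with (- (w - z)) by ring; apply Cmod_opp. Qed.

(** The four parts of [tri_split] add up to the whole, so one of them carries at least a quarter of
    the modulus. *)
Lemma tri_subdivide (F : C -> C) (a b c : C) : (forall z, ccont F z) ->
  exists a' b' c', perim a' b' c' = (perim a b c / 2)%R /\ (Cmod (a' - a) <= perim a b c)%R /\
    (Cmod (tri F a b c) <= 4 * Cmod (tri F a' b' c'))%R.
Proof.
  intros H.
  assert (H2 : RtoC 2 <> 0) by (intros E; apply RtoC_inj in E; lra).
  assert (half : forall z, Cmod (z / 2) = (Cmod z / 2)%R).
  { intros z; rewrite Cmod_div, Cmod_R, Rabs_pos_eq by (assumption || lra); reflexivity. }
  assert (E := tri_split F a b c H).
  assert (pab := Cmod_ge_0 (b - a)); assert (pbc := Cmod_ge_0 (c - b)); assert (pca := Cmod_ge_0 (a - c)).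
  assert (da : forall x y, (Cmod ((x + y) / 2 - a)%C <= (Cmod (x - a)%C + Cmod (y - a)%C) / 2)%R).
  { intros x y; replace ((x + y) / 2 - a) with (((x - a) + (y - a)) / 2) by (field; assumption).
    rewrite half; generalize (Cmod_triangle (x - a) (y - a)); lra. }
  assert (aa : Cmod (a - a) = 0%R) by (replace (a - a) with (RtoC 0) by ring; apply Cmod_0).
  assert (ac := Cmod_sym a c).
  destruct (Rle_lt_dec (Cmod (tri F a b c)) (4 * Cmod (tri F a ((a + b) / 2) ((c + a) / 2)))) as [L1|L1].
  { exists a, ((a + b) / 2), ((c + a) / 2); repeat split; [| unfold perim; lra | assumption].
    apply perim_half; field; assumption. }
  destruct (Rle_lt_dec (Cmod (tri F a b c)) (4 * Cmod (tri F ((a + b) / 2) b ((b + c) / 2)))) as [L2|L2].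
  { exists ((a + b) / 2), b, ((b + c) / 2); repeat split; [| | assumption].
    - apply perim_half; field; assumption.
    - specialize (da a b); unfold perim; lra. }
  destruct (Rle_lt_dec (Cmod (tri F a b c)) (4 * Cmod (tri F ((c + a) / 2) ((b + c) / 2) c))) as [L3|L3].
  { exists ((c + a) / 2), ((b + c) / 2), c; repeat split; [| | assumption].
    - apply perim_half; field; assumption.
    - specialize (da c a); unfold perim; lra. }
  destruct (Rle_lt_dec (Cmod (tri F a b c)) (4 * Cmod (tri F ((b + c) / 2) ((c + a) / 2) ((a + b) / 2)))) as [L4|L4].
  { exists ((b + c) / 2), ((c + a) / 2), ((a + b) / 2); repeat split; [| | assumption].
    - transitivity (perim b a c / 2)%R; [|unfold perim; rewrite (Cmod_sym b a), (Cmod_sym c a), (Cmod_sym b c)].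
      + unfold perim.
        replace ((c + a) / 2 - (b + c) / 2) with ((a - b) / 2) by (field; assumption).
        replace ((a + b) / 2 - (c + a) / 2) with ((b - c) / 2) by (field; assumption).
        replace ((b + c) / 2 - (a + b) / 2) with ((c - a) / 2) by (field; assumption).
        rewrite !half, (Cmod_sym c a); lra.
      + rewrite (Cmod_sym a c); lra.
    - specialize (da b c); unfold perim; lra. }
  exfalso.
  assert (X : (Cmod (tri F a b c) <= Cmod (tri F a ((a + b) / 2) ((c + a) / 2)) + Cmod (tri F ((a + b) / 2) b ((b + c) / 2))
    + Cmod (tri F ((c + a) / 2) ((b + c) / 2) c) + Cmod (tri F ((b + c) / 2) ((c + a) / 2) ((a + b) / 2)))%R).
  { rewrite E at 1.
    eapply Rle_trans; [apply Cmod_triangle|]; apply Rplus_le_compat_r.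
    eapply Rle_trans; [apply Cmod_triangle|]; apply Rplus_le_compat_r.
    apply Cmod_triangle. }
  lra.
Qed.

(** The intervals of radius [2 * D / 2 ^ n] around [u n] are nested; their common point is the
    limit, with the rate read off at once. *)
Lemma halving_limit (u : nat -> R) (D : R) : (forall n, Rabs (u (S n) - u n) <= D / 2 ^ n)%R ->
  exists l, forall n, (Rabs (u n - l) <= 2 * D / 2 ^ n)%R.
Proof.
  intros H.
  assert (step : forall n, (2 * D / 2 ^ S n = D / 2 ^ n)%R).
  { intros n; simpl; field; apply pow_nonzero; lra. }
  set (L := fun n => (u n - 2 * D / 2 ^ n)%R); set (U := fun n => (u n + 2 * D / 2 ^ n)%R).
  assert (e2 : forall n, (2 * D / 2 ^ n = D / 2 ^ n + D / 2 ^ n)%R) by (intros; field; apply pow_nonzero; lra).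
  assert (HL : forall n, (L n <= L (S n))%R).
  { intros n; unfold L; rewrite step, e2; specialize (H n); apply Rabs_le_between in H; lra. }
  assert (HU : forall n, (U (S n) <= U n)%R).
  { intros n; unfold U; rewrite step, e2; specialize (H n); apply Rabs_le_between in H; lra. }
  assert (HL' : forall n k, (L n <= L (n + k)%nat)%R).
  { intros n k; induction k as [|k IH]; [rewrite Nat.add_0_r; lra|].
    rewrite Nat.add_succ_r; eapply Rle_trans; [exact IH | apply HL]. }
  assert (HU' : forall n k, (U (n + k)%nat <= U n)%R).
  { intros n k; induction k as [|k IH]; [rewrite Nat.add_0_r; lra|].
    rewrite Nat.add_succ_r; eapply Rle_trans; [apply HU | exact IH]. }
  assert (HLU : forall n, (L n <= U n)%R).
  { intros n; unfold L, U; rewrite e2; generalize (Rle_trans _ _ _ (Rabs_pos _) (H n)); lra. }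
  assert (HLU' : forall n m, (L n <= U m)%R).
  { intros n m; eapply Rle_trans; [apply (HL' n m)|]; eapply Rle_trans; [apply HLU|].
    rewrite Nat.add_comm; apply HU'. }
  destruct (completeness (fun y => exists n, y = L n)) as [l [Hu Hl]].
  - exists (U 0%nat); intros y [n ->]; apply HLU'.
  - exists (L 0%nat), 0%nat; reflexivity.
  - exists l; intros n; apply Rabs_le_between.
    assert (L n <= l)%R by (apply Hu; exists n; reflexivity).
    assert (l <= U n)%R by (apply Hl; intros y [m ->]; apply HLU').
    unfold L, U in *; lra.
Qed.

(** The midpoint rule is exact for affine functions; around a triangle these values add up to zero,
    which removes the linear part in [goursat]. *)
Lemma seg_affine (c l z0 a b : C) :
  seg (fun z => c + l * (z - z0)) a b = (b - a) * (c + l * ((a + b) / 2 - z0)).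
Proof.
  assert (H2 : RtoC 2 <> 0) by (intros E; apply RtoC_inj in E; lra).
  unfold seg; f_equal.
  assert (E : CI RtoC 0 1 = / 2).
  { assert (RInt (fun t => t) 0 1 = / 2)%R.
    { rewrite (RInt_of_derive (fun t => t * t / 2)%R); [as_R; field | | apply cts_id].
      intros x; auto_derive; [trivial | field]. }
    unfold CI; simpl; rewrite H, RInt_R_const, <- RtoC_inv by lra; unfold RtoC; f_equal; ring. }
  rewrite (CI_ext _ (fun t => (c + l * (a - z0)) + (l * (b - a)) * RtoC t)) by (intros; unfold path; ring).
  rewrite CI_plus, CI_const, CI_scal, E.
  - rewrite Rminus_0_r; field; assumption.
  - apply ccts_RtoC, cts_id.
  - apply ccts_const.
  - apply ccts_mult; [apply ccts_const | apply ccts_RtoC, cts_id].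
Qed.

Lemma seg_plus (F G : C -> C) (a b : C) : (forall z, ccont F z) -> (forall z, ccont G z) ->
  seg (fun z => F z + G z) a b = seg F a b + seg G a b.
Proof.
  intros HF HG; unfold seg; rewrite CI_plus by (apply ccts_along; assumption); ring.
Qed.

Lemma seg_ext (F G : C -> C) (a b : C) : (forall z, F z = G z) -> seg F a b = seg G a b.
Proof. intros H; unfold seg; f_equal; apply CI_ext; intros; apply H. Qed.

Lemma path_dist (a b : C) (t : R) : (0 <= t <= 1)%R -> (Cmod (path a b t - a) <= Cmod (b - a))%R.
Proof.
  intros Ht; unfold path; replace (a + RtoC t * (b - a) - a) with (RtoC t * (b - a)) by ring.
  rewrite Cmod_mult, Cmod_R, Rabs_pos_eq by lra; generalize (Cmod_ge_0 (b - a)); nra.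
Qed.

Theorem goursat (F : C -> C) : (forall z, cdiff F z) -> forall a b c, tri F a b c = 0.
Proof.
  intros HF a b c.
  assert (cF : forall z, ccont F z) by (intros; apply cdiff_ccont, HF).
  set (P := (C * C * C)%type).
  set (step := fun x y : P => let '(a, b, c) := x in let '(a', b', c') := y in
    perim a' b' c' = (perim a b c / 2)%R /\ (Cmod (a' - a) <= perim a b c)%R /\
    (Cmod (tri F a b c) <= 4 * Cmod (tri F a' b' c'))%R).
  assert (Hstep : forall x, exists y, step x y).
  { intros [[x y] z]; destruct (tri_subdivide F x y z cF) as [x' [y' [z' H]]].
    exists (x', y', z'); exact H. }
  set (next := fun x => proj1_sig (constructive_indefinite_description _ (Hstep x))).
  assert (Hnext : forall x, step x (next x)).
  { intros x; unfold next; apply (proj2_sig (constructive_indefinite_description _ (Hstep x))). }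
  set (s := fun n => Nat.iter n next (a, b, c)).
  set (A := fun n => fst (fst (s n))); set (B := fun n => snd (fst (s n))); set (Cc := fun n => snd (s n)).
  set (D := perim a b c).
  assert (Hs : forall n, step (s n) (s (S n))) by (intros n; apply Hnext).
  assert (HD : forall n, perim (A n) (B n) (Cc n) = (D / 2 ^ n)%R).
  { induction n as [|n IH]; [unfold A, B, Cc, s, D; simpl; field|].
    specialize (Hs n); unfold A, B, Cc in *.
    destruct (s n) as [[x y] z]; destruct (s (S n)) as [[x' y'] z']; simpl in *.
    destruct Hs as [E _]; rewrite E, IH; field; apply pow_nonzero; lra. }
  assert (HT : forall n, (Cmod (tri F a b c) <= 4 ^ n * Cmod (tri F (A n) (B n) (Cc n)))%R).
  { induction n as [|n IH]; [unfold A, B, Cc, s; simpl; lra|].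
    eapply Rle_trans; [exact IH|].
    specialize (Hs n); unfold A, B, Cc in *.
    destruct (s n) as [[x y] z]; destruct (s (S n)) as [[x' y'] z']; simpl in *.
    destruct Hs as [_ [_ E]].
    assert (0 < 4 ^ n)%R by (apply pow_lt; lra). nra. }
  assert (HA : forall n, (Cmod (A (S n) - A n) <= D / 2 ^ n)%R).
  { intros n; specialize (HD n); specialize (Hs n); unfold A, B, Cc in *.
    destruct (s n) as [[x y] z]; destruct (s (S n)) as [[x' y'] z']; simpl in *.
    rewrite <- HD; apply Hs. }
  destruct (halving_limit (fun n => Re (A n)) D) as [l1 Hl1].
  { intros n; eapply Rle_trans; [|apply HA]; exact (Re_le_Cmod (A (S n) - A n)). }
  destruct (halving_limit (fun n => Im (A n)) D) as [l2 Hl2].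
  { intros n; eapply Rle_trans; [|apply HA]; exact (Im_le_Cmod (A (S n) - A n)). }
  set (z0 := (l1, l2) : C).
  assert (Hz0 : forall n, (Cmod (A n - z0) <= 4 * (D / 2 ^ n))%R).
  { intros n; eapply Rle_trans; [apply Cmod_le_sum|].
    specialize (Hl1 n); specialize (Hl2 n); unfold Re, Im, z0 in *; simpl.
    replace (fst (A n) + - l1)%R with (fst (A n) - l1)%R by ring.
    replace (snd (A n) + - l2)%R with (snd (A n) - l2)%R by ring.
    replace (4 * (D / 2 ^ n))%R with (2 * D / 2 ^ n + 2 * D / 2 ^ n)%R by (field; apply pow_nonzero; lra).
    lra. }
  assert (D0 : (0 <= D)%R).
  { unfold D, perim; generalize (Cmod_ge_0 (b - a)) (Cmod_ge_0 (c - b)) (Cmod_ge_0 (a - c)); lra. }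
  apply Cmod_eq_0, Rle_antisym; [|apply Cmod_ge_0].
  apply Rle_eps; intros e He; rewrite Rplus_0_l.
  destruct (HF z0) as [l Hl].
  (* 12 is the factor 2 of [seg_bound] times 6: points on the sides of the [n]-th triangle are
     within [2 * Dn] of its first vertex, which is within [4 * Dn] of [z0]. *)
  set (e' := (e / (12 * (D * D + 1)))%R).
  assert (He' : (0 < e')%R) by (apply Rdiv_lt_0_compat; nra).
  destruct (Hl e' He') as [d [pd Hd]].
  assert (Hn : exists n, (6 * (D / 2 ^ n) < d)%R).
  { destruct (Pow_x_infinity 2 ltac:(rewrite Rabs_pos_eq; lra) (6 * D / d + 1)%R) as [n Hn].
    specialize (Hn n (le_n n)); rewrite Rabs_pos_eq in Hn by (apply pow_le; lra).
    exists n.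
    assert (p2 : (0 < 2 ^ n)%R) by (apply pow_lt; lra).
    replace (6 * (D / 2 ^ n))%R with (6 * D / 2 ^ n)%R by (field; lra).
    apply Rlt_div_l; [assumption|].
    apply Rlt_le_trans with (d * (6 * D / d + 1))%R.
    - replace (d * (6 * D / d + 1))%R with (6 * D + d)%R by (field; lra); lra.
    - apply Rmult_le_compat_l; lra. }
  destruct Hn as [n Hn].
  specialize (HD n); specialize (HT n); specialize (Hz0 n).
  set (x := A n) in *; set (y := B n) in *; set (z := Cc n) in *; set (Dn := (D / 2 ^ n)%R) in *.
  assert (Dn0 : (0 <= Dn)%R).
  { rewrite <- HD; unfold perim; generalize (Cmod_ge_0 (y - x)) (Cmod_ge_0 (z - y)) (Cmod_ge_0 (x - z)); lra. }
  set (Aff := fun w => F z0 + l * (w - z0)).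
  set (E := fun w => F w + (- F z0 + (- l) * (w - z0))).
  assert (cA : forall w, ccont Aff w).
  { intros w; apply cdiff_ccont, cdiff_plus; [apply cdiff_const|].
    apply cdiff_mult; [apply cdiff_const|]; apply cdiff_plus; [apply cdiff_id | apply cdiff_const]. }
  assert (cE : forall w, ccont E w).
  { intros w; apply cdiff_ccont, cdiff_plus; [apply HF|]; apply cdiff_plus; [apply cdiff_const|].
    apply cdiff_mult; [apply cdiff_const|]; apply cdiff_plus; [apply cdiff_id | apply cdiff_const]. }
  assert (split : forall p q, seg F p q = seg Aff p q + seg E p q).
  { intros p q; rewrite <- seg_plus by assumption; apply seg_ext; intros w; unfold Aff, E; ring. }
  assert (HE : forall w, (Cmod (w - x) <= 2 * Dn)%R -> (Cmod (E w) <= e' * (6 * Dn))%R).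
  { intros w Hw.
    assert (Hwz : (Cmod (w - z0) <= 6 * Dn)%R).
    { replace (w - z0) with ((w - x) + (x - z0)) by ring; eapply Rle_trans; [apply Cmod_triangle|]; lra. }
    replace (E w) with (F w - F z0 - l * (w - z0)) by (unfold E; ring).
    eapply Rle_trans; [apply Hd; lra|]; apply Rmult_le_compat_l; lra. }
  unfold perim in HD.
  assert (px := Cmod_ge_0 (y - x)); assert (py := Cmod_ge_0 (z - y)); assert (pz := Cmod_ge_0 (x - z)).
  assert (Sg : forall p q, (Cmod (p - x) <= Dn)%R -> (Cmod (q - p) <= Dn)%R ->
    (Cmod (seg E p q) <= 2 * Cmod (q - p) * (e' * (6 * Dn)))%R).
  { intros p q H1 H2; apply seg_bound; [assumption|]; intros t Ht; apply HE.
    replace (path p q t - x) with ((path p q t - p) + (p - x)) by ring.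
    eapply Rle_trans; [apply Cmod_triangle|]; generalize (path_dist p q t Ht); lra. }
  assert (ET : tri F x y z = seg E x y + seg E y z + seg E z x).
  { assert (H2 : RtoC 2 <> 0) by (intros E2; apply RtoC_inj in E2; lra).
    unfold tri; rewrite !split; unfold Aff; rewrite !seg_affine; field; assumption. }
  assert (BT : (Cmod (tri F x y z) <= 12 * e' * (Dn * Dn))%R).
  { rewrite ET; eapply Rle_trans; [apply Cmod_triangle|].
    eapply Rle_trans; [apply Rplus_le_compat_r, Cmod_triangle|].
    assert (X0 : Cmod (x - x) = 0%R) by (replace (x - x) with (RtoC 0) by ring; apply Cmod_0).
    assert (X1 := Sg x y ltac:(lra) ltac:(lra)).
    assert (X2 := Sg y z ltac:(lra) ltac:(lra)).
    assert (X3 := Sg z x ltac:(rewrite (Cmod_sym z x); lra) ltac:(lra)).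
    replace (12 * e' * (Dn * Dn))%R with (2 * (Cmod (y - x) + Cmod (z - y) + Cmod (x - z)) * (e' * (6 * Dn)))%R
      by (rewrite HD; ring).
    lra. }
  eapply Rle_trans; [exact HT|].
  assert (p4 : (0 < 4 ^ n)%R) by (apply pow_lt; lra).
  assert (E4 : (4 ^ n * (Dn * Dn) = D * D)%R).
  { unfold Dn; replace 4%R with (2 * 2)%R by ring; rewrite Rpow_mult_distr; field; apply pow_nonzero; lra. }
  apply Rle_trans with (4 ^ n * (12 * e' * (Dn * Dn)))%R; [apply Rmult_le_compat_l; lra|].
  replace (4 ^ n * (12 * e' * (Dn * Dn)))%R with (12 * e' * (4 ^ n * (Dn * Dn)))%R by ring.
  rewrite E4; unfold e'.
  replace (12 * (e / (12 * (D * D + 1))) * (D * D))%R with (e * ((D * D) / (D * D + 1)))%R by (field; nra).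
  rewrite <- (Rmult_1_r e) at 2; apply Rmult_le_compat_l; [lra|].
  apply Rle_div_l; nra.
Qed.

(** * Rotating the contour *)

Definition cexp (z : C) : C := ((exp (Re z) * cos (Im z))%R, (exp (Re z) * sin (Im z))%R).

Lemma cexp_plus (z w : C) : cexp (z + w) = cexp z * cexp w.
Proof.
  unfold cexp, Cmult; simpl; rewrite exp_plus, cos_plus, sin_plus; unfold Re, Im; f_equal; ring.
Qed.

Lemma Cmod_cexp (z : C) : Cmod (cexp z) = exp (Re z).
Proof.
  unfold Cmod, cexp; simpl fst; simpl snd.
  replace ((exp (Re z) * cos (Im z)) ^ 2 + (exp (Re z) * sin (Im z)) ^ 2)%R with (Rsqr (exp (Re z))).
  - apply sqrt_Rsqr; left; apply exp_pos.
  - generalize (sin2_cos2 (Im z)); unfold Rsqr; intros E.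
    transitivity (exp (Re z) * exp (Re z) * (sin (Im z) * sin (Im z) + cos (Im z) * cos (Im z)))%R;
      [rewrite E; ring | ring].
Qed.

(** The upper bound is [1 - x <= exp (- x)] inverted, which gives [(1 - x) * exp x <= 1]. *)
Lemma exp_second_order (x : R) : (Rabs x <= / 2)%R -> (0 <= exp x - 1 - x <= 2 * x ^ 2)%R.
Proof.
  intros Hx; apply Rabs_le_between in Hx.
  assert (H1 := exp_ineq1_le x); assert (H2 := exp_ineq1_le (- x)).
  split; [lra|].
  rewrite exp_Ropp in H2.
  assert (p := exp_pos x).
  assert (H3 : ((1 + - x) * exp x <= 1)%R).
  { apply Rmult_le_reg_r with (/ exp x)%R; [apply Rinv_0_lt_compat; assumption|].
    rewrite Rmult_assoc, Rinv_r, Rmult_1_r, Rmult_1_l by lra; assumption. }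
  nra.
Qed.

Lemma sin_abs_le (x : R) : (Rabs (sin x) <= Rabs x)%R.
Proof.
  assert (pos : forall y, (0 <= y -> Rabs (sin y) <= y)%R).
  { intros y [Hy | <-]; [|rewrite sin_0, Rabs_R0; lra].
    assert (H1 := sin_lt_x y Hy).
    destruct (Rle_lt_dec 1 y) as [Hy1|Hy1].
    - generalize (SIN_bound y); intros; apply Rabs_le_between; lra.
    - assert (0 < sin y)%R by (apply sin_gt_0; [assumption | generalize PI2_1; lra]).
      apply Rabs_le_between; lra. }
  destruct (Rle_lt_dec 0 x) as [Hx|Hx].
  - rewrite (Rabs_pos_eq x) by assumption; apply pos, Hx.
  - rewrite (Rabs_left x), <- (Ropp_involutive x) by assumption; rewrite sin_neg, Rabs_Ropp.
    rewrite Ropp_involutive; apply pos; lra.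
Qed.

Lemma cos_second_order (x : R) : (0 <= 1 - cos x <= x ^ 2 / 2)%R.
Proof.
  generalize (COS_bound x); intros; split; [lra|].
  replace x with (2 * (x / 2))%R at 1 by field; rewrite cos_2a_sin.
  assert (Hs := sin_abs_le (x / 2)).
  assert (sin (x / 2) ^ 2 <= (x / 2) ^ 2)%R.
  { rewrite <- (pow2_abs (sin (x / 2))), <- (pow2_abs (x / 2)); apply pow_incr; split; [apply Rabs_pos | assumption]. }
  nra.
Qed.

Lemma sin_second_order (x : R) : (Rabs x <= / 2)%R -> (Rabs (sin x - x) <= x ^ 2)%R.
Proof.
  intros Hx.
  destruct (MVT_gen (fun y => sin y - y)%R 0 x (fun y => cos y - 1)%R) as [c [Hc E]].
  - intros y _; auto_derive; [trivial | ring].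
  - intros y _; apply cts_pt; cts_tac.
  - rewrite sin_0, !Rminus_0_r in E; rewrite E.
    assert (Hcx : (Rabs c <= Rabs x)%R).
    { unfold Rmin, Rmax in Hc; destruct (Rle_dec 0 x).
      - rewrite !Rabs_pos_eq; lra.
      - rewrite !Rabs_left1; lra. }
    assert (H := cos_second_order c); rewrite Rabs_mult.
    rewrite (Rabs_left1 (cos c - 1)) by lra.
    rewrite <- (pow2_abs c) in H; rewrite <- (pow2_abs x).
    generalize (Rabs_pos c) (Rabs_pos x); intros.
    assert (Rabs c ^ 2 <= Rabs x)%R by nra.
    nra.
Qed.

Lemma cexp_second_order (h : C) : (Cmod h <= / 2)%R -> (Cmod (cexp h - 1 - h) <= 10 * Cmod h ^ 2)%R.
Proof.
  intros Hh.
  assert (Hr := Re_le_Cmod h); assert (Hi := Im_le_Cmod h).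
  set (x := Re h) in *; set (y := Im h) in *; set (r := Cmod h) in *.
  assert (r0 : (0 <= r)%R) by apply Cmod_ge_0.
  assert (X2 : (x ^ 2 <= r ^ 2)%R) by (rewrite <- pow2_abs; apply pow_incr; split; [apply Rabs_pos | assumption]).
  assert (Y2 : (y ^ 2 <= r ^ 2)%R) by (rewrite <- pow2_abs; apply pow_incr; split; [apply Rabs_pos | assumption]).
  assert (XY : (Rabs x * Rabs y <= r ^ 2)%R).
  { replace (r ^ 2)%R with (r * r)%R by ring; apply Rmult_le_compat; auto using Rabs_pos. }
  assert (Ex := exp_second_order x ltac:(lra)).
  assert (Cy := cos_second_order y); assert (Sy := sin_second_order y ltac:(lra)).
  assert (Hx : (- / 2 <= x <= / 2)%R) by (apply Rabs_le_between; lra).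
  assert (Ex2 : (exp x <= 2)%R).
  { assert (x ^ 2 <= / 4)%R by nra. lra. }
  assert (Ex0 := exp_pos x).
  assert (Ex1 : (Rabs (exp x - 1) <= 2 * Rabs x)%R).
  { apply Rabs_le_between.
    assert (x ^ 2 <= Rabs x / 2)%R by (rewrite <- pow2_abs; generalize (Rabs_pos x); nra).
    assert (- Rabs x <= x <= Rabs x)%R by (apply Rabs_le_between, Rle_refl).
    lra. }
  eapply Rle_trans; [apply Cmod_le_sum|].
  replace (Re (cexp h - 1 - h)) with (exp x * cos y - 1 - x)%R by (unfold cexp, x, y, Re, Im; simpl; ring).
  replace (Im (cexp h - 1 - h)) with (exp x * sin y - y)%R by (unfold cexp, x, y, Re, Im; simpl; ring).
  assert (P1 : (Rabs (exp x * cos y - 1 - x) <= 3 * r ^ 2)%R).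
  { replace (exp x * cos y - 1 - x)%R with ((exp x - 1 - x) - exp x * (1 - cos y))%R by ring.
    assert (exp x * (1 - cos y) <= 2 * (y ^ 2 / 2))%R by (apply Rmult_le_compat; lra).
    assert (0 <= exp x * (1 - cos y))%R by (apply Rmult_le_pos; lra).
    apply Rabs_le_between; lra. }
  assert (P2 : (Rabs (exp x * sin y - y) <= 4 * r ^ 2)%R).
  { replace (exp x * sin y - y)%R with (exp x * (sin y - y) + (exp x - 1) * y)%R by ring.
    eapply Rle_trans; [apply Rabs_triang|]; rewrite !Rabs_mult, (Rabs_pos_eq (exp x)) by lra.
    assert (exp x * Rabs (sin y - y) <= 2 * y ^ 2)%R by (apply Rmult_le_compat; auto using Rabs_pos; lra).
    assert (Rabs (exp x - 1) * Rabs y <= 2 * Rabs x * Rabs y)%R by (apply Rmult_le_compat_r; [apply Rabs_pos | assumption]).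
    lra. }
  assert (0 <= r ^ 2)%R by apply pow2_ge_0; lra.
Qed.

Lemma cexp_first_order (h : C) : (Cmod h <= / 2)%R -> (Cmod (cexp h - 1) <= 6 * Cmod h)%R.
Proof.
  intros Hh; replace (cexp h - 1) with ((cexp h - 1 - h) + h) by ring.
  eapply Rle_trans; [apply Cmod_triangle|].
  generalize (cexp_second_order h Hh) (Cmod_ge_0 h); intros; nra.
Qed.

Lemma cdiff_cexp (z : C) : cdiff cexp z.
Proof.
  exists (cexp z); intros e He.
  assert (p : (0 < exp (Re z))%R) by apply exp_pos.
  exists (Rmin (/ 2) (e / (10 * exp (Re z))))%R; split.
  { apply Rmin_pos; [lra | apply Rdiv_lt_0_compat; lra]. }
  intros w Hw.
  replace (cexp w) with (cexp z * cexp (w - z)) by (rewrite <- cexp_plus; f_equal; ring).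
  replace (cexp z * cexp (w - z) - cexp z - cexp z * (w - z)) with (cexp z * (cexp (w - z) - 1 - (w - z))) by ring.
  rewrite Cmod_mult, Cmod_cexp.
  set (h := Cmod (w - z)) in *.
  assert (h0 : (0 <= h)%R) by apply Cmod_ge_0.
  assert (Hw1 : (h < / 2)%R) by (eapply Rlt_le_trans; [exact Hw | apply Rmin_l]).
  assert (Hw2 : (h <= e / (10 * exp (Re z)))%R) by (left; eapply Rlt_le_trans; [exact Hw | apply Rmin_r]).
  assert (X := cexp_second_order (w - z) ltac:(fold h; lra)); fold h in X.
  apply Rle_trans with (exp (Re z) * (10 * h ^ 2))%R; [apply Rmult_le_compat_l; lra|].
  replace (exp (Re z) * (10 * h ^ 2))%R with (h * (10 * exp (Re z)) * h)%R by ring.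
  apply Rmult_le_compat_r; [assumption|].
  apply Rle_trans with (e / (10 * exp (Re z)) * (10 * exp (Re z)))%R; [apply Rmult_le_compat_r; lra | right; field; lra].
Qed.

Lemma seg_ray (F : C -> C) (d : C) (T : R) : (forall z, ccont F z) ->
  seg F 0 (RtoC T * d) = d * CI (fun t => F (RtoC t * d)) 0 T.
Proof.
  intros H; unfold seg.
  assert (cr : ccts (fun t => F (RtoC t * d))).
  { apply ccts_comp; [assumption|]; apply ccts_mult; [apply ccts_RtoC, cts_id | apply ccts_const]. }
  assert (E := CI_comp_lin (fun t => F (RtoC t * d)) T 0 0 1 cr).
  rewrite Rmult_0_r, Rmult_1_r, !Rplus_0_r in E; rewrite <- E.
  rewrite (CI_ext (fun y => RtoC T * F (RtoC (T * y + 0)%R * d)) (fun t => RtoC T * F (path 0 (RtoC T * d) t))).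
  - rewrite CI_scal by (apply ccts_along; assumption); ring.
  - intros t; do 2 f_equal; unfold path; rewrite Rplus_0_r, RtoC_mult; ring.
Qed.

Lemma gaussian_beats_exp (K A eps e : R) : (0 <= K -> 0 <= A -> 0 < eps -> 0 < e ->
  exists R0, 0 < R0 /\ forall R, R0 <= R -> K * R * exp (A * R - eps * R ^ 2) <= e)%R.
Proof.
  intros HK HA Heps He.
  exists (Rmax 1 (Rmax ((A + 2) / eps) (K / e)))%R; split.
  { apply Rlt_le_trans with 1%R; [lra | apply Rmax_l]. }
  intros R HR.
  assert (H1 : (1 <= R)%R) by (eapply Rle_trans; [apply Rmax_l | exact HR]).
  assert (HR' := Rle_trans _ _ _ (Rmax_r _ _) HR).
  assert (H2 : ((A + 2) / eps <= R)%R) by (eapply Rle_trans; [apply Rmax_l | exact HR']).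
  assert (H3 : (K / e <= R)%R) by (eapply Rle_trans; [apply Rmax_r | exact HR']).
  assert (H2' : (A + 2 <= R * eps)%R) by (apply (proj1 (Rle_div_l _ _ _ Heps)); assumption).
  assert (H3' : (K <= R * e)%R) by (apply (proj1 (Rle_div_l _ _ _ He)); assumption).
  apply Rle_trans with (K * R * exp (- (2 * R)))%R.
  - apply Rmult_le_compat_l; [apply Rmult_le_pos; lra|]; apply exp_le_mono; nra.
  - replace (- (2 * R))%R with (- R + - R)%R by ring; rewrite exp_plus, exp_Ropp.
    assert (E := exp_ineq1_le R).
    assert (R * / exp R <= 1)%R by (apply (Rle_div_l R 1 (exp R)); lra).
    assert (0 < / exp R)%R by (apply Rinv_0_lt_compat; lra).
    assert (K * / exp R <= e)%R by (apply (Rle_div_l K e (exp R)); nra).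
    replace (K * R * (/ exp R * / exp R))%R with ((R * / exp R) * (K * / exp R))%R by ring.
    apply Rle_trans with (1 * e)%R; [|lra].
    apply Rmult_le_compat; try lra; apply Rmult_le_pos; lra.
Qed.

Lemma linear_exp_decay (K c e : R) : (0 <= K -> 0 < c -> 0 < e ->
  exists R0, 0 < R0 /\ forall R, R0 <= R -> K * R * exp (- (c * R)) <= e)%R.
Proof.
  intros HK Hc He.
  exists (Rmax 1 (8 * K / (c ^ 2 * e)))%R; split; [apply Rlt_le_trans with 1%R; [lra | apply Rmax_l]|].
  intros R HR.
  assert (H1 : (1 <= R)%R) by (eapply Rle_trans; [apply Rmax_l | exact HR]).
  assert (H2 : (8 * K / (c ^ 2 * e) <= R)%R) by (eapply Rle_trans; [apply Rmax_r | exact HR]).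
  assert (c2 : (0 < c ^ 2)%R) by (apply pow_lt; assumption).
  assert (H3 : (8 * K <= R * (c ^ 2 * e))%R) by (apply (proj1 (Rle_div_l _ _ (c ^ 2 * e)%R ltac:(nra))); assumption).
  replace (- (c * R))%R with (- (c * R / 2) + - (c * R / 2))%R by field.
  rewrite exp_plus, !exp_Ropp.
  assert (E := exp_ineq1_le (c * R / 2)).
  set (y := exp (c * R / 2)) in *.
  assert (Hy : (c * R / 2 <= y)%R) by lra.
  assert (cR : (0 < c * R)%R) by nra.
  rewrite <- Rinv_mult.
  apply (Rle_div_l (K * R) e (y * y)); [nra|].
  assert ((c * R / 2) * (c * R / 2) <= y * y)%R by (apply Rmult_le_compat; lra).
  apply Rle_trans with (e * ((c * R / 2) * (c * R / 2)))%R; [|apply Rmult_le_compat_l; lra].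
  nra.
Qed.

(** * Moving a real half-line to the negative imaginary half-line *)

Section Rotation.

Variables (G : C -> C) (M tau b s B : R).
Hypothesis HG : forall z, cdiff G z.
Hypothesis HM : forall z, (Cmod (G z) <= M * exp (tau * Cmod z))%R.
Hypothesis Htau : (0 <= tau < b)%R.
Hypothesis Hs : s = 1%R \/ s = (-1)%R.
Hypothesis HB : forall T, (0 <= T)%R -> (RInt (fun x => Cmod (G (RtoC (s * x)))) 0 T <= B)%R.

(** The integrand of the Fourier integral at angular frequency [b]. Its modulus is that of [G] times
    [exp (b * Im z)], so it decays along directions close to [- Ci]. *)
Definition osc (z : C) : C := G z * cexp ((- Ci * RtoC b) * z).

(** A slope so small that along [d1], of modulus at most [1 + ka], the decay [b] still beats the
    growth [tau * (1 + ka)]; [c] is the margin. *)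
Let ka := ((b - tau) / (2 * (tau + 1)))%R.
Let d1 : C := ((s * ka)%R, (-1)%R).
Let c := (b - tau * (1 + ka))%R.
Let m : C := (1%R, (s / ka)%R).

(* On the sector spanned by [s] and [d1] one has [Re (m z^2) >= |z|^2]: the damping factor beats
   the exponential growth of [G], which is not controlled by [|Im z|] there. *)
Definition damped (eps : R) (z : C) : C := osc z * cexp ((- (RtoC eps * m)) * (z * z)).

Lemma ka_pos : (0 < ka)%R.
Proof. apply Rdiv_lt_0_compat; lra. Qed.

Lemma c_pos : (0 < c)%R.
Proof.
  unfold c, ka.
  assert (tau * ((b - tau) / (2 * (tau + 1))) <= (b - tau) / 2)%R; [|lra].
  apply Rle_trans with ((tau + 1) * ((b - tau) / (2 * (tau + 1))))%R; [|right; field; lra].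
  apply Rmult_le_compat_r; [apply Rlt_le, ka_pos | lra].
Qed.

Lemma M_pos : (0 <= M)%R.
Proof.
  specialize (HM 0); rewrite Cmod_0, Rmult_0_r, exp_0, Rmult_1_r in HM.
  eapply Rle_trans; [apply Cmod_ge_0 | exact HM].
Qed.

Lemma s_sq : (s * s = 1)%R.
Proof. destruct Hs as [-> | ->]; ring. Qed.

Lemma cdiff_osc (z : C) : cdiff osc z.
Proof.
  apply cdiff_mult; [apply HG|]; apply (cdiff_comp cexp); [apply cdiff_cexp|].
  apply cdiff_mult; [apply cdiff_const | apply cdiff_id].
Qed.

Lemma cdiff_damped (eps : R) (z : C) : cdiff (damped eps) z.
Proof.
  apply cdiff_mult; [apply cdiff_osc|]; apply (cdiff_comp cexp); [apply cdiff_cexp|].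
  apply cdiff_mult; [apply cdiff_const |]; apply cdiff_mult; apply cdiff_id.
Qed.

Lemma Cmod_osc (z : C) : Cmod (osc z) = (Cmod (G z) * exp (b * Im z))%R.
Proof.
  unfold osc; rewrite Cmod_mult, Cmod_cexp; do 2 f_equal; unfold Re, Im; simpl; ring.
Qed.

Lemma osc_bound (z : C) : (Cmod (osc z) <= M * exp (tau * Cmod z + b * Im z))%R.
Proof.
  rewrite Cmod_osc, exp_plus, <- Rmult_assoc.
  apply Rmult_le_compat_r; [left; apply exp_pos | apply HM].
Qed.

Lemma Cmod_sqr (z : C) : (Cmod z ^ 2 = Re z ^ 2 + Im z ^ 2)%R.
Proof.
  unfold Cmod; rewrite pow2_sqrt; [reflexivity|].
  generalize (pow2_ge_0 (fst z)) (pow2_ge_0 (snd z)); lra.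
Qed.

(** [al] and [be] are the coordinates of [z] in the basis [s], [d1]. The imaginary part of [m] turns
    the mixed term of [z * z] into at least [2 * be ^ 2], which compensates for [- Im z ^ 2]. *)
Lemma damped_bound (eps al be : R) (z : C) : (0 <= eps)%R -> (0 <= al)%R -> (0 <= be)%R ->
  Re z = (s * (al + be * ka))%R -> Im z = (- be)%R ->
  (Cmod (damped eps z) <= Cmod (osc z) * exp (- (eps * Cmod z ^ 2)))%R.
Proof.
  intros He Ha Hb E1 E2; unfold damped; rewrite Cmod_mult, Cmod_cexp.
  apply Rmult_le_compat_l; [apply Cmod_ge_0|]; apply exp_le_mono.
  assert (k := ka_pos); assert (ss := s_sq).
  assert (E : Re ((- (RtoC eps * m)) * (z * z))
     = (- (eps * (Re z ^ 2 - Im z ^ 2 - s / ka * (2 * (Re z * Im z)))))%R).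
  { unfold m, Re, Im; simpl; ring. }
  rewrite E, Cmod_sqr; apply Ropp_le_contravar, Rmult_le_compat_l; [assumption|].
  rewrite E1, E2.
  replace (s / ka * (2 * (s * (al + be * ka) * - be)))%R with (- ((s * s) * (2 * be * (al / ka + be))))%R
    by (field; lra).
  rewrite ss.
  assert (0 <= al / ka)%R by (apply Rle_mult_inv_pos; assumption).
  assert (0 <= be * (al / ka))%R by (apply Rmult_le_pos; assumption).
  nra.
Qed.

Lemma Cmod_d1 : (Cmod d1 <= 1 + ka)%R.
Proof.
  assert (k := ka_pos).
  eapply Rle_trans; [apply Cmod_le_sum|]; unfold d1, Re, Im; simpl.
  rewrite Rabs_mult, (Rabs_pos_eq ka), (Rabs_left (-1)) by lra.
  destruct Hs as [-> | ->]; [rewrite Rabs_R1 | rewrite Rabs_left by lra]; lra.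
Qed.

Lemma Cmod_s : Cmod (RtoC s) = 1%R.
Proof.
  rewrite Cmod_R; destruct Hs as [-> | ->]; [apply Rabs_R1 | rewrite Rabs_left by lra; ring].
Qed.

(** Goursat on the triangle [0], [R s], [R d1], with [R] large: the Gaussian removes the far side.
    The bound does not involve [eps], so the damping can be lifted afterwards at fixed [R']. *)
Lemma rotation_damped (eps R' : R) : (0 < eps)%R -> (0 <= R')%R -> forall tail, 
  (forall R, R' <= R -> RInt (fun x => Cmod (G (RtoC (s * x)))) R' R <= tail)%R ->
  (Cmod (seg (damped eps) 0 (RtoC R' * RtoC s) - seg (damped eps) 0 (RtoC R' * d1))
    <= 2 * tail + 2 * (1 + ka) * (M * (exp (- (c * R')) / c)))%R.
Proof.
  intros He HR' tail Htail; apply Rle_eps; intros e' He'.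
  assert (k := ka_pos); assert (pc := c_pos); assert (pM := M_pos).
  assert (cD : forall z, ccont (damped eps) z) by (intros; apply cdiff_ccont, cdiff_damped).
  assert (cO : forall z, ccont osc z) by (intros; apply cdiff_ccont, cdiff_osc).
  assert (cG : forall z, ccont G z) by (intros; apply cdiff_ccont, HG).
  (* On the far side [|z|] lies between [R / 2] and [(2 + ka) * R], and that side is no longer than
     [(2 + ka) * R]; hence these constants. *)
  destruct (gaussian_beats_exp (2 * (2 + ka) * M) (tau * (2 + ka)) (eps / 4) e') as [R0 [pR0 HR0]]; try nra.
  set (R := (R0 + R')%R); specialize (HR0 R ltac:(unfold R; lra)).
  assert (HR : (R' <= R)%R) by (unfold R; lra).
  assert (Rp : (0 < R)%R) by (unfold R; lra).
  assert (cray : forall d, ccts (fun t => damped eps (RtoC t * d))).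
  { intros d; apply ccts_comp; [assumption|]; apply ccts_mult; [apply ccts_RtoC, cts_id | apply ccts_const]. }
  assert (T := goursat (damped eps) (cdiff_damped eps) 0 (RtoC R * RtoC s) (RtoC R * d1)).
  unfold tri in T; rewrite (seg_rev _ 0 (RtoC R * d1) cD) in T.
  assert (chord : (Cmod (seg (damped eps) (RtoC R * RtoC s) (RtoC R * d1)) <= e')%R).
  { eapply Rle_trans; [apply (seg_bound _ _ _ (M * exp (tau * (2 + ka) * R - eps / 4 * R ^ 2))); [assumption|]|].
    - intros u Hu.
      set (z := path (RtoC R * RtoC s) (RtoC R * d1) u).
      assert (E1 : Re z = (s * (R * (1 - u) + R * u * ka))%R) by (unfold z, path, d1, Re; simpl; ring).
      assert (E2 : Im z = (- (R * u))%R) by (unfold z, path, d1, Im; simpl; ring).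
      eapply Rle_trans; [apply (damped_bound eps (R * (1 - u)) (R * u)); auto; try (apply Rmult_le_pos; lra); lra|].
      assert (zU : (Cmod z <= R * (2 + ka))%R).
      { eapply Rle_trans; [apply Cmod_le_sum|]; rewrite E1, E2, Rabs_mult, Rabs_Ropp.
        replace (Rabs s) with 1%R by (rewrite <- Cmod_R, Cmod_s; reflexivity).
        assert (0 <= R * u)%R by (apply Rmult_le_pos; lra).
        assert (0 <= R * (1 - u))%R by (apply Rmult_le_pos; lra).
        assert (0 <= R * u * ka)%R by (apply Rmult_le_pos; lra).
        assert (0 <= R * (1 - u) * ka)%R by (apply Rmult_le_pos; lra).
        rewrite !Rabs_pos_eq by lra; lra. }
      assert (zL : (R ^ 2 / 4 <= Cmod z ^ 2)%R).
      { rewrite Cmod_sqr, E1, E2.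
        replace ((s * (R * (1 - u) + R * u * ka)) ^ 2 + (- (R * u)) ^ 2)%R
          with ((s * s) * (R * (1 - u) + R * u * ka) ^ 2 + (R * u) ^ 2)%R by ring.
        rewrite s_sq, Rmult_1_l.
        assert (0 <= R * u * ka)%R by (apply Rmult_le_pos; nra).
        assert (0 <= R * (1 - u))%R by nra.
        assert ((R * (1 - u)) ^ 2 <= (R * (1 - u) + R * u * ka) ^ 2)%R by (apply pow_incr; lra).
        assert (R ^ 2 / 4 <= (R * (1 - u)) ^ 2 + (R * u) ^ 2)%R; [|lra].
        replace ((R * (1 - u)) ^ 2 + (R * u) ^ 2)%R with (R ^ 2 * (1 - 2 * u + 2 * u ^ 2))%R by ring.
        assert (0 <= R ^ 2)%R by apply pow2_ge_0. assert (/ 2 <= 1 - 2 * u + 2 * u ^ 2)%R by (generalize (pow2_ge_0 (u - / 2)%R); lra); nra. }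
      apply Rle_trans with (M * exp (tau * (2 + ka) * R) * exp (- (eps / 4 * R ^ 2)))%R.
      + apply Rmult_le_compat; [apply Cmod_ge_0 | left; apply exp_pos | |].
        * eapply Rle_trans; [apply osc_bound|]; apply Rmult_le_compat_l; [assumption|]; apply exp_le_mono.
          rewrite E2; assert (0 <= b * (R * u))%R by (apply Rmult_le_pos; nra).
          assert (tau * Cmod z <= tau * (R * (2 + ka)))%R by (apply Rmult_le_compat_l; lra). lra.
        * apply exp_le_mono; nra.
      + rewrite Rmult_assoc, <- exp_plus; right; do 2 f_equal; ring.
    - assert (HL : (Cmod (RtoC R * d1 - RtoC R * RtoC s) <= R * (2 + ka))%R).
      { replace (RtoC R * d1 - RtoC R * RtoC s) with (RtoC R * (d1 - RtoC s)) by ring.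
        rewrite Cmod_mult, Cmod_R, Rabs_pos_eq by lra; apply Rmult_le_compat_l; [lra|].
        replace (d1 - RtoC s) with (d1 + - RtoC s) by ring.
        eapply Rle_trans; [apply Cmod_triangle|]; rewrite Cmod_opp, Cmod_s; generalize Cmod_d1; lra. }
      eapply Rle_trans; [|exact HR0].
      assert (pe : (0 < exp (tau * (2 + ka) * R - eps / 4 * R ^ 2))%R) by apply exp_pos.
      set (X := exp (tau * (2 + ka) * R - eps / 4 * R ^ 2)) in *.
      assert (0 <= M * X)%R by (apply Rmult_le_pos; lra).
      apply Rle_trans with (2 * (R * (2 + ka)) * (M * X))%R; [|right; ring].
      apply Rmult_le_compat_r; lra. }
  assert (tailS : (Cmod (seg (damped eps) 0 (RtoC R * RtoC s) - seg (damped eps) 0 (RtoC R' * RtoC s)) <= 2 * tail)%R).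
  { rewrite !seg_ray by assumption.
    rewrite (CI_Chasles _ 0 R' R (cray (RtoC s))).
    match goal with |- (Cmod (?x * (?y + ?z) - ?x * ?y) <= _)%R => replace (x * (y + z) - x * y) with (x * z) by ring end.
    rewrite Cmod_mult, Cmod_s, Rmult_1_l.
    eapply Rle_trans; [apply (CI_bound _ (fun x => Cmod (G (RtoC (s * x))))); auto|].
    - apply cts_Cmod, ccts_comp; [assumption|]; apply ccts_RtoC; cts_tac.
    - intros t Ht; eapply Rle_trans; [apply (damped_bound eps t 0); try lra|].
      + unfold Re; simpl; ring.
      + unfold Im; simpl; ring.
      + rewrite Cmod_osc.
        replace (RtoC t * RtoC s) with (RtoC (s * t)) by (rewrite RtoC_mult; ring).
        replace (Im (RtoC (s * t))) with 0%R by reflexivity.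
        rewrite Rmult_0_r, exp_0, Rmult_1_r.
        rewrite <- (Rmult_1_r (Cmod (G (RtoC (s * t))))) at 2.
        apply Rmult_le_compat_l; [apply Cmod_ge_0|]; rewrite <- exp_0; apply exp_le_mono.
        generalize (Rmult_le_pos _ _ (Rlt_le _ _ He) (pow2_ge_0 (Cmod (RtoC (s * t))))); lra.
    - specialize (Htail R HR); lra. }
  assert (tailD : (Cmod (seg (damped eps) 0 (RtoC R * d1) - seg (damped eps) 0 (RtoC R' * d1))
      <= 2 * (1 + ka) * (M * (exp (- (c * R')) / c)))%R).
  { rewrite !seg_ray by assumption.
    rewrite (CI_Chasles _ 0 R' R (cray d1)).
    match goal with |- (Cmod (?x * (?y + ?z) - ?x * ?y) <= _)%R => replace (x * (y + z) - x * y) with (x * z) by ring end.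
    rewrite Cmod_mult.
    assert (Hi : (Cmod (CI (fun t => damped eps (RtoC t * d1)) R' R) <= 2 * (M * (exp (- (c * R')) / c)))%R).
    { eapply Rle_trans; [apply (CI_bound _ (fun x => M * exp (- (c * x)))%R); auto; [cts_tac|]|].
      - intros t Ht; eapply Rle_trans; [apply (damped_bound eps 0 t); try lra|].
        + unfold d1, Re; simpl; ring.
        + unfold d1, Im; simpl; ring.
        + assert (X : (Cmod (osc (RtoC t * d1)) <= M * exp (- (c * t)))%R).
          { eapply Rle_trans; [apply osc_bound|]; apply Rmult_le_compat_l; [assumption|]; apply exp_le_mono.
            replace (Im (RtoC t * d1)) with (- t)%R by (unfold d1, Im; simpl; ring).
            rewrite Cmod_mult, Cmod_R, Rabs_pos_eq by lra.
            assert (t * Cmod d1 <= t * (1 + ka))%R by (apply Rmult_le_compat_l; [lra | apply Cmod_d1]).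
            assert (tau * (t * Cmod d1) <= tau * (t * (1 + ka)))%R by (apply Rmult_le_compat_l; lra).
            unfold c; lra. }
          eapply Rle_trans; [|exact X].
          rewrite <- (Rmult_1_r (Cmod (osc (RtoC t * d1)))) at 2.
          apply Rmult_le_compat_l; [apply Cmod_ge_0|]; rewrite <- exp_0; apply exp_le_mono.
          generalize (Rmult_le_pos _ _ (Rlt_le _ _ He) (pow2_ge_0 (Cmod (RtoC t * d1)))); lra.
      - rewrite (RInt_of_derive (fun x => - (M * (exp (- (c * x)) / c)))%R); [| | cts_tac].
        + assert (0 < exp (- (c * R)))%R by apply exp_pos.
          assert (0 <= M * (exp (- (c * R)) / c))%R.
          { apply Rmult_le_pos; [assumption|]; apply Rle_mult_inv_pos; lra. }
          lra.
        + intros x; auto_derive; [trivial | field; lra]. }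
    assert (X := Cmod_d1); assert (X0 := Cmod_ge_0 d1).
    apply Rle_trans with ((1 + ka) * (2 * (M * (exp (- (c * R')) / c))))%R; [|right; ring].
    apply Rmult_le_compat; auto using Cmod_ge_0. }
  replace (seg (damped eps) 0 (RtoC R' * RtoC s) - seg (damped eps) 0 (RtoC R' * d1))
    with (- (seg (damped eps) 0 (RtoC R * RtoC s) - seg (damped eps) 0 (RtoC R' * RtoC s))
      + ((seg (damped eps) 0 (RtoC R * d1) - seg (damped eps) 0 (RtoC R' * d1))
      + ((seg (damped eps) 0 (RtoC R * RtoC s) + seg (damped eps) (RtoC R * RtoC s) (RtoC R * d1)
           + - seg (damped eps) 0 (RtoC R * d1)) - seg (damped eps) (RtoC R * RtoC s) (RtoC R * d1)))) by ring.
  rewrite T.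
  eapply Rle_trans; [apply Cmod_triangle|].
  eapply Rle_trans; [apply Rplus_le_compat_l, Cmod_triangle|].
  replace (0 - seg (damped eps) (RtoC R * RtoC s) (RtoC R * d1)) with (- seg (damped eps) (RtoC R * RtoC s) (RtoC R * d1)) by ring.
  rewrite !Cmod_opp; lra.
Qed.

(** On a segment of fixed length the damping factor tends to 1 uniformly: [K] bounds [osc] there and
    [Q] bounds [m * z ^ 2]. *)
Lemma damped_limit (d : C) (R' : R) : (0 <= R')%R -> forall e, (0 < e)%R -> exists eps, (0 < eps)%R /\
  forall eps', (0 < eps' <= eps)%R -> (Cmod (seg (damped eps') 0 (RtoC R' * d) - seg osc 0 (RtoC R' * d)) <= e)%R.
Proof.
  intros HR' e He.
  assert (pM := M_pos).
  set (r := (R' * Cmod d)%R).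
  assert (Hd := Cmod_ge_0 d); assert (Hm := Cmod_ge_0 m).
  assert (r0 : (0 <= r)%R) by (apply Rmult_le_pos; assumption).
  set (Q := (Cmod m * r ^ 2)%R).
  assert (Q0 : (0 <= Q)%R) by (apply Rmult_le_pos; [assumption | apply pow2_ge_0]).
  set (K := (M * exp ((tau + b) * r))%R).
  assert (K0 : (0 <= K)%R) by (apply Rmult_le_pos; [assumption | left; apply exp_pos]).
  assert (KQ : (0 <= r * (K * Q))%R) by (apply Rmult_le_pos; [|apply Rmult_le_pos]; assumption).
  (* The first bound brings the exponent into the range of [cexp_first_order]; 12 is its factor 6
     times the factor 2 of [CI_bound_const]. *)
  exists (Rmin (/ (2 * (Q + 1))) (e / (12 * (r * (K * Q) + 1))))%R; split.
  { apply Rmin_pos; [apply Rinv_0_lt_compat; lra | apply Rdiv_lt_0_compat; lra]. }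
  intros eps' [p1 p2].
  assert (h1 : (eps' * Q <= / 2)%R).
  { apply Rle_trans with (/ (2 * (Q + 1)) * (Q + 1))%R; [|right; field; lra].
    apply Rmult_le_compat; try lra; eapply Rle_trans; [exact p2 | apply Rmin_l]. }
  assert (h2 : (eps' * (12 * (r * (K * Q))) <= e)%R).
  { apply Rle_trans with (e / (12 * (r * (K * Q) + 1)) * (12 * (r * (K * Q) + 1)))%R; [|right; field; lra].
    apply Rmult_le_compat; try lra; eapply Rle_trans; [exact p2 | apply Rmin_r]. }
  assert (cD : forall z, ccont (damped eps') z) by (intros; apply cdiff_ccont, cdiff_damped).
  assert (cO : forall z, ccont osc z) by (intros; apply cdiff_ccont, cdiff_osc).
  assert (cray : forall F, (forall z, ccont F z) -> ccts (fun t => F (RtoC t * d))).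
  { intros F cF; apply ccts_comp; [assumption|]; apply ccts_mult; [apply ccts_RtoC, cts_id | apply ccts_const]. }
  rewrite !seg_ray by assumption.
  match goal with |- (Cmod (?x * ?y - ?x * ?z) <= _)%R => replace (x * y - x * z) with (x * (y - z)) by ring end.
  rewrite <- CI_minus by (apply cray; assumption).
  rewrite Cmod_mult.
  apply Rle_trans with (Cmod d * (2 * ((R' - 0) * (K * (6 * (eps' * Q))))))%R.
  - apply Rmult_le_compat_l; [assumption|].
    apply CI_bound_const; [|assumption|].
    { apply ccts_minus; apply cray; assumption. }
    intros t Ht; unfold damped.
    set (z := RtoC t * d).
    replace (osc z * cexp (- (RtoC eps' * m) * (z * z)) - osc z) with (osc z * (cexp (- (RtoC eps' * m) * (z * z)) - 1)) by ring.
    rewrite Cmod_mult.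
    assert (Hz : (Cmod z <= r)%R).
    { unfold z, r; rewrite Cmod_mult, Cmod_R, Rabs_pos_eq by lra; apply Rmult_le_compat_r; lra. }
    assert (z0 := Cmod_ge_0 z).
    assert (Hh : (Cmod (- (RtoC eps' * m) * (z * z)) <= eps' * Q)%R).
    { rewrite !Cmod_mult, Cmod_opp, Cmod_mult, Cmod_R, Rabs_pos_eq by lra; unfold Q.
      rewrite Rmult_assoc; apply Rmult_le_compat_l; [lra|]; apply Rmult_le_compat_l; [assumption|].
      replace (r ^ 2)%R with (r * r)%R by ring; apply Rmult_le_compat; assumption. }
    apply Rmult_le_compat; try apply Cmod_ge_0.
    + eapply Rle_trans; [apply osc_bound|]; unfold K; apply Rmult_le_compat_l; [assumption|]; apply exp_le_mono.
      assert (Im z <= Cmod z)%R by (eapply Rle_trans; [apply Rle_abs | apply Im_le_Cmod]).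
      assert (tau * Cmod z <= tau * r)%R by (apply Rmult_le_compat_l; lra).
      assert (b * Im z <= b * r)%R by (apply Rmult_le_compat_l; lra).
      lra.
    + eapply Rle_trans; [apply cexp_first_order; lra|]; lra.
  - eapply Rle_trans; [|exact h2]; unfold r; right; ring.
Qed.

(** Two stages meet at the direction [d1]: from [s] to [d1] through the damped integrand, and from
    [d1] to [- Ci] without damping. *)
Lemma rotation : forall e, (0 < e)%R -> exists R0, (0 < R0)%R /\ forall R, (R0 <= R)%R ->
  (Cmod (seg osc 0 (RtoC R * RtoC s) - seg osc 0 (RtoC R * (- Ci))) <= e)%R.
Proof.
  intros e He.
  assert (k := ka_pos); assert (pc := c_pos); assert (pM := M_pos).
  assert (cO : forall z, ccont osc z) by (intros; apply cdiff_ccont, cdiff_osc).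
  assert (cG : forall z, ccont G z) by (intros; apply cdiff_ccont, HG).
  assert (cg : cts (fun x => Cmod (G (RtoC (s * x))))).
  { apply cts_Cmod, ccts_comp; [assumption|]; apply ccts_RtoC; cts_tac. }
  destruct (increasing_bounded_lim (fun T => RInt (fun x => Cmod (G (RtoC (s * x)))) 0 T) B) as [L [_ [L1 L2]]].
  { intros x y Hxy; apply RInt_monotone_bounds; [assumption | intros; apply Cmod_ge_0 | lra | lra]. }
  { exact HB. }
  destruct (L2 (e / 12)%R) as [Ra [pRa HRa]]; [lra|].
  destruct (linear_exp_decay (2 * (1 + ka) * (M / c)) c (e / 6)) as [Rb [pRb HRb]]; try lra.
  { apply Rmult_le_pos; [lra|]; apply Rle_mult_inv_pos; assumption. }
  destruct (linear_exp_decay (2 * ka * M) c (e / 3)) as [Rc [pRc HRc]]; try lra.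
  { apply Rmult_le_pos; [lra | assumption]. }
  exists (1 + Ra + Rb + Rc)%R; split; [lra|]; intros R HR.
  specialize (HRa R ltac:(lra)); specialize (HRb R ltac:(lra)); specialize (HRc R ltac:(lra)).
  assert (S1 : (Cmod (seg osc 0 (RtoC R * RtoC s) - seg osc 0 (RtoC R * d1)) <= e / 3)%R).
  { apply Rle_eps; intros e' He'.
    destruct (damped_limit (RtoC s) R ltac:(lra) (e' / 2) ltac:(lra)) as [ea [pea Hea]].
    destruct (damped_limit d1 R ltac:(lra) (e' / 2) ltac:(lra)) as [eb [peb Heb]].
    set (eps := Rmin ea eb).
    assert (peps : (0 < eps)%R) by (apply Rmin_pos; assumption).
    specialize (Hea eps (conj peps (Rmin_l _ _))); specialize (Heb eps (conj peps (Rmin_r _ _))).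
    assert (X := rotation_damped eps R peps ltac:(lra) (e / 12)%R).
    assert (Ht : (forall R1, R <= R1 -> RInt (fun x => Cmod (G (RtoC (s * x)))) R R1 <= e / 12)%R).
    { intros R1 HR1; specialize (L1 R1 ltac:(lra)).
      rewrite (RInt_c_Chasles _ 0 R R1 cg) in L1; simpl in *; lra. }
    specialize (X Ht).
    assert (Y : (2 * (1 + ka) * (M * (exp (- (c * R)) / c)) <= e / 6)%R).
    { eapply Rle_trans; [|exact HRb].
      assert (p : (0 < exp (- (c * R)))%R) by apply exp_pos.
      apply Rle_trans with (2 * (1 + ka) * (M / c) * 1 * exp (- (c * R)))%R; [right; field; lra|].
      apply Rmult_le_compat_r; [lra|]; apply Rmult_le_compat_l; [|lra].
      apply Rmult_le_pos; [lra|]; apply Rle_mult_inv_pos; assumption. }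
    replace (seg osc 0 (RtoC R * RtoC s) - seg osc 0 (RtoC R * d1))
      with (- (seg (damped eps) 0 (RtoC R * RtoC s) - seg osc 0 (RtoC R * RtoC s))
       + ((seg (damped eps) 0 (RtoC R * RtoC s) - seg (damped eps) 0 (RtoC R * d1))
       + (seg (damped eps) 0 (RtoC R * d1) - seg osc 0 (RtoC R * d1)))) by ring.
    eapply Rle_trans; [apply Cmod_triangle|].
    eapply Rle_trans; [apply Rplus_le_compat_l, Cmod_triangle|].
    rewrite Cmod_opp; lra. }
  (* The side opposite 0 is horizontal, at height [- R], where the factor [exp (b * Im z)]
     suffices. *)
  assert (S2 : (Cmod (seg osc 0 (RtoC R * d1) - seg osc 0 (RtoC R * (- Ci))) <= e / 3)%R).
  { assert (T := goursat osc cdiff_osc 0 (RtoC R * d1) (RtoC R * (- Ci))).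
    unfold tri in T; rewrite (seg_rev _ 0 (RtoC R * (- Ci)) cO) in T.
    replace (seg osc 0 (RtoC R * d1) - seg osc 0 (RtoC R * (- Ci)))
      with ((seg osc 0 (RtoC R * d1) + seg osc (RtoC R * d1) (RtoC R * (- Ci)) + - seg osc 0 (RtoC R * (- Ci)))
        - seg osc (RtoC R * d1) (RtoC R * (- Ci))) by ring.
    rewrite T; replace (0 - seg osc (RtoC R * d1) (RtoC R * - Ci)) with (- seg osc (RtoC R * d1) (RtoC R * (- Ci))) by ring.
    rewrite Cmod_opp.
    eapply Rle_trans; [apply (seg_bound _ _ _ (M * exp (- (c * R)))); [assumption|]|].
    - intros u Hu; eapply Rle_trans; [apply osc_bound|]; apply Rmult_le_compat_l; [assumption|]; apply exp_le_mono.
      set (z := path (RtoC R * d1) (RtoC R * - Ci) u).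
      assert (E1 : Re z = (s * (R * (1 - u) * ka))%R) by (unfold z, path, d1, Re; simpl; ring).
      assert (E2 : Im z = (- R)%R) by (unfold z, path, d1, Im; simpl; ring).
      assert (zU : (Cmod z <= R * (1 + ka))%R).
      { eapply Rle_trans; [apply Cmod_le_sum|]; rewrite E1, E2, Rabs_mult, Rabs_Ropp.
        replace (Rabs s) with 1%R by (rewrite <- Cmod_R, Cmod_s; reflexivity).
        assert (0 <= R * u * ka)%R by (apply Rmult_le_pos; [apply Rmult_le_pos|]; lra).
        assert (0 <= R * (1 - u) * ka)%R by (apply Rmult_le_pos; [apply Rmult_le_pos|]; lra).
        rewrite !Rabs_pos_eq by lra; lra. }
      rewrite E2; assert (tau * Cmod z <= tau * (R * (1 + ka)))%R by (apply Rmult_le_compat_l; lra).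
      unfold c; lra.
    - replace (RtoC R * - Ci - RtoC R * d1) with (RtoC (- (R * ka)) * RtoC s).
      2:{ unfold d1, Ci, RtoC, Cmult, Cminus, Cplus, Copp; simpl; f_equal; ring. }
      rewrite Cmod_mult, Cmod_s, Cmod_R, Rabs_Ropp, Rabs_pos_eq by nra.
      eapply Rle_trans; [|exact HRc]; right; ring. }
  replace (seg osc 0 (RtoC R * RtoC s) - seg osc 0 (RtoC R * - Ci))
    with ((seg osc 0 (RtoC R * RtoC s) - seg osc 0 (RtoC R * d1))
      + (seg osc 0 (RtoC R * d1) - seg osc 0 (RtoC R * - Ci))) by ring.
  eapply Rle_trans; [apply Cmod_triangle|]; lra.
Qed.

End Rotation.

(** * Vanishing of the Fourier integral at frequencies beyond the type *)

Lemma CI_reflect (g : R -> C) (T : R) : ccts g -> CI (fun t => g (- t)%R) 0 T = CI g (- T) 0.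
Proof.
  intros [g1 g2]; unfold CI; f_equal.
  - rewrite (RInt_c_reflect (fun t => Re (g t)) 0 T g1), Ropp_0; reflexivity.
  - rewrite (RInt_c_reflect (fun t => Im (g t)) 0 T g2), Ropp_0; reflexivity.
Qed.

Lemma ccts_real (F : C -> C) : (forall z, ccont F z) -> ccts (fun x => F (RtoC x)).
Proof. intros H; apply ccts_comp; [assumption | apply ccts_RtoC, cts_id]. Qed.

Lemma fourier_vanishes (G : C -> C) (M tau b B : R) : (forall z, cdiff G z) ->
  (forall z, Cmod (G z) <= M * exp (tau * Cmod z))%R -> (0 <= tau < b)%R ->
  (forall T, 0 <= T -> RInt (fun x => Cmod (G (RtoC x))) (- T) T <= B)%R ->
  forall e, (0 < e)%R -> exists R0, (0 < R0)%R /\ forall R, (R0 <= R)%R ->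
    (Cmod (CI (fun x => osc G b (RtoC x)) (- R) R) <= e)%R.
Proof.
  intros HG HM Ht HB e He.
  assert (cG : forall z, ccont G z) by (intros; apply cdiff_ccont, HG).
  assert (cO : forall z, ccont (osc G b) z) by (intros; apply cdiff_ccont, cdiff_osc, HG).
  assert (cg : cts (fun x => Cmod (G (RtoC x)))) by (apply cts_Cmod, ccts_real, cG).
  destruct (rotation G M tau b 1 B HG HM Ht (or_introl eq_refl)) with (e := (e / 2)%R) as [R1 [p1 H1]]; [|lra|].
  { intros T HT; eapply Rle_trans; [|apply (HB T HT)].
    rewrite (RInt_R_ext _ (fun x => Cmod (G (RtoC x)))) by (intros; rewrite Rmult_1_l; reflexivity).
    apply RInt_monotone_bounds; [assumption | intros; apply Cmod_ge_0 | lra | lra]. }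
  destruct (rotation G M tau b (-1) B HG HM Ht (or_intror eq_refl)) with (e := (e / 2)%R) as [R2 [p2 H2]]; [|lra|].
  { intros T HT; eapply Rle_trans; [|apply (HB T HT)].
    rewrite (RInt_R_ext _ (fun x => (fun y => Cmod (G (RtoC y))) (- x)%R))
      by (intros; cbv beta; do 3 f_equal; ring).
    rewrite (RInt_c_reflect (fun y => Cmod (G (RtoC y)))) by assumption.
    apply RInt_monotone_bounds; [assumption | intros; apply Cmod_ge_0 | lra | lra]. }
  exists (R1 + R2)%R; split; [lra|]; intros R HR.
  specialize (H1 R ltac:(lra)); specialize (H2 R ltac:(lra)).
  assert (co := ccts_real _ cO).
  rewrite (seg_ray (osc G b) (RtoC 1)) in H1 by assumption.
  rewrite (seg_ray (osc G b) (RtoC (-1))) in H2 by assumption.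
  rewrite (CI_ext _ (fun t => osc G b (RtoC t))) in H1 by (intros; rewrite <- RtoC_mult, Rmult_1_r; reflexivity).
  rewrite (CI_ext _ (fun t => osc G b (RtoC (- t)))) in H2
    by (intros; rewrite <- RtoC_mult; do 2 f_equal; ring).
  rewrite (CI_reflect (fun t => osc G b (RtoC t))) in H2 by assumption.
  rewrite (CI_Chasles _ (- R) 0 R co).
  set (X := CI (fun t => osc G b (RtoC t)) 0 R) in *; set (Y := CI (fun t => osc G b (RtoC t)) (- R) 0) in *.
  set (Z := seg (osc G b) 0 (RtoC R * - Ci)) in *.
  replace (Y + X) with ((RtoC 1 * X - Z) + - (RtoC (-1) * Y - Z)) by (rewrite RtoC_m1; ring).
  eapply Rle_trans; [apply Cmod_triangle|]; rewrite Cmod_opp; lra.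
Qed.

(** Reflecting [z] to [- z] exchanges the frequencies [b] and [- b]. Sums and differences of the two
    vanishing integrals isolate cosine and sine, for the real and the imaginary part of [G]. *)
Lemma fourier_vanishes_real (G : C -> C) (M tau b B : R) : (forall z, cdiff G z) ->
  (forall z, Cmod (G z) <= M * exp (tau * Cmod z))%R -> (0 <= tau < b)%R ->
  (forall T, 0 <= T -> RInt (fun x => Cmod (G (RtoC x))) (- T) T <= B)%R ->
  (is_int (fun x => Re (G (RtoC x)) * cos (b * x))%R 0 /\ is_int (fun x => Re (G (RtoC x)) * sin (b * x))%R 0) /\
  (is_int (fun x => Im (G (RtoC x)) * cos (b * x))%R 0 /\ is_int (fun x => Im (G (RtoC x)) * sin (b * x))%R 0).
Proof.
  intros HG HM Ht HB.
  assert (cG : forall z, ccont G z) by (intros; apply cdiff_ccont, HG).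
  assert (cg : cts (fun x => Cmod (G (RtoC x)))) by (apply cts_Cmod, ccts_real, cG).
  set (G' := fun z => G (- z)).
  assert (HG' : forall z, cdiff G' z).
  { intros z; apply (cdiff_comp G (fun w => - w)); [apply HG|].
    destruct (cdiff_mult (fun _ => RtoC (-1)) (fun w => w) z (cdiff_const _ z) (cdiff_id z)) as [l Hl].
    exists l; intros e He; destruct (Hl e He) as [d [pd Hd]]; exists d; split; [assumption|].
    intros w Hw; specialize (Hd w Hw); rewrite RtoC_m1 in Hd.
    replace (- w - - z) with (- RtoC 1 * w - - RtoC 1 * z) by ring; exact Hd. }
  assert (HM' : forall z, (Cmod (G' z) <= M * exp (tau * Cmod z))%R).
  { intros z; unfold G'; rewrite <- (Cmod_opp z); apply HM. }
  assert (HB' : forall T, (0 <= T -> RInt (fun x => Cmod (G' (RtoC x))) (- T) T <= B)%R).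
  { intros T HT; rewrite (RInt_R_ext _ (fun x => (fun y => Cmod (G (RtoC y))) (- x)%R)).
    - rewrite (RInt_c_reflect (fun y => Cmod (G (RtoC y)))) by assumption; rewrite Ropp_involutive; apply HB, HT.
    - intros x; unfold G'; rewrite RtoC_opp; reflexivity. }
  assert (V1 := fourier_vanishes G M tau b B HG HM Ht HB).
  assert (V2 := fourier_vanishes G' M tau b B HG' HM' Ht HB').
  destruct (ccts_real G cG) as [cR cI].
  set (U := fun x => Re (G (RtoC x))) in *; set (V := fun x => Im (G (RtoC x))) in *.
  assert (I1 : forall R, CI (fun x => osc G b (RtoC x)) (- R) R =
    ((RInt (fun x => U x * cos (b * x)) (- R) R + RInt (fun x => V x * sin (b * x)) (- R) R)%R,
     (RInt (fun x => V x * cos (b * x)) (- R) R - RInt (fun x => U x * sin (b * x)) (- R) R)%R)).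
  { intros R; unfold CI; rewrite <- RInt_c_plus, <- RInt_c_minus by cts_tac; f_equal;
    apply RInt_R_ext; intros x; unfold osc, cexp, U, V, Re, Im; simpl;
    replace (((- (0) * b - - (1) * 0) * x - (- (0) * 0 + - (1) * b) * 0))%R with 0%R by ring;
    replace (((- (0) * b - - (1) * 0) * 0 + (- (0) * 0 + - (1) * b) * x))%R with (- (b * x))%R by ring;
    rewrite exp_0, cos_neg, sin_neg; ring. }
  assert (I2 : forall R, CI (fun x => osc G' b (RtoC x)) (- R) R =
    ((RInt (fun x => U x * cos (b * x)) (- R) R - RInt (fun x => V x * sin (b * x)) (- R) R)%R,
     (RInt (fun x => V x * cos (b * x)) (- R) R + RInt (fun x => U x * sin (b * x)) (- R) R)%R)).
  { intros R; unfold CI; rewrite <- RInt_c_plus, <- RInt_c_minus by cts_tac; f_equal.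
    - rewrite (RInt_R_ext (fun t => Re (osc G' b (RtoC t))) (fun x => (fun y => U y * cos (b * y) - V y * sin (b * y))%R (- x)%R)).
      { rewrite (RInt_c_reflect (fun y => U y * cos (b * y) - V y * sin (b * y))%R) by cts_tac; rewrite Ropp_involutive; reflexivity. }
      intros x; unfold osc, cexp, U, V, G', Re, Im; rewrite RtoC_opp; simpl;
      replace (((- (0) * b - - (1) * 0) * x - (- (0) * 0 + - (1) * b) * 0))%R with 0%R by ring;
      replace (((- (0) * b - - (1) * 0) * 0 + (- (0) * 0 + - (1) * b) * x))%R with (b * - x)%R by ring.
      rewrite exp_0; ring.
    - rewrite (RInt_R_ext (fun t => Im (osc G' b (RtoC t))) (fun x => (fun y => V y * cos (b * y) + U y * sin (b * y))%R (- x)%R)).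
      { rewrite (RInt_c_reflect (fun y => V y * cos (b * y) + U y * sin (b * y))%R) by cts_tac; rewrite Ropp_involutive; reflexivity. }
      intros x; unfold osc, cexp, U, V, G', Re, Im; rewrite RtoC_opp; simpl;
      replace (((- (0) * b - - (1) * 0) * x - (- (0) * 0 + - (1) * b) * 0))%R with 0%R by ring;
      replace (((- (0) * b - - (1) * 0) * 0 + (- (0) * 0 + - (1) * b) * x))%R with (b * - x)%R by ring.
      rewrite exp_0; ring. }
  assert (all : forall e, (0 < e)%R -> exists T0, (0 <= T0)%R /\ forall T, (T0 <= T)%R ->
    (Rabs (RInt (fun x => U x * cos (b * x)) (- T) T - 0) <= e /\ Rabs (RInt (fun x => U x * sin (b * x)) (- T) T - 0) <= e /\
     Rabs (RInt (fun x => V x * cos (b * x)) (- T) T - 0) <= e /\ Rabs (RInt (fun x => V x * sin (b * x)) (- T) T - 0) <= e)%R).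
  { intros e He; destruct (V1 e He) as [R1 [p1 H1]]; destruct (V2 e He) as [R2 [p2 H2]].
    exists (R1 + R2)%R; split; [lra|]; intros T HT.
    specialize (H1 T ltac:(lra)); specialize (H2 T ltac:(lra)); rewrite I1 in H1; rewrite I2 in H2.
    assert (A1 := Rle_trans _ _ _ (Re_le_Cmod _) H1); assert (A2 := Rle_trans _ _ _ (Im_le_Cmod _) H1).
    assert (A3 := Rle_trans _ _ _ (Re_le_Cmod _) H2); assert (A4 := Rle_trans _ _ _ (Im_le_Cmod _) H2).
    unfold Re, Im in A1, A2, A3, A4; simpl in A1, A2, A3, A4.
    apply Rabs_le_between in A1; apply Rabs_le_between in A2; apply Rabs_le_between in A3; apply Rabs_le_between in A4.
    repeat split; apply Rabs_le_between; lra. }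
  split; split; intros e He; destruct (all e He) as [T0 [p0 H0]]; exists T0; (split; [exact p0|]);
    intros T HT; destruct (H0 T HT) as [A1 [A2 [A3 A4]]];
    [exact A1 | exact A2 | exact A3 | exact A4].
Qed.

Close Scope C_scope.

(** * A function of exponential type is determined by its restriction to the real line *)

(** The values at [s] and [t] differ by the factor [exp ((s - t) / y)], and the strict inequality
    [1 + x < exp x] compares them without derivatives. *)
Lemma peak_increasing (y s t : R) : 0 < y -> 0 <= s < t -> t <= y ->
  s * exp (- (s / y)) < t * exp (- (t / y)).
Proof.
  intros Hy Hs Ht.
  assert (E : exp (- (t / y)) = exp (- (s / y)) * exp ((s - t) / y))
    by (rewrite <- exp_plus; f_equal; field; lra).
  assert (p := exp_pos (- (s / y))).
  rewrite E.
  assert (H : 1 + (s - t) / y < exp ((s - t) / y)).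
  { apply exp_ineq1; apply Rmult_integral_contrapositive; split; [lra | apply Rinv_neq_0_compat; lra]. }
  assert (H2 : s <= t * (1 + (s - t) / y)).
  { assert ((t - s) / y * t <= t - s); [|lra].
    unfold Rdiv; rewrite Rmult_assoc, <- (Rmult_1_r (t - s)) at 1.
    assert (/ y * t <= 1) by (rewrite Rmult_comm; apply (Rle_div_l t 1 y); lra). nra. }
  replace (t * (exp (- (s / y)) * exp ((s - t) / y))) with (t * exp ((s - t) / y) * exp (- (s / y))) by ring.
  apply Rmult_lt_compat_r; [assumption|].
  apply Rle_lt_trans with (t * (1 + (s - t) / y)); [assumption | apply Rmult_lt_compat_l; lra].
Qed.

Lemma peak_decreasing (y s t : R) : 0 < y -> y <= s < t ->
  t * exp (- (t / y)) < s * exp (- (s / y)).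
Proof.
  intros Hy Hs.
  assert (E : exp (- (s / y)) = exp (- (t / y)) * exp ((t - s) / y))
    by (rewrite <- exp_plus; f_equal; field; lra).
  assert (p := exp_pos (- (t / y))).
  rewrite E.
  assert (H : 1 + (t - s) / y < exp ((t - s) / y)).
  { apply exp_ineq1; apply Rmult_integral_contrapositive; split; [lra | apply Rinv_neq_0_compat; lra]. }
  assert (H2 : t <= s * (1 + (t - s) / y)).
  { assert (t - s <= (t - s) / y * s); [|lra].
    apply Rle_trans with ((t - s) * 1); [lra|]; unfold Rdiv; rewrite Rmult_assoc.
    apply Rmult_le_compat_l; [lra|].
    rewrite Rmult_comm; apply (Rle_div_r 1 s y); lra. }
  replace (s * (exp (- (t / y)) * exp ((t - s) / y))) with (s * exp ((t - s) / y) * exp (- (t / y))) by ring.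
  apply Rmult_lt_compat_r; [assumption|].
  apply Rle_lt_trans with (s * (1 + (t - s) / y)); [assumption | apply Rmult_lt_compat_l; lra].
Qed.

(* Laplace's method: [t^n e^(-n t / y)] concentrates at [t = y]. *)
Lemma peak_nonpos (phi : R -> R) (M tau y : R) (n0 : nat) : cts phi -> 0 < y -> 0 <= M -> 0 <= tau ->
  (forall t, 0 <= t -> Rabs (phi t) <= M * exp (tau * t)) ->
  (forall n, (n0 <= n)%nat -> forall e, 0 < e -> exists R0, forall R, R0 <= R ->
    Rabs (RInt (fun t => phi t * (t * exp (- (t / y))) ^ n) 0 R) <= e) ->
  phi y <= 0.
Proof.
  intros cphi Hy HM Htau Hb Hlim; apply Rnot_lt_le; intros Hpos.
  set (k := fun t => t * exp (- (t / y))).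
  assert (ck : cts k) by (unfold k; cts_tac).
  assert (kpos : forall t, 0 <= t -> 0 <= k t) by (intros t Ht; apply Rmult_le_pos; [assumption | left; apply exp_pos]).
  set (h := phi y / 2).
  destruct (cts_pt phi cphi y h) as [d0 [pd0 Hd0]]; [unfold h; lra|].
  simpl in Hd0; unfold R_dist in Hd0.
  set (d := Rmin (y / 2) (d0 / 2)).
  assert (Hd : 0 < d) by (apply Rmin_pos; lra).
  assert (Hdy : d <= y / 2) by apply Rmin_l.
  assert (Hdd : d < d0) by (apply Rle_lt_trans with (d0 / 2); [apply Rmin_r | lra]).
  assert (phih : forall t, y - d <= t <= y + d -> h <= phi t).
  { intros t Ht; destruct (Req_dec t y) as [-> | Hne]; [unfold h; lra|].
    assert (Hty : Rabs (t - y) < d0) by (apply Rabs_lt_between; lra).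
    specialize (Hd0 t (conj (conj Logic.I (not_eq_sym Hne)) Hty)).
    apply Rabs_lt_between in Hd0; unfold h in *; lra. }
  set (k2 := Rmax (k (y - d)) (k (y + d))).
  assert (k2p : 0 < k2).
  { apply Rlt_le_trans with (k (y - d)); [|apply Rmax_l].
    apply Rmult_lt_0_compat; [lra | apply exp_pos]. }
  assert (k20 : k2 < k y).
  { apply Rmax_lub_lt; [apply peak_increasing; lra | apply peak_decreasing; lra]. }
  assert (kl : forall t, 0 <= t <= y - d -> k t <= k2).
  { intros t [Ht [Ht2 | ->]]; [|apply Rmax_l].
    eapply Rle_trans; [left; apply (peak_increasing y t (y - d)); lra | apply Rmax_l]. }
  assert (kr : forall t, y + d <= t -> k t <= k2).
  { intros t [Ht2 | <-]; [|apply Rmax_r].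
    eapply Rle_trans; [left; apply (peak_decreasing y (y + d) t); lra | apply Rmax_r]. }
  (* [k2] bounds the kernel outside the window where [phi >= h]; [k1] lies halfway to the peak and
     is exceeded on a smaller window. *)
  set (k1 := (k y + k2) / 2).
  destruct (cts_pt k ck y (k y - k1)) as [d1 [pd1 Hd1]]; [unfold k1; lra|].
  simpl in Hd1; unfold R_dist in Hd1.
  set (d' := Rmin d (d1 / 2)).
  assert (Hd' : 0 < d') by (apply Rmin_pos; lra).
  assert (Hd'd : d' <= d) by apply Rmin_l.
  assert (Hd'1 : d' < d1) by (apply Rle_lt_trans with (d1 / 2); [apply Rmin_r | lra]).
  assert (kk1 : forall t, y - d' <= t <= y + d' -> k1 <= k t).
  { intros t Ht; destruct (Req_dec t y) as [-> | Hne]; [unfold k1; lra|].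
    assert (Hty : Rabs (t - y) < d1) by (apply Rabs_lt_between; lra).
    specialize (Hd1 t (conj (conj Logic.I (not_eq_sym Hne)) Hty)).
    apply Rabs_lt_between in Hd1; lra. }
  (* A fixed power [n1] of the kernel is spent on the growth of [phi] and leaves the integrable
     [exp (- t)]; the remaining power [n] does the concentrating. *)
  assert (Hn1 : exists n1 : nat, tau + 1 <= INR n1 / (2 * y)).
  { destruct (INR_unbounded ((tau + 1) * (2 * y))) as [n1 H1]; exists n1.
    apply Rle_div_r; lra. }
  destruct Hn1 as [n1 Hn1].
  set (Cc := M * (2 * y) ^ n1).
  assert (HCc : 0 <= Cc) by (apply Rmult_le_pos; [assumption | apply pow_le; lra]).
  assert (dom : forall t, 0 <= t -> Rabs (phi t) * k t ^ n1 <= Cc * exp (- t)).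
  { intros t Ht.
    assert (K1 : k t <= 2 * y * exp (- (t / (2 * y)))).
    { unfold k; assert (X := exp_ineq1_le (t / (2 * y))).
      replace (- (t / y)) with (- (t / (2 * y)) + - (t / (2 * y))) by (field; lra).
      rewrite exp_plus.
      assert (p := exp_pos (- (t / (2 * y)))).
      assert (E : exp (t / (2 * y)) * exp (- (t / (2 * y))) = 1)
        by (rewrite <- exp_plus, Rplus_opp_r; apply exp_0).
      set (q := exp (- (t / (2 * y)))) in *.
      assert (t <= 2 * y * exp (t / (2 * y))).
      { apply Rle_trans with (2 * y * (t / (2 * y))); [right; field; lra|].
        apply Rmult_le_compat_l; lra. }
      assert (t * q <= 2 * y * exp (t / (2 * y)) * q) by (apply Rmult_le_compat_r; lra).
      assert (t * q <= 2 * y) by (rewrite Rmult_assoc, E in *; lra).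
      replace (t * (q * q)) with (t * q * q) by ring; apply Rmult_le_compat_r; lra. }
    apply Rle_trans with (M * exp (tau * t) * (2 * y * exp (- (t / (2 * y)))) ^ n1).
    - apply Rmult_le_compat; [apply Rabs_pos | apply pow_le, kpos, Ht | apply Hb, Ht |].
      apply pow_incr; split; [apply kpos, Ht | assumption].
    - rewrite Rpow_mult_distr; unfold Cc.
      assert (En : exp (- (t / (2 * y))) ^ n1 = exp (- (INR n1 / (2 * y) * t))).
      { rewrite <- (Rpower_pow n1) by apply exp_pos; unfold Rpower; rewrite ln_exp; f_equal; field; lra. }
      rewrite En.
      replace (M * exp (tau * t) * ((2 * y) ^ n1 * exp (- (INR n1 / (2 * y) * t))))
        with (M * (2 * y) ^ n1 * (exp (tau * t) * exp (- (INR n1 / (2 * y) * t)))) by ring.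
      rewrite <- exp_plus; apply Rmult_le_compat_l; [assumption|]; apply exp_le_mono.
      assert ((tau + 1) * t <= INR n1 / (2 * y) * t) by (apply Rmult_le_compat_r; lra). lra. }
  assert (outer : forall a b n, 0 <= a <= b -> (forall t, a <= t <= b -> k t <= k2) ->
    Rabs (RInt (fun t => phi t * k t ^ (n + n1)) a b) <= k2 ^ n * Cc).
  { intros a b n Hab Hk.
    apply Rle_trans with (RInt (fun t => k2 ^ n * (Cc * exp (- t))) a b).
    - apply RInt_c_abs_le; [cts_tac | cts_tac | lra |]; intros t Ht.
      rewrite pow_add, Rabs_mult, (Rabs_pos_eq (k t ^ n * k t ^ n1))
        by (apply Rmult_le_pos; apply pow_le, kpos; lra).
      replace (Rabs (phi t) * (k t ^ n * k t ^ n1)) with (k t ^ n * (Rabs (phi t) * k t ^ n1)) by ring.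
      apply Rmult_le_compat; [apply pow_le, kpos; lra | | |].
      + apply Rmult_le_pos; [apply Rabs_pos | apply pow_le, kpos; lra].
      + apply pow_incr; split; [apply kpos; lra | apply Hk, Ht].
      + apply dom; lra.
    - rewrite !RInt_c_scal by cts_tac.
      rewrite (RInt_of_derive (fun t => - exp (- t))); [| intros x; auto_derive; [trivial | ring] | cts_tac].
      assert (0 < k2 ^ n) by (apply pow_lt; assumption).
      assert (exp (- a) <= 1) by (rewrite <- exp_0; apply exp_le_mono; lra).
      assert (0 < exp (- b)) by apply exp_pos.
      apply Rmult_le_compat_l; [lra|].
      rewrite <- (Rmult_1_r Cc) at 2; apply Rmult_le_compat_l; [assumption|]; simpl; lra. }
  assert (k1p : k2 < k1) by (unfold k1; lra).
  assert (hp : 0 < h) by (unfold h; lra).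
  (* The window contributes at least a multiple of [k1 ^ n], the rest at most a multiple of
     [k2 ^ n]. As [k2 < k1], large [n] is contradictory. *)
  assert (key : forall n, (n0 <= n)%nat -> 2 * d' * (h * k1 ^ (n + n1)) <= 2 * (k2 ^ n * Cc)).
  { intros n Hn; apply Rle_eps; intros e He.
    destruct (Hlim (n + n1)%nat ltac:(lia) e He) as [R0 HR0].
    set (R := Rmax R0 (y + d)).
    specialize (HR0 R (Rmax_l _ _)); fold k in HR0.
    assert (HR : y + d <= R) by apply Rmax_r.
    change (fun t => phi t * (t * exp (- (t / y))) ^ (n + n1)) with (fun t => phi t * k t ^ (n + n1)) in HR0.
    assert (cc : cts (fun t => phi t * k t ^ (n + n1))) by cts_tac.
    rewrite (RInt_c_Chasles _ 0 (y - d) R cc), (RInt_c_Chasles _ (y - d) (y + d) R cc) in HR0.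
    assert (O1 := outer 0 (y - d) n ltac:(lra) ltac:(intros; apply kl; lra)).
    assert (O2 := outer (y + d) R n ltac:(lra) ltac:(intros; apply kr; lra)).
    assert (Mid : 2 * d' * (h * k1 ^ (n + n1)) <= RInt (fun t => phi t * k t ^ (n + n1)) (y - d) (y + d)).
    { rewrite (RInt_c_Chasles _ (y - d) (y - d') (y + d) cc), (RInt_c_Chasles _ (y - d') (y + d') (y + d) cc).
      assert (P : forall a b, y - d <= a -> a <= b -> b <= y + d -> 0 <= RInt (fun t => phi t * k t ^ (n + n1)) a b).
      { intros a b H1 H2 H3; apply RInt_c_pos; [assumption | assumption |]; intros t Ht.
        apply Rmult_le_pos; [|apply pow_le, kpos; lra].
        specialize (phih t ltac:(lra)); lra. }
      assert (P1 := P (y - d) (y - d') ltac:(lra) ltac:(lra) ltac:(lra)).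
      assert (P2 := P (y + d') (y + d) ltac:(lra) ltac:(lra) ltac:(lra)).
      assert (P3 : RInt (fun _ => h * k1 ^ (n + n1)) (y - d') (y + d') <= RInt (fun t => phi t * k t ^ (n + n1)) (y - d') (y + d')).
      { apply RInt_c_le; [cts_tac | assumption | lra |]; intros t Ht.
        apply Rmult_le_compat; [lra | apply pow_le; lra | apply phih; lra |].
        apply pow_incr; split; [lra | apply kk1, Ht]. }
      rewrite RInt_R_const in P3; simpl in *; lra. }
    apply Rabs_le_between in O1; apply Rabs_le_between in O2; apply Rabs_le_between in HR0; simpl in *; lra. }
  set (q := k1 / k2).
  assert (Hq : 1 < q) by (apply Rlt_div_r; lra).
  set (Kc := 2 * d' * (h * k1 ^ n1)).
  assert (HKc : 0 < Kc).
  { unfold Kc; apply Rmult_lt_0_compat; [lra|]; apply Rmult_lt_0_compat; [assumption | apply pow_lt; lra]. }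
  destruct (Pow_x_infinity q ltac:(rewrite Rabs_pos_eq; lra) (2 * Cc / Kc + 1)) as [N HN].
  specialize (HN (N + n0)%nat ltac:(lia)).
  rewrite Rabs_pos_eq in HN by (apply pow_le; lra).
  specialize (key (N + n0)%nat ltac:(lia)).
  set (n := (N + n0)%nat) in *.
  assert (p2 : 0 < k2 ^ n) by (apply pow_lt; assumption).
  assert (Eq : k1 ^ n = q ^ n * k2 ^ n) by (rewrite <- Rpow_mult_distr; f_equal; unfold q; field; lra).
  rewrite pow_add, Eq in key.
  assert (key2 : Kc * q ^ n <= 2 * Cc).
  { apply Rmult_le_reg_r with (k2 ^ n); [assumption|]; unfold Kc; lra. }
  assert (Kc * (2 * Cc / Kc + 1) <= Kc * q ^ n) by (apply Rmult_le_compat_l; lra).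
  replace (Kc * (2 * Cc / Kc + 1)) with (2 * Cc + Kc) in * by (field; lra).
  lra.
Qed.

Open Scope C_scope.

Lemma cdiff_pow (F : C -> C) (n : nat) (z : C) : cdiff F z -> cdiff (fun w => F w ^ n) z.
Proof.
  intros H; induction n as [|n IH]; simpl; [apply cdiff_const | apply cdiff_mult; assumption].
Qed.

Lemma Cmod_Ci : Cmod Ci = 1%R.
Proof. transitivity (sqrt 1); [unfold Cmod, Ci; simpl; f_equal; ring | apply sqrt_1]. Qed.

(** Multiplied by a power of [z], the translate of [F] still vanishes on the real half-line, so
    [rotation] makes its weighted integrals down the vertical half-line from [x] tend to zero. With
    power [n] and frequency [n / y] the weight is the [n]-th power of a kernel peaked at depth [y],
    and [peak_nonpos] singles out that point. *)
Lemma zero_on_R_lower (F : C -> C) (M tau : R) : (forall z, cdiff F z) -> (0 <= tau)%R ->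
  (forall z, Cmod (F z) <= M * exp (tau * Cmod z))%R -> (forall x : R, F (RtoC x) = 0) ->
  forall x y : R, (0 < y)%R -> F (x, (- y)%R) = 0.
Proof.
  intros HF Htau HM H0 x y Hy.
  assert (cF : forall z, ccont F z) by (intros; apply cdiff_ccont, HF).
  assert (pM : (0 <= M)%R).
  { specialize (HM 0); rewrite Cmod_0, Rmult_0_r, exp_0, Rmult_1_r in HM.
    eapply Rle_trans; [apply Cmod_ge_0 | exact HM]. }
  set (ph := fun t => F (RtoC x + RtoC t * - Ci)).
  assert (cph : ccts ph).
  { apply ccts_comp; [assumption|]; apply ccts_plus; [apply ccts_const|].
    apply ccts_mult; [apply ccts_RtoC, cts_id | apply ccts_const]. }
  set (M' := (M * exp (tau * Rabs x))%R).
  assert (pM' : (0 <= M')%R) by (apply Rmult_le_pos; [assumption | left; apply exp_pos]).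
  assert (FM : forall w : C, (Cmod (F (RtoC x + w)%C) <= M' * exp (tau * Cmod w))%R).
  { intros w; eapply Rle_trans; [apply HM|]; unfold M'; rewrite Rmult_assoc, <- exp_plus.
    apply Rmult_le_compat_l; [assumption|]; apply exp_le_mono; rewrite <- Rmult_plus_distr_l.
    apply Rmult_le_compat_l; [assumption|]; eapply Rle_trans; [apply Cmod_triangle|].
    rewrite Cmod_R; lra. }
  assert (phb : forall t, (0 <= t)%R -> (Cmod (ph t) <= M' * exp (tau * t))%R).
  { intros t Ht; eapply Rle_trans; [apply FM|]; rewrite Cmod_mult, Cmod_R, Cmod_opp, Rabs_pos_eq by assumption.
    rewrite Cmod_Ci, Rmult_1_r; lra. }
  (* For such [n] the new type [tau + n / (2 * y)] lies below the frequency [n / y]. *)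
  destruct (INR_unbounded (2 * tau * y + 1)) as [n0 Hn0].
  assert (lim : forall n, (n0 <= n)%nat -> forall e, (0 < e)%R -> exists R0, forall R, (R0 <= R)%R ->
    (Cmod (CI (fun t => ph t * RtoC ((t * exp (- (t / y))) ^ n))%C 0 R) <= e)%R).
  { intros n Hn e He.
    assert (HnR : (INR n0 <= INR n)%R) by (apply le_INR; assumption).
    (* The factor [Ci] makes the power real on the half-line: at [z = - Ci * t] it is [t ^ n]. *)
    set (G := fun z => F (RtoC x + z) * (Ci * z) ^ n).
    set (b := (INR n / y)%R); set (tau' := (tau + INR n / (2 * y))%R).
    assert (Hb : (0 <= tau' < b)%R).
    { unfold tau', b; split.
      - assert (0 <= INR n / (2 * y))%R by (apply Rle_mult_inv_pos; [apply pos_INR | lra]); lra.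
      - replace (INR n / y)%R with (INR n / (2 * y) + INR n / (2 * y))%R by (field; lra).
        assert (tau < INR n / (2 * y))%R by (apply Rlt_div_r; lra). lra. }
    assert (HG : forall z, cdiff G z).
    { intros z; apply cdiff_mult.
      - apply (cdiff_comp F (fun w => RtoC x + w)); [apply HF | apply cdiff_plus; [apply cdiff_const | apply cdiff_id]].
      - apply cdiff_pow, cdiff_mult; [apply cdiff_const | apply cdiff_id]. }
    assert (CCi := Cmod_Ci).
    assert (HGM : forall z, (Cmod (G z) <= M' * (2 * y) ^ n * exp (tau' * Cmod z))%R).
    { intros z; unfold G; rewrite Cmod_mult, Cmod_pow, Cmod_mult, CCi, Rmult_1_l.
      assert (z0 := Cmod_ge_0 z); set (r := Cmod z) in *.
      assert (X := exp_ineq1_le (r / (2 * y))).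
      assert (Hr : (r <= 2 * y * exp (r / (2 * y)))%R).
      { apply Rle_trans with (2 * y * (r / (2 * y)))%R; [right; field; lra|]; apply Rmult_le_compat_l; lra. }
      apply Rle_trans with (M' * exp (tau * r) * (2 * y * exp (r / (2 * y))) ^ n)%R.
      - apply Rmult_le_compat; [apply Cmod_ge_0 | apply pow_le; assumption | apply FM |].
        apply pow_incr; lra.
      - rewrite Rpow_mult_distr.
        assert (En : (exp (r / (2 * y)) ^ n = exp (INR n / (2 * y) * r))%R).
        { rewrite <- (Rpower_pow n) by apply exp_pos; unfold Rpower; rewrite ln_exp; f_equal; field; lra. }
        rewrite En; unfold tau'; rewrite Rmult_plus_distr_r, exp_plus; right; ring. }
    assert (G0 : forall t : R, G (RtoC t) = 0).
    { intros t; unfold G; rewrite <- RtoC_plus, H0; ring. }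
    assert (Hrot := rotation G _ tau' b 1 0 HG HGM Hb (or_introl eq_refl)).
    assert (Hz : forall T, (0 <= T)%R -> (RInt (fun t => Cmod (G (RtoC (1 * t)))) 0 T <= 0)%R).
    { intros T HT; rewrite (RInt_R_ext _ (fun _ => 0%R)) by (intros; rewrite G0; apply Cmod_0).
      rewrite RInt_R_const; lra. }
    destruct (Hrot Hz e He) as [R0 [pR0 HR0]].
    exists R0; intros R HR; specialize (HR0 R HR).
    assert (cO : forall z, ccont (osc G b) z) by (intros; apply cdiff_ccont, cdiff_osc, HG).
    rewrite !seg_ray in HR0 by assumption.
    rewrite (CI_ext (fun t => osc G b (RtoC t * RtoC 1)) (fun _ => 0)) in HR0.
    2:{ intros t; unfold osc; rewrite <- RtoC_mult, G0; ring. }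
    rewrite CI_const in HR0.
    rewrite (CI_ext (fun t => osc G b (RtoC t * - Ci)) (fun t => ph t * RtoC ((t * exp (- (t / y))) ^ n))) in HR0.
    2:{ intros t; unfold osc, G; fold (ph t); rewrite <- Cmult_assoc; f_equal.
        replace (Ci * (RtoC t * - Ci)) with (RtoC t) by (unfold Ci, RtoC, Cmult, Copp; simpl; f_equal; ring).
        replace (cexp (- Ci * RtoC b * (RtoC t * - Ci))) with (RtoC (exp (- (t / y)) ^ n)).
        - rewrite Rpow_mult_distr, RtoC_mult, !RtoC_pow; reflexivity.
        - replace (- Ci * RtoC b * (RtoC t * - Ci)) with (RtoC (- (b * t)))
            by (unfold Ci, RtoC, Cmult, Copp; simpl; f_equal; ring).
          unfold cexp; simpl; rewrite cos_0, sin_0, Rmult_1_r, Rmult_0_r; unfold RtoC; f_equal.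
          rewrite <- (Rpower_pow n) by apply exp_pos; unfold Rpower; rewrite ln_exp; f_equal; unfold b; field; lra. }
    set (X := CI (fun t => ph t * RtoC ((t * exp (- (t / y))) ^ n))%C 0 R) in *.
    replace (RtoC 1 * (RtoC (R - 0) * 0) - - Ci * X) with (Ci * X) in HR0 by ring.
    rewrite Cmod_mult, CCi, Rmult_1_l in HR0; exact HR0. }
  destruct cph as [cp1 cp2].
  (* [peak_nonpos] is one-sided; it is applied to both signs of the real and of the imaginary
     part. *)
  assert (gen : forall (psi : R -> R), cts psi -> (forall t, Rabs (psi t) <= Cmod (ph t))%R ->
    (forall n R, (Rabs (RInt (fun t => psi t * (t * exp (- (t / y))) ^ n) 0 R)
      <= Cmod (CI (fun t => ph t * RtoC ((t * exp (- (t / y))) ^ n))%C 0 R))%R) -> (psi y <= 0)%R).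
  { intros psi cpsi Hpsi Hint; apply (peak_nonpos psi M' tau y n0); auto.
    - intros t Ht; eapply Rle_trans; [apply Hpsi | apply phb, Ht].
    - intros n Hn e He; destruct (lim n Hn e He) as [R0 HR0]; exists R0; intros R HR.
      eapply Rle_trans; [apply Hint | apply HR0, HR]. }
  assert (EQ1 : forall n R, RInt (fun t => Re (ph t) * (t * exp (- (t / y))) ^ n)%R 0 R
     = Re (CI (fun t => ph t * RtoC ((t * exp (- (t / y))) ^ n))%C 0 R)).
  { intros n R; unfold CI; simpl; apply RInt_R_ext; intros t; unfold Re; simpl; ring. }
  assert (EQ2 : forall n R, RInt (fun t => Im (ph t) * (t * exp (- (t / y))) ^ n)%R 0 R
     = Im (CI (fun t => ph t * RtoC ((t * exp (- (t / y))) ^ n))%C 0 R)).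
  { intros n R; unfold CI; simpl; apply RInt_R_ext; intros t; unfold Im; simpl; ring. }
  assert (neg : forall (psi : R -> R) n R, cts psi -> RInt (fun t => - psi t * (t * exp (- (t / y))) ^ n)%R 0 R
     = (- RInt (fun t => psi t * (t * exp (- (t / y))) ^ n)%R 0 R)%R).
  { intros psi n R cpsi; rewrite <- RInt_c_opp by cts_tac; apply RInt_R_ext; intros; ring. }
  assert (A1 : (Re (ph y) <= 0)%R).
  { apply (gen (fun t => Re (ph t))); [assumption | intros; apply Re_le_Cmod |].
    intros n R; rewrite EQ1; apply Re_le_Cmod. }
  assert (A2 : (- Re (ph y) <= 0)%R).
  { apply (gen (fun t => - Re (ph t))%R); [cts_tac | intros; rewrite Rabs_Ropp; apply Re_le_Cmod |].
    intros n R; rewrite neg, EQ1, Rabs_Ropp by assumption; apply Re_le_Cmod. }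
  assert (A3 : (Im (ph y) <= 0)%R).
  { apply (gen (fun t => Im (ph t))); [assumption | intros; apply Im_le_Cmod |].
    intros n R; rewrite EQ2; apply Im_le_Cmod. }
  assert (A4 : (- Im (ph y) <= 0)%R).
  { apply (gen (fun t => - Im (ph t))%R); [cts_tac | intros; rewrite Rabs_Ropp; apply Im_le_Cmod |].
    intros n R; rewrite neg, EQ2, Rabs_Ropp by assumption; apply Im_le_Cmod. }
  replace (F (x, (- y)%R)) with (ph y).
  - rewrite (surjective_pairing (ph y)); unfold RtoC; unfold Re, Im in *; f_equal; lra.
  - unfold ph; f_equal; unfold RtoC, Ci, Cplus, Cmult, Copp; simpl; f_equal; ring.
Qed.

Theorem zero_on_R (F : C -> C) (M tau : R) : (forall z, cdiff F z) -> (0 <= tau)%R ->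
  (forall z, Cmod (F z) <= M * exp (tau * Cmod z))%R -> (forall x : R, F (RtoC x) = 0) ->
  forall z, F z = 0.
Proof.
  intros HF Htau HM H0 [x y].
  destruct (Rtotal_order y 0) as [Hy | [-> | Hy]]; [| apply H0 |].
  - rewrite <- (Ropp_involutive y); apply (zero_on_R_lower F M tau); auto; lra.
  - set (G := fun z => F (RtoC (-1) * z)).
    replace (F (x, y)) with (G ((- x)%R, (- y)%R)).
    + apply (zero_on_R_lower G M tau); auto.
      * intros z; apply (cdiff_comp F (fun w => RtoC (-1) * w)); [apply HF|].
        apply cdiff_mult; [apply cdiff_const | apply cdiff_id].
      * intros z; unfold G; eapply Rle_trans; [apply HM|].
        rewrite Cmod_mult, Cmod_R; replace (Rabs (-1)) with 1%R by (rewrite Rabs_left; lra).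
        rewrite Rmult_1_l; lra.
      * intros t; unfold G; rewrite <- RtoC_mult; apply H0.
    + unfold G; f_equal; unfold RtoC, Cmult; simpl; f_equal; ring.
Qed.

(** * Entire Hartley transforms *)

Definition fourier (f : R -> R) (b : R) (z : C) : C :=
  CI (fun t => RtoC (f t) * cexp ((Ci * RtoC (2 * PI * t)) * z)) (- b) b.

(** The extension to the plane through [cas u = ((1 - i) / 2) e^(i u) + ((1 + i) / 2) e^(- i u)]. *)
Definition hartleyC (f : R -> R) (b : R) (z : C) : C :=
  ((1 - Ci) / 2) * fourier f b z + ((1 + Ci) / 2) * fourier f b (RtoC (-1) * z).

Lemma ccts_cexp (g : R -> C) : ccts g -> ccts (fun t => cexp (g t)).
Proof. apply ccts_comp; intros z; apply cdiff_ccont, cdiff_cexp. Qed.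

Ltac cct := repeat lazymatch goal with
  | |- ccts (fun t => cexp _) => apply ccts_cexp
  | |- ccts (fun t => RtoC _) => apply ccts_RtoC; cts_tac
  | |- ccts (fun t => (_ - _)%C) => apply ccts_minus
  | |- ccts (fun t => (_ + _)%C) => apply ccts_plus
  | |- ccts (fun t => (_ * _)%C) => apply ccts_mult
  | |- ccts (fun t => _) => apply ccts_const
  end.

Lemma Cmod_freq (b t : R) : (- b <= t <= b)%R -> (Cmod (Ci * RtoC (2 * PI * t)) <= 2 * PI * b)%R.
Proof.
  intros Ht; assert (HPI := PI_RGT_0); rewrite Cmod_mult, Cmod_Ci, Rmult_1_l, Cmod_R.
  rewrite Rabs_mult, (Rabs_pos_eq (2 * PI)) by lra.
  apply Rmult_le_compat_l; [lra | apply Rabs_le_between; lra].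
Qed.

Lemma fourier_bound (f : R -> R) (b : R) (z : C) : cts f -> (0 <= b)%R ->
  (Cmod (fourier f b z) <= 2 * RInt (fun t => Rabs (f t)) (- b) b * exp (2 * PI * b * Cmod z))%R.
Proof.
  intros cf Hb; unfold fourier.
  apply Rle_trans with (2 * RInt (fun t => exp (2 * PI * b * Cmod z) * Rabs (f t)) (- b) b)%R.
  - apply CI_bound; [cct | cts_tac | lra |].
    intros t Ht; rewrite Cmod_mult, Cmod_R, Cmod_cexp, Rmult_comm.
    apply Rmult_le_compat_r; [apply Rabs_pos|]; apply exp_le_mono.
    eapply Rle_trans; [apply Rle_abs|]; eapply Rle_trans; [apply Re_le_Cmod|].
    rewrite Cmod_mult; apply Rmult_le_compat_r; [apply Cmod_ge_0 | apply Cmod_freq, Ht].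
  - rewrite RInt_c_scal by cts_tac; right; as_R; ring.
Qed.

(** The quadratic remainder of the exponential is uniform over the bounded set of frequencies, so
    the derivative passes under the integral. *)
Lemma cdiff_fourier (f : R -> R) (b : R) (z : C) : cts f -> (0 <= b)%R -> cdiff (fourier f b) z.
Proof.
  intros cf Hb; assert (HPI := PI_RGT_0).
  exists (CI (fun t => RtoC (f t) * (Ci * RtoC (2 * PI * t)) * cexp ((Ci * RtoC (2 * PI * t)) * z)) (- b) b).
  intros e He.
  set (p := (2 * PI * b)%R).
  assert (p0 : (0 <= p)%R) by (apply Rmult_le_pos; lra).
  set (A := RInt (fun t => Rabs (f t)) (- b) b).
  assert (A0 : (0 <= A)%R) by (apply RInt_c_pos; [cts_tac | lra | intros; apply Rabs_pos]).
  set (K := (2 * (exp (p * Cmod z) * (10 * p ^ 2) * A))%R).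
  assert (X0 := exp_pos (p * Cmod z)).
  assert (K0 : (0 <= K)%R).
  { unfold K; apply Rmult_le_pos; [lra|]; apply Rmult_le_pos; [|assumption].
    apply Rmult_le_pos; [lra|]; generalize (pow2_ge_0 p); lra. }
  exists (Rmin (/ (2 * (p + 1))) (e / (K + 1)))%R; split.
  { apply Rmin_pos; [apply Rinv_0_lt_compat; lra | apply Rdiv_lt_0_compat; lra]. }
  intros w Hw.
  set (h := Cmod (w - z)) in *.
  assert (h0 : (0 <= h)%R) by apply Cmod_ge_0.
  assert (h1 : (p * h <= / 2)%R).
  { apply Rle_trans with ((p + 1) * / (2 * (p + 1)))%R; [|right; field; lra].
    apply Rmult_le_compat; try lra; left; eapply Rlt_le_trans; [exact Hw | apply Rmin_l]. }
  assert (h2 : (K * h <= e)%R).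
  { apply Rle_trans with ((K + 1) * (e / (K + 1)))%R; [|right; field; lra].
    apply Rmult_le_compat; try lra; left; eapply Rlt_le_trans; [exact Hw | apply Rmin_r]. }
  unfold fourier; rewrite <- CI_minus by cct.
  rewrite (Cmult_comm (CI _ _ _)), <- CI_scal, <- CI_minus by cct.
  apply Rle_trans with (2 * RInt (fun t => (exp (p * Cmod z) * (10 * p ^ 2) * h ^ 2) * Rabs (f t)) (- b) b)%R.
  - apply CI_bound; [cct | cts_tac | lra |].
    intros t Ht.
    set (c := Ci * RtoC (2 * PI * t)).
    assert (Hc : (Cmod c <= p)%R) by (apply Cmod_freq, Ht).
    assert (c0 := Cmod_ge_0 c).
    replace (RtoC (f t) * cexp (c * w) - RtoC (f t) * cexp (c * z) - (w - z) * (RtoC (f t) * c * cexp (c * z)))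
      with (RtoC (f t) * (cexp (c * z) * (cexp (c * (w - z)) - 1 - c * (w - z)))).
    2:{ replace (cexp (c * w)) with (cexp (c * z) * cexp (c * (w - z))) by (rewrite <- cexp_plus; f_equal; ring). ring. }
    rewrite !Cmod_mult, Cmod_R, Cmod_cexp, Rmult_comm.
    apply Rmult_le_compat_r; [apply Rabs_pos|].
    assert (Hch : (Cmod (c * (w - z)) <= p * h)%R) by (rewrite Cmod_mult; apply Rmult_le_compat_r; assumption).
    rewrite (Rmult_assoc (exp (p * Cmod z))); apply Rmult_le_compat; [left; apply exp_pos | apply Cmod_ge_0 | |].
    + apply exp_le_mono; eapply Rle_trans; [apply Rle_abs|]; eapply Rle_trans; [apply Re_le_Cmod|].
      rewrite Cmod_mult; apply Rmult_le_compat_r; [apply Cmod_ge_0 | assumption].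
    + eapply Rle_trans; [apply cexp_second_order; lra|].
      rewrite Rmult_assoc; apply Rmult_le_compat_l; [lra|]; rewrite <- Rpow_mult_distr.
      apply pow_incr; split; [apply Cmod_ge_0 | assumption].
  - rewrite RInt_c_scal by cts_tac; fold A.
    apply Rle_trans with (K * h * h)%R; [right; unfold K; ring|].
    apply Rmult_le_compat_r; assumption.
Qed.

Lemma cdiff_hartleyC (f : R -> R) (b : R) (z : C) : cts f -> (0 <= b)%R -> cdiff (hartleyC f b) z.
Proof.
  intros cf Hb; apply cdiff_plus; (apply cdiff_mult; [apply cdiff_const|]).
  - apply cdiff_fourier; assumption.
  - apply (cdiff_comp (fourier f b) (fun w => RtoC (-1) * w)); [apply cdiff_fourier; assumption|].
    apply cdiff_mult; [apply cdiff_const | apply cdiff_id].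
Qed.

Lemma hartleyC_bound (f : R -> R) (b : R) (z : C) : cts f -> (0 <= b)%R ->
  (Cmod (hartleyC f b z) <= 4 * RInt (fun t => Rabs (f t)) (- b) b * exp (2 * PI * b * Cmod z))%R.
Proof.
  intros cf Hb; unfold hartleyC.
  assert (H2 : RtoC 2 <> 0) by (intros E; apply RtoC_inj in E; lra).
  assert (C2 : Cmod (RtoC 2) = 2%R) by (rewrite Cmod_R; apply Rabs_pos_eq; lra).
  assert (B1 : (Cmod ((1 - Ci) / 2) <= 1)%R).
  { rewrite Cmod_div, C2 by assumption; apply (Rle_div_l _ 1 2); [lra|].
    eapply Rle_trans; [apply Cmod_triangle|]; rewrite Cmod_opp, Cmod_Ci, Cmod_1; lra. }
  assert (B2 : (Cmod ((1 + Ci) / 2) <= 1)%R).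
  { rewrite Cmod_div, C2 by assumption; apply (Rle_div_l _ 1 2); [lra|].
    eapply Rle_trans; [apply Cmod_triangle|]; rewrite Cmod_Ci, Cmod_1; lra. }
  assert (F1 := fourier_bound f b z cf Hb); assert (F2 := fourier_bound f b (RtoC (-1) * z) cf Hb).
  rewrite Cmod_mult, Cmod_R in F2; replace (Rabs (-1)) with 1%R in F2 by (rewrite Rabs_left; lra).
  rewrite Rmult_1_l in F2.
  eapply Rle_trans; [apply Cmod_triangle|]; rewrite !Cmod_mult.
  assert (X1 : (Cmod ((1 - Ci) / 2) * Cmod (fourier f b z) <= 1 * Cmod (fourier f b z))%R)
    by (apply Rmult_le_compat_r; [apply Cmod_ge_0 | assumption]).
  assert (X2 : (Cmod ((1 + Ci) / 2) * Cmod (fourier f b (RtoC (-1) * z)) <= 1 * Cmod (fourier f b (RtoC (-1) * z)))%R)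
    by (apply Rmult_le_compat_r; [apply Cmod_ge_0 | assumption]).
  simpl in *; lra.
Qed.

Lemma hartleyC_real (f : R -> R) (b x : R) : cts f -> hartleyC f b (RtoC x) = RtoC (hartley f b x).
Proof.
  intros cf.
  pose (Cx := (RInt (fun t => f t * cos (2 * PI * x * t))%R (- b) b) : R).
  pose (Sx := (RInt (fun t => f t * sin (2 * PI * x * t))%R (- b) b) : R).
  assert (E1 : fourier f b (RtoC x) = (Cx, Sx)).
  { unfold fourier, CI, Cx, Sx; f_equal; apply RInt_R_ext; intros t; unfold cexp, Re, Im; simpl.
    - match goal with |- context [exp ?u] => replace u with 0%R by ring end; rewrite exp_0.
      match goal with |- context [cos ?u] => replace u with (2 * PI * x * t)%R by ring end; ring.
    - match goal with |- context [exp ?u] => replace u with 0%R by ring end; rewrite exp_0.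
      match goal with |- context [sin ?u] => replace u with (2 * PI * x * t)%R by ring end; ring. }
  assert (E2 : fourier f b (RtoC (-1) * RtoC x) = (Cx, (- Sx)%R)).
  { unfold fourier, CI, Cx, Sx; rewrite <- RInt_c_opp by cts_tac; f_equal; apply RInt_R_ext; intros t;
    unfold cexp, Re, Im; simpl.
    - match goal with |- context [exp ?u] => replace u with 0%R by ring end; rewrite exp_0.
      match goal with |- context [cos ?u] => replace u with (- (2 * PI * x * t))%R by ring end; rewrite cos_neg; ring.
    - match goal with |- context [exp ?u] => replace u with 0%R by ring end; rewrite exp_0.
      match goal with |- context [sin ?u] => replace u with (- (2 * PI * x * t))%R by ring end; rewrite sin_neg; ring. }
  assert (E3 : hartley f b x = (Cx + Sx)%R).
  { unfold hartley, Cx, Sx; rewrite <- RInt_c_plus by cts_tac; apply RInt_R_ext; intros t; unfold cas; ring. }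
  assert (H2 : RtoC 2 <> 0) by (intros E; apply RtoC_inj in E; lra).
  assert (Eh : @eq C (Cx, Sx) (RtoC Cx + Ci * RtoC Sx)) by (unfold RtoC, Ci, Cplus, Cmult; simpl; f_equal; as_R; ring).
  assert (Eh' : @eq C (Cx, (- Sx)%R) (RtoC Cx - Ci * RtoC Sx))
    by (unfold Cminus, Copp, RtoC, Ci, Cplus, Cmult; simpl; f_equal; as_R; ring).
  unfold hartleyC; rewrite E1, E2, E3, Eh, Eh', RtoC_plus.
  assert (Ei : Ci * Ci = - RtoC 1) by (unfold RtoC, Ci, Cmult, Copp; simpl; f_equal; ring).
  transitivity (RtoC Cx - (Ci * Ci) * RtoC Sx); [field; assumption | rewrite Ei; ring].
Qed.

Lemma entire_hartleyC (f : R -> R) (b : R) : cts f -> (0 <= b)%R -> entire (hartleyC f b).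
Proof. intros cf Hb z; apply ex_derive_cdiff, cdiff_hartleyC; assumption. Qed.

Lemma sqmod_hartleyC (f : R -> R) (b x : R) : cts f -> sqmod (hartleyC f b) x = (hartley f b x ^ 2)%R.
Proof. intros cf; unfold sqmod; rewrite hartleyC_real, Cmod_R by assumption; apply pow2_abs. Qed.

Lemma PW_hartleyC (a : R) (f : R -> R) : (0 < a <= 1)%R -> cts f ->
  (forall x, x <= - a \/ a <= x -> f x = 0)%R ->
  PW (2 * a) (hartleyC f a) /\ L2sq (hartleyC f a) = Nrm a f /\ L2Wsq (hartleyC f a) = (Nrm a f + Qf a f)%R.
Proof.
  intros Ha cf Hz; assert (HPI := PI_RGT_0).
  destruct (hartley_W_Qf a f Ha cf Hz) as [H1 H2].
  assert (ch := cts_hartley f a cf); assert (cw := cts_W).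
  assert (Eq : sqmod (hartleyC f a) = (fun x => hartley f a x ^ 2)%R)
    by (apply functional_extensionality; intros x; apply sqmod_hartleyC, cf).
  assert (Ew : (fun x => sqmod (hartleyC f a) x * W x)%R = (fun x => hartley f a x ^ 2 * W x)%R)
    by (rewrite Eq; reflexivity).
  repeat split.
  - apply entire_hartleyC; [assumption | lra].
  - intros e He; exists (4 * RInt (fun t => Rabs (f t)) (- a) a)%R; intros z.
    eapply Rle_trans; [apply hartleyC_bound; [assumption | lra]|].
    apply Rmult_le_compat_l.
    + assert (0 <= RInt (fun t => Rabs (f t)) (- a) a)%R by (apply RInt_c_pos; [cts_tac | lra | intros; apply Rabs_pos]).
      lra.
    + apply exp_le_mono, Rmult_le_compat_r; [apply Cmod_ge_0 | lra].
  - rewrite Eq; exists (Nrm a f).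
    apply (abs_int_is_RInt_gen _ (Nrm a f)); [cts_tac | | assumption].
    apply abs_int_pos; [cts_tac | intros; apply pow2_ge_0 | assumption].
  - unfold L2sq; rewrite Eq; apply RInt_gen_is_int; [cts_tac | intros; apply pow2_ge_0 | assumption].
  - unfold L2Wsq; rewrite Ew; apply RInt_gen_is_int; [cts_tac | | assumption].
    intros x; apply Rmult_le_pos; [apply pow2_ge_0 | apply W_bounds].
Qed.

Close Scope C_scope.

(** * Bounds on the Paley-Wiener space *)

Lemma is_int_dilate (f : R -> R) (r l : R) : cts f -> 0 < r ->
  is_int (fun x => f (r * x)) l -> is_int f (r * l).
Proof.
  intros cf Hr H e He.
  destruct (H (e / r)) as [T0 [p0 H0]]; [apply Rdiv_lt_0_compat; assumption|].
  exists (r * T0); split; [apply Rmult_le_pos; lra|]; intros T HT.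
  specialize (H0 (T / r) ltac:(apply Rle_div_r; lra)).
  assert (E : RInt f (- T) T = r * RInt (fun x => f (r * x)) (- (T / r)) (T / r)).
  { rewrite <- RInt_c_scal by cts_tac.
    generalize (RInt_c_comp_lin f r 0 (- (T / r)) (T / r) cf); intros X.
    rewrite (RInt_R_ext (fun x => r * f (r * x)) (fun y => r * f (r * y + 0)))
      by (intros; rewrite Rplus_0_r; reflexivity).
    rewrite X; f_equal; field; lra. }
  rewrite E, <- Rmult_minus_distr_l, Rabs_mult, (Rabs_pos_eq r) by lra.
  apply Rle_trans with (r * (e / r)); [apply Rmult_le_compat_l; lra | right; field; lra].
Qed.

(** Quantitative dominated convergence: the weights are within [eta] on [[- Y, Y]], and within [C]
    outside, where [q] has mass at most [tail]. *)
Lemma weighted_close (q k1 k2 : R -> R) (n I1 I2 Y eta C tail : R) : cts q -> cts k1 -> cts k2 ->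
  (forall x, 0 <= q x) -> is_int q n -> is_int (fun x => q x * k1 x) I1 -> is_int (fun x => q x * k2 x) I2 ->
  0 <= Y -> 0 <= eta -> 0 <= C -> (forall x, - Y <= x <= Y -> Rabs (k1 x - k2 x) <= eta) ->
  (forall x, Rabs (k1 x - k2 x) <= C) -> n - tail <= RInt q (- Y) Y ->
  Rabs (I1 - I2) <= eta * n + C * tail.
Proof.
  intros cq c1 c2 Hq Hn H1 H2 HY Heta HC Hin Hout Ht; apply Rle_eps; intros e He.
  destruct (H1 (e / 2)) as [T1 [p1 X1]]; [lra|].
  destruct (H2 (e / 2)) as [T2 [p2 X2]]; [lra|].
  set (T := T1 + T2 + Y); specialize (X1 T ltac:(unfold T; lra)); specialize (X2 T ltac:(unfold T; lra)).
  assert (HT : Y <= T) by (unfold T; lra).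
  set (F := fun x => q x * k1 x - q x * k2 x).
  assert (cF : cts F) by (unfold F; cts_tac).
  assert (HF1 : forall x, Rabs (F x) <= C * q x).
  { intros x; unfold F; rewrite <- Rmult_minus_distr_l, Rabs_mult, (Rabs_pos_eq (q x)), Rmult_comm by apply Hq.
    apply Rmult_le_compat_r; [apply Hq | apply Hout]. }
  assert (A1 := RInt_symm_diff F (fun x => C * q x) Y T cF ltac:(cts_tac) ltac:(lra) HF1).
  rewrite !RInt_c_scal in A1 by assumption.
  assert (A2 : Rabs (RInt F (- Y) Y) <= eta * RInt q (- Y) Y).
  { rewrite <- RInt_c_scal by assumption; apply RInt_c_abs_le; [assumption | cts_tac | lra |].
    intros x Hx; unfold F; rewrite <- Rmult_minus_distr_l, Rabs_mult, (Rabs_pos_eq (q x)), Rmult_comm by apply Hq.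
    apply Rmult_le_compat_r; [apply Hq | apply Hin, Hx]. }
  assert (A3 := pos_int_bound q n cq Hq Hn (- Y) Y ltac:(lra)).
  assert (A4 := pos_int_bound q n cq Hq Hn (- T) T ltac:(lra)).
  assert (EF : RInt F (- T) T = RInt (fun x => q x * k1 x) (- T) T - RInt (fun x => q x * k2 x) (- T) T)
    by (unfold F; apply RInt_c_minus; cts_tac).
  rewrite EF in A1.
  assert (A5 : C * RInt q (- T) T - C * RInt q (- Y) Y <= C * tail).
  { rewrite <- Rmult_minus_distr_l; apply Rmult_le_compat_l; lra. }
  assert (A6 : eta * RInt q (- Y) Y <= eta * n) by (apply Rmult_le_compat_l; assumption).
  apply Rabs_le_between in A1; apply Rabs_le_between in A2; apply Rabs_le_between in X1; apply Rabs_le_between in X2.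
  apply Rabs_le_between; lra.
Qed.

(** A substitution moves the dilation from [q] to the weights. These are bounded and converge
    uniformly on bounded sets, so no continuity of dilations in L1 has to be proved. *)
Lemma dilate_limit (q om J : R -> R) (a n I : R) : cts q -> cts om -> cts J -> 0 < a ->
  (forall x, 0 <= q x) -> (forall x, 0 <= om x <= 2) -> (forall x, Rabs (J x) <= 2) -> J 0 = 1 ->
  is_int q n -> is_int (fun x => q x * om x) I ->
  forall e, 0 < e -> exists th0, 0 < th0 <= / 2 /\ forall th I', 0 < th <= th0 ->
    is_int (fun x => q ((1 - th) * x) * (J (a * th ^ 2 / 2 * x) ^ 2 * om x)) I' ->
    Rabs ((1 - th) * I' - I) <= e.
Proof.
  intros cq co cJ Ha Hq Ho HJ J0 Hn HI e He.
  assert (Hn0 : 0 <= n).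
  { eapply Rle_trans; [|apply (pos_int_bound q n cq Hq Hn 0 0 (Rle_refl _))].
    apply RInt_c_pos; [assumption | lra | intros; apply Hq]. }
  destruct (Hn (e / 40)) as [Y0 [pY0 HY0]]; [lra|].
  set (Y := Y0 + 1).
  assert (Htail : n - e / 40 <= RInt q (- Y) Y).
  { specialize (HY0 Y ltac:(unfold Y; lra)); apply Rabs_le_between in HY0; lra. }
  set (eta := e / (2 * (n + 1))).
  assert (Heta : 0 < eta) by (apply Rdiv_lt_0_compat; lra).
  assert (Hetan : eta * n <= e / 2).
  { apply Rle_trans with (eta * (n + 1)); [apply Rmult_le_compat_l; lra | unfold eta; right; field; lra]. }
  assert (He8 : 0 < eta / 16) by lra.
  destruct (@Heine_cor2 om (- (2 * Y)) (2 * Y) (fun x _ => cts_pt om co x) (mkposreal _ He8)) as [d1 Hd1].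
  simpl in Hd1.
  assert (pd1 := cond_pos d1).
  destruct (cts_pt J cJ 0 (eta / 32)) as [d2 [pd2 Hd2]]; [lra|].
  simpl in Hd2; unfold R_dist in Hd2.
  assert (HYp : 0 < Y) by (unfold Y; lra).
  (* Three demands: the dilation factor is at least [/ 2], points of [[- Y, Y]] move by less than
     [d1], and the argument of [J] stays below [d2]. *)
  set (th0 := Rmin (/ 2) (Rmin (d1 / (4 * Y)) (d2 / (2 * a * Y)))).
  assert (aY : 0 < a * Y) by (apply Rmult_lt_0_compat; assumption).
  assert (Hth0 : 0 < th0).
  { unfold th0; apply Rmin_pos; [lra | apply Rmin_pos; apply Rdiv_lt_0_compat; lra]. }
  exists th0; split; [split; [assumption | apply Rmin_l]|].
  intros th I' [pth Hth] HI'.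
  assert (T1 : th <= / 2) by (eapply Rle_trans; [exact Hth | apply Rmin_l]).
  assert (T' : th <= Rmin (d1 / (4 * Y)) (d2 / (2 * a * Y))) by (eapply Rle_trans; [exact Hth | apply Rmin_r]).
  assert (T2 : th * (4 * Y) <= d1).
  { apply (Rle_div_r th d1 (4 * Y)); [lra|]; eapply Rle_trans; [exact T' | apply Rmin_l]. }
  assert (T3 : th * (2 * a * Y) <= d2).
  { apply (Rle_div_r th d2 (2 * a * Y)); [lra|]; eapply Rle_trans; [exact T' | apply Rmin_r]. }
  set (r := 1 - th) in *.
  assert (Hr : / 2 <= r < 1) by (unfold r; lra).
  set (de := a * th ^ 2 / 2) in *.
  set (k1 := fun y => J (de * (/ r * y)) ^ 2 * om (/ r * y)).
  assert (ck1 : cts k1) by (unfold k1; cts_tac).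
  assert (HI1 : is_int (fun y => q y * k1 y) (r * I')).
  { apply is_int_dilate; [cts_tac | lra |].
    apply (is_int_ext (fun x => q (r * x) * (J (de * x) ^ 2 * om x))); [|assumption].
    intros x; unfold k1; replace (/ r * (r * x)) with x by (field; lra); reflexivity. }
  (* 10 is the bound [4 * 2] on the new weight plus 2 for the old one; the total is at most
     [e / 2 + 10 * (e / 40)]. *)
  eapply Rle_trans; [apply (weighted_close q k1 om n (r * I') I Y eta 10 (e / 40)); auto; try lra|].
  - intros x Hx.
    assert (Hir : 1 < / r <= 2).
    { split; [rewrite <- Rinv_1 at 1; apply Rinv_lt_contravar; lra|].
      rewrite <- (Rinv_inv 2); apply Rinv_le_contravar; lra. }
    assert (Hrx : Rabs (/ r * x - x) <= 2 * th * Y).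
    { replace (/ r * x - x) with ((th * / r) * x) by (unfold r; field; unfold r in Hr; lra).
      rewrite Rabs_mult, (Rabs_pos_eq (th * / r)) by (apply Rmult_le_pos; lra).
      apply Rmult_le_compat; [apply Rmult_le_pos; lra | apply Rabs_pos | nra | apply Rabs_le_between; lra]. }
    assert (W1 : Rabs (om (/ r * x) - om x) <= eta / 16).
    { left; apply Hd1.
      - apply Rabs_le_between; rewrite Rabs_mult, Rabs_pos_eq by lra.
        apply Rmult_le_compat; [lra | apply Rabs_pos | lra | apply Rabs_le_between; lra].
      - lra.
      - eapply Rle_lt_trans; [exact Hrx|]; nra. }
    assert (W2 : Rabs (J (de * (/ r * x)) - 1) <= eta / 32).
    { rewrite <- J0.
      destruct (Req_dec (de * (/ r * x)) 0) as [-> | Hne]; [rewrite Rminus_diag, Rabs_R0; lra|].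
      left; apply Hd2; split; [split; [exact Logic.I | auto]|].
      rewrite Rminus_0_r, Rabs_mult, Rabs_mult.
      assert (Hde : 0 <= de <= a * th / 4).
      { unfold de; split; [apply Rle_mult_inv_pos; [apply Rmult_le_pos; [lra | apply pow2_ge_0] | lra]|].
        assert (a * th * th <= a * th * / 2) by (apply Rmult_le_compat_l; [apply Rmult_le_pos|]; lra). lra. }
      rewrite (Rabs_pos_eq de), (Rabs_pos_eq (/ r)) by lra.
      assert (Rabs x <= Y) by (apply Rabs_le_between; lra).
      assert (/ r * Rabs x <= 2 * Y) by (apply Rmult_le_compat; auto using Rabs_pos; lra).
      assert (0 <= / r * Rabs x) by (apply Rmult_le_pos; [lra | apply Rabs_pos]).
      assert (de * (/ r * Rabs x) <= a * th / 4 * (2 * Y)) by (apply Rmult_le_compat; lra).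
      assert (0 < th * (a * Y)) by (apply Rmult_lt_0_compat; lra).
      lra. }
    unfold k1.
    set (j := J (de * (/ r * x))) in *.
    assert (Hj : Rabs j <= 2) by apply HJ.
    replace (j ^ 2 * om (/ r * x) - om x) with ((j - 1) * (j + 1) * om (/ r * x) + (om (/ r * x) - om x)) by ring.
    eapply Rle_trans; [apply Rabs_triang|]; rewrite !Rabs_mult.
    assert (Rabs (om (/ r * x)) <= 2) by (rewrite Rabs_pos_eq; apply Ho).
    assert (Rabs (j + 1) <= 3) by (apply Rabs_le_between in Hj; apply Rabs_le_between; lra).
    assert (Rabs (j - 1) * Rabs (j + 1) <= eta / 32 * 3) by (apply Rmult_le_compat; auto using Rabs_pos).
    assert (Rabs (j - 1) * Rabs (j + 1) * Rabs (om (/ r * x)) <= eta / 32 * 3 * 2).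
    { apply Rmult_le_compat; auto using Rabs_pos; apply Rmult_le_pos; apply Rabs_pos. }
    lra.
  - intros x; unfold k1.
    specialize (HJ (de * (/ r * x))); set (j := J (de * (/ r * x))) in *.
    assert (O1 := Ho (/ r * x)); assert (O2 := Ho x).
    assert (0 <= j ^ 2 <= 4).
    { split; [apply pow2_ge_0|]; rewrite <- pow2_abs; replace 4 with (2 ^ 2) by ring.
      apply pow_incr; split; [apply Rabs_pos | assumption]. }
    assert (0 <= j ^ 2 * om (/ r * x) <= 4 * 2) by (split; [apply Rmult_le_pos | apply Rmult_le_compat]; lra).
    apply Rabs_le_between; lra.
  - lra.
Qed.

(** The multiplier is the Hartley transform of this bump: mass one gives it the value 1 at the
    origin, support in [[-1, 1]] gives exponential type [2 * PI], and Plancherel makes it square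
    integrable. *)
Definition tent (t : R) : R := Rmax 0 (1 - Rabs t).

Lemma cts_tent : cts tent.
Proof. apply (cts_max (fun t => 1 - Rabs t)); cts_tac. Qed.

Lemma tent_zero (t : R) : t <= - (1) \/ 1 <= t -> tent t = 0.
Proof.
  intros H; unfold tent; apply Rmax_left.
  destruct H; [rewrite Rabs_left1 | rewrite Rabs_pos_eq]; lra.
Qed.

Lemma tent_pos (t : R) : 0 <= tent t.
Proof. apply Rmax_l. Qed.

Lemma tent_mass : RInt tent (- (1)) 1 = 1.
Proof.
  assert (ct := cts_tent).
  rewrite (RInt_even tent 1 ct) by (intros x; unfold tent; rewrite Rabs_Ropp; reflexivity).
  rewrite (RInt_R_ext_in tent (fun t => 1 - t)).
  - rewrite (RInt_of_derive (fun t => t - t ^ 2 / 2)); [as_R; field | | cts_tac].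
    intros x; auto_derive; [trivial | field].
  - lra.
  - intros x Hx; unfold tent; rewrite Rabs_pos_eq, Rmax_right; lra.
Qed.

Lemma hartley_tent_0 : hartley tent 1 0 = 1.
Proof.
  unfold hartley; rewrite (RInt_R_ext _ tent); [apply tent_mass|].
  intros t; unfold cas; rewrite Rmult_0_r, Rmult_0_l, cos_0, sin_0; ring.
Qed.

Lemma hartley_tent_abs (x : R) : Rabs (hartley tent 1 x) <= 2.
Proof.
  assert (ct := cts_tent).
  apply Rle_trans with (RInt (fun t => 2 * tent t) (- (1)) 1).
  - apply RInt_c_abs_le; [apply cts_mult; [assumption | apply cts_cas; cts_tac] | cts_tac | lra |].
    intros t _; rewrite Rabs_mult, (Rabs_pos_eq (tent t)), Rmult_comm by apply tent_pos.
    apply Rmult_le_compat_r; [apply tent_pos | apply cas_abs].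
  - rewrite RInt_c_scal, tent_mass by assumption; lra.
Qed.

Lemma sqmod_cts (F : C -> C) : (forall z, ccont F z) -> cts (sqmod F).
Proof. intros H; apply cts_pow, cts_Cmod, ccts_real, H. Qed.

Lemma sqmod_pos (F : C -> C) (x : R) : 0 <= sqmod F x.
Proof. apply pow2_ge_0. Qed.

(** The strict inequality for [tau] lets the vanishing of the spectrum include [|t| = a], so the
    inverse transforms [h1] and [h2] are continuous and zero at the end points, as Plancherel
    requires. The bounds for the real and the imaginary part then add. *)
Lemma spectrum_bounds (G : C -> C) (M tau B a lo hi : R) : (forall z, cdiff G z) ->
  (forall z, Cmod (G z) <= M * exp (tau * Cmod z)) -> 0 <= tau < 2 * PI * a -> 0 < a <= 1 ->
  (forall T, 0 <= T -> RInt (fun x => Cmod (G (RtoC x))) (- T) T <= B) ->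
  (forall f, cts f -> lo * Nrm a f <= Qf a f <= hi * Nrm a f) ->
  exists n w, is_int (sqmod G) n /\ is_int (fun x => sqmod G x * W x) w /\ (1 + lo) * n <= w <= (1 + hi) * n.
Proof.
  intros HG HM Htau Ha HB Hsp.
  assert (HPI := PI_RGT_0); assert (cW := cts_W).
  assert (cG : forall z, ccont G z) by (intros; apply cdiff_ccont, HG).
  destruct (ccts_real G cG) as [cR cI].
  assert (cM : cts (fun x => Cmod (G (RtoC x)))) by (apply cts_Cmod, ccts_real, cG).
  assert (HB' : abs_int (fun x => Cmod (G (RtoC x))) B).
  { intros T HT; rewrite (RInt_R_ext _ (fun x => Cmod (G (RtoC x)))) by (intros; apply Rabs_pos_eq, Cmod_ge_0).
    apply HB, HT. }
  assert (BR : abs_int (fun x => Re (G (RtoC x))) B)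
    by (apply (abs_int_dom _ (fun x => Cmod (G (RtoC x)))); auto; intros; apply Re_le_Cmod).
  assert (BI : abs_int (fun x => Im (G (RtoC x))) B)
    by (apply (abs_int_dom _ (fun x => Cmod (G (RtoC x)))); auto; intros; apply Im_le_Cmod).
  assert (van : forall t, a <= Rabs t ->
    is_int (fun x => Re (G (RtoC x)) * cas (2 * PI * t * x)) 0 /\ is_int (fun x => Im (G (RtoC x)) * cas (2 * PI * t * x)) 0).
  { intros t Ht.
    assert (Hb : 0 <= tau < 2 * PI * Rabs t).
    { split; [lra|]; apply Rlt_le_trans with (2 * PI * a); [lra | apply Rmult_le_compat_l; lra]. }
    destruct (fourier_vanishes_real G M tau (2 * PI * Rabs t) B HG HM Hb HB) as [[Rc Rs] [Ic Is]].
    assert (comb : forall U : R -> R, cts U -> is_int (fun x => U x * cos (2 * PI * Rabs t * x)) 0 ->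
      is_int (fun x => U x * sin (2 * PI * Rabs t * x)) 0 -> is_int (fun x => U x * cas (2 * PI * t * x)) 0).
    { intros U cU Hc Hs.
      (* The vanishing is known at [|t|]; for negative [t] only the sine changes sign. *)
      set (sg := if Rle_lt_dec 0 t then 1 else -1).
      assert (E : forall x, U x * cas (2 * PI * t * x) = U x * cos (2 * PI * Rabs t * x) + sg * (U x * sin (2 * PI * Rabs t * x))).
      { intros x; unfold cas, sg; destruct (Rle_lt_dec 0 t) as [H|H].
        - rewrite Rabs_pos_eq by assumption; ring.
        - rewrite Rabs_left by assumption.
          replace (2 * PI * - t * x) with (- (2 * PI * t * x)) by ring; rewrite cos_neg, sin_neg; ring. }
      apply (is_int_ext (fun x => U x * cos (2 * PI * Rabs t * x) + sg * (U x * sin (2 * PI * Rabs t * x))));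
        [intros; rewrite E; reflexivity|].
      replace 0 with (0 + sg * 0) by ring.
      apply is_int_plus; [cts_tac | cts_tac | assumption | apply is_int_scal; [cts_tac | assumption]]. }
    split; apply comb; assumption. }
  destruct (hartley_inversion (fun x => Re (G (RtoC x))) B a cR BR ltac:(lra) (fun t Ht => proj1 (van t Ht)))
    as [h1 [ch1 [hz1 E1]]].
  destruct (hartley_inversion (fun x => Im (G (RtoC x))) B a cI BI ltac:(lra) (fun t Ht => proj2 (van t Ht)))
    as [h2 [ch2 [hz2 E2]]].
  destruct (hartley_W_Qf a h1 Ha ch1 hz1) as [P1 W1].
  destruct (hartley_W_Qf a h2 Ha ch2 hz2) as [P2 W2].
  assert (cH1 := cts_hartley h1 a ch1); assert (cH2 := cts_hartley h2 a ch2).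
  assert (Eq : forall x, hartley h1 a x ^ 2 + hartley h2 a x ^ 2 = sqmod G x).
  { intros x; unfold sqmod; rewrite Cmod_sqr, E1, E2; reflexivity. }
  exists (Nrm a h1 + Nrm a h2), ((Nrm a h1 + Qf a h1) + (Nrm a h2 + Qf a h2)); repeat split.
  - apply (is_int_ext (fun x => hartley h1 a x ^ 2 + hartley h2 a x ^ 2)); [assumption|].
    apply is_int_plus; try assumption; cts_tac.
  - apply (is_int_ext (fun x => hartley h1 a x ^ 2 * W x + hartley h2 a x ^ 2 * W x)).
    { intros x; rewrite <- Eq; ring. }
    apply is_int_plus; try assumption; cts_tac.
  - generalize (Hsp h1 ch1) (Hsp h2 ch2); lra.
  - generalize (Hsp h1 ch1) (Hsp h2 ch2); lra.
Qed.

Theorem PW_bounds (a lo hi : R) : 0 < a <= 1 ->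
  (forall f, cts f -> lo * Nrm a f <= Qf a f <= hi * Nrm a f) ->
  forall F, PW (2 * a) F -> exists n w, is_int (sqmod F) n /\ is_int (fun x => sqmod F x * W x) w /\
    (1 + lo) * n <= w <= (1 + hi) * n.
Proof.
  intros Ha Hsp F [HE [HT [n HL]]].
  assert (HPI := PI_RGT_0); assert (cW := cts_W).
  assert (HdF : forall z, cdiff F z) by (intros z; apply ex_derive_cdiff, HE).
  assert (cF : forall z, ccont F z) by (intros; apply cdiff_ccont, HdF).
  assert (cq := sqmod_cts F cF); assert (Hq := sqmod_pos F).
  apply is_int_of_is_RInt_gen in HL; [|assumption].
  assert (Hn0 : 0 <= n).
  { eapply Rle_trans; [|apply (pos_int_bound _ n cq Hq HL 0 0 (Rle_refl _))].
    apply RInt_c_pos; [assumption | lra | intros; apply Hq]. }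
  destruct (abs_int_ex (fun x => sqmod F x * W x) (2 * n)) as [w [_ Hw]].
  { cts_tac. }
  { intros T HT'; apply Rle_trans with (RInt (fun x => 2 * sqmod F x) (- T) T).
    - apply RInt_c_le; [cts_tac | cts_tac | lra |]; intros x _; generalize (W_bounds x); intros.
      rewrite Rabs_pos_eq by (apply Rmult_le_pos; [apply Hq | lra]).
      rewrite Rmult_comm; apply Rmult_le_compat_r; [apply Hq | lra].
    - rewrite RInt_c_scal by assumption; generalize (pos_int_bound _ n cq Hq HL (- T) T ltac:(lra)); simpl; lra. }
  exists n, w; split; [assumption|]; split; [assumption|].
  set (J := hartley tent 1).
  assert (ct := cts_tent).
  assert (cJ : cts J) by (apply cts_hartley, ct).
  assert (approx : forall e, 0 < e -> exists n' w', Rabs (n' - n) <= e /\ Rabs (w' - w) <= e /\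
     (1 + lo) * n' <= w' <= (1 + hi) * n').
  { intros e He.
    (* The weights [W] and 1 are followed along the same family of approximants, so that the two
       limits can be compared. *)
    destruct (dilate_limit (sqmod F) W J a n w cq cW cJ ltac:(lra) Hq W_bounds hartley_tent_abs hartley_tent_0 HL Hw e He)
      as [t1 [[pt1 Ht1] L1]].
    destruct (dilate_limit (sqmod F) (fun _ => 1) J a n n cq (cts_const 1) cJ ltac:(lra) Hq ltac:(intros; lra)
      hartley_tent_abs hartley_tent_0 HL) with (e := e) as [t2 [[pt2 Ht2] L2]]; [|assumption|].
    { apply (is_int_ext (sqmod F)); [intros; ring | assumption]. }
    set (th := Rmin t1 t2).
    assert (pth : 0 < th) by (apply Rmin_pos; assumption).
    assert (th1 : th <= t1) by apply Rmin_l; assert (th2 : th <= t2) by apply Rmin_r.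
    (* With the type of [F] relaxed to [p + p * th], the dilated function has type
       [(p + p * th) * (1 - th) = p - p * th ^ 2]. Half of this gain,
       [2 * PI * de = p * th ^ 2 / 2], goes to the multiplier, and the type stays strictly below
       [p]. *)
    set (r := 1 - th); set (de := a * th ^ 2 / 2).
    set (p := 2 * PI * a).
    assert (pp : 0 < p) by (unfold p; apply Rmult_lt_0_compat; lra).
    assert (th20 : 0 < th ^ 2) by (apply pow_lt; assumption).
    assert (pde : 0 < de) by (unfold de; apply Rmult_lt_0_compat; [apply Rmult_lt_0_compat|]; lra).
    destruct (HT (p * th)) as [M HM]; [apply Rmult_lt_0_compat; assumption|].
    set (G := fun z : C => (F (RtoC r * z) * hartleyC tent 1 (RtoC de * z))%C).
    assert (Hr : / 2 <= r < 1) by (unfold r; lra).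
    assert (HG : forall z, cdiff G z).
    { intros z; apply cdiff_mult.
      - apply (cdiff_comp F (fun w => (RtoC r * w)%C)); [apply HdF|].
        apply cdiff_mult; [apply cdiff_const | apply cdiff_id].
      - apply (cdiff_comp (hartleyC tent 1) (fun w => (RtoC de * w)%C)); [apply cdiff_hartleyC; [assumption | lra]|].
        apply cdiff_mult; [apply cdiff_const | apply cdiff_id]. }
    assert (pM : 0 <= M).
    { specialize (HM 0%C); rewrite Cmod_0, Rmult_0_r, exp_0, Rmult_1_r in HM.
      eapply Rle_trans; [apply Cmod_ge_0 | exact HM]. }
    set (tau := (p + p * th) * r + 2 * PI * de).
    assert (Htau : 0 <= tau < 2 * PI * a).
    { assert (E : tau = p - p * th ^ 2 / 2) by (unfold tau, r, de, p; field).
      fold p; split.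
      - unfold tau; apply Rplus_le_le_0_compat; apply Rmult_le_pos; try lra; nra.
      - rewrite E; assert (0 < p * th ^ 2) by (apply Rmult_lt_0_compat; assumption); lra. }
    assert (HGM : forall z, Cmod (G z) <= (M * 4) * exp (tau * Cmod z)).
    { intros z; unfold G; rewrite Cmod_mult.
      assert (X1 := HM (RtoC r * z)%C); assert (X2 := hartleyC_bound tent 1 (RtoC de * z)%C ct ltac:(lra)).
      rewrite (RInt_R_ext (fun t => Rabs (tent t)) tent), tent_mass in X2 by (intros; apply Rabs_pos_eq, tent_pos).
      rewrite Cmod_mult, Cmod_R, Rabs_pos_eq in X1, X2 by lra.
      replace (tau * Cmod z) with ((PI * (2 * a) + p * th) * (r * Cmod z) + 2 * PI * 1 * (de * Cmod z))
        by (unfold tau, p; ring).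
      rewrite exp_plus.
      eapply Rle_trans; [apply Rmult_le_compat; [apply Cmod_ge_0 | apply Cmod_ge_0 | exact X1 | exact X2]|].
      right; ring. }
    assert (EJ : forall x, Cmod (hartleyC tent 1 (RtoC de * RtoC x)%C) = Rabs (J (de * x))).
    { intros x; rewrite <- RtoC_mult, hartleyC_real by assumption; apply Cmod_R. }
    assert (EG : forall x, Cmod (G (RtoC x)) = Cmod (F (RtoC (r * x))) * Rabs (J (de * x))).
    { intros x; unfold G; rewrite Cmod_mult, EJ, RtoC_mult; reflexivity. }
    assert (Esq : forall x, sqmod G x = sqmod F (r * x) * J (de * x) ^ 2).
    { intros x; unfold sqmod; rewrite EG, Rpow_mult_distr, pow2_abs; reflexivity. }
    set (nJ := RInt (fun s => tent s ^ 2) (- (1)) 1).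
    assert (PJ : is_int (fun x => J x ^ 2) nJ) by (apply hartley_plancherel; [assumption | lra | apply tent_zero]).
    assert (cG : forall z, ccont G z) by (intros; apply cdiff_ccont, HG).
    assert (scaled : forall f l c T, cts f -> (forall x, 0 <= f x) -> is_int f l -> 0 < c -> 0 <= T ->
      RInt (fun x => f (c * x)) (- T) T <= / c * l).
    { intros f l c T cf Hf Hl Hc HT0.
      assert (X := RInt_c_comp_lin f c 0 (- T) T cf).
      rewrite (RInt_R_ext (fun y => c * f (c * y + 0)) (fun y => c * f (c * y))) in X
        by (intros; rewrite Rplus_0_r; reflexivity).
      rewrite RInt_c_scal in X by cts_tac.
      assert (cT0 : 0 <= c * T) by (apply Rmult_le_pos; lra).
      assert (Y := pos_int_bound f l cf Hf Hl (c * - T + 0) (c * T + 0) ltac:(lra)).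
      rewrite <- X in Y.
      apply Rmult_le_reg_l with c; [assumption|].
      rewrite <- Rmult_assoc, Rinv_r, Rmult_1_l by lra; exact Y. }
    destruct (spectrum_bounds G (M * 4) tau (/ 2 * (/ r * n) + / 2 * (/ de * nJ)) a lo hi HG HGM Htau Ha) as [n1 [w1 [N1 [W1 S1]]]].
    { intros T HT0.
      (* Integrability of the product of two square-integrable functions, by the inequality of
         arithmetic and geometric means. *)
      apply Rle_trans with (RInt (fun x => / 2 * sqmod F (r * x) + / 2 * J (de * x) ^ 2) (- T) T).
      - apply RInt_c_le; [apply cts_Cmod, ccts_real, cG | cts_tac | lra |].
        intros x _; rewrite EG, <- (pow2_abs (J (de * x))); unfold sqmod.
        generalize (pow2_ge_0 (Cmod (F (RtoC (r * x))) - Rabs (J (de * x)))); lra.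
      - rewrite RInt_c_plus by cts_tac.
        rewrite (RInt_c_scal (fun x => sqmod F (r * x))), (RInt_c_scal (fun x => J (de * x) ^ 2)) by cts_tac.
        assert (Y1 := scaled (sqmod F) n r T cq Hq HL ltac:(lra) HT0).
        assert (Y2 := scaled (fun x => J x ^ 2) nJ de T ltac:(cts_tac) ltac:(intros; apply pow2_ge_0) PJ pde HT0).
        simpl in *; lra. }
    { exact Hsp. }
    exists (r * n1), (r * w1); repeat split.
    - apply (L2 th n1); [lra|]; apply (is_int_ext (sqmod G)); [|assumption].
      intros x; rewrite Esq, Rmult_1_r; reflexivity.
    - apply (L1 th w1); [lra|]; apply (is_int_ext (fun x => sqmod G x * W x)); [|assumption].
      intros x; rewrite Esq, Rmult_assoc; reflexivity.
    - replace ((1 + lo) * (r * n1)) with (r * ((1 + lo) * n1)) by ring; apply Rmult_le_compat_l; lra.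
    - replace ((1 + hi) * (r * n1)) with (r * ((1 + hi) * n1)) by ring; apply Rmult_le_compat_l; lra. }
  assert (lip : forall c n' e, Rabs (n' - n) <= e -> Rabs (c * n' - c * n) <= Rabs c * e).
  { intros c n' e H; rewrite <- Rmult_minus_distr_l, Rabs_mult; apply Rmult_le_compat_l; [apply Rabs_pos | assumption]. }
  split; apply Rle_eps; intros e He.
  - assert (c0 := Rabs_pos (1 + lo)).
    destruct (approx (e / (1 + Rabs (1 + lo)))) as [n' [w' [A1 [A2 A3]]]]; [apply Rdiv_lt_0_compat; lra|].
    assert (A4 := lip (1 + lo) n' _ A1).
    set (e1 := e / (1 + Rabs (1 + lo))) in *.
    assert (Ee : e = e1 + Rabs (1 + lo) * e1) by (unfold e1; field; lra).
    apply Rabs_le_between in A2; apply Rabs_le_between in A4; lra.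
  - assert (c0 := Rabs_pos (1 + hi)).
    destruct (approx (e / (1 + Rabs (1 + hi)))) as [n' [w' [A1 [A2 A3]]]]; [apply Rdiv_lt_0_compat; lra|].
    assert (A4 := lip (1 + hi) n' _ A1).
    set (e1 := e / (1 + Rabs (1 + hi))) in *.
    assert (Ee : e = e1 + Rabs (1 + hi) * e1) by (unfold e1; field; lra).
    apply Rabs_le_between in A2; apply Rabs_le_between in A4; lra.
Qed.

(** [F] is only known to be nonzero at some complex point. [zero_on_R] makes it nonzero on the line,
    so the quotients in [ratios] have a positive denominator. *)
Lemma L2sq_pos (Delta : R) (F : C -> C) : 0 <= Delta -> PW Delta F -> (exists z, F z <> RtoC 0) ->
  forall n, is_int (sqmod F) n -> 0 < n.
Proof.
  intros HD [HE [HT _]] [z Hz] n Hn.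
  assert (HPI := PI_RGT_0).
  assert (HdF : forall z, cdiff F z) by (intros; apply ex_derive_cdiff, HE).
  assert (cF : forall z, ccont F z) by (intros; apply cdiff_ccont, HdF).
  assert (cq := sqmod_cts F cF); assert (Hq := sqmod_pos F).
  destruct (Rle_lt_dec n 0) as [Hn0|]; [exfalso | assumption].
  destruct (HT 1 Rlt_0_1) as [M HM].
  apply Hz; apply (zero_on_R F M (PI * Delta + 1)); auto.
  - assert (0 <= PI * Delta) by (apply Rmult_le_pos; lra); lra.
  - intros x.
    destruct (Hq x) as [Hx | Hx].
    + exfalso.
      assert (0 < RInt (sqmod F) (x - 1) (x + 1)) by (apply (RInt_c_pos_strict _ _ _ x); auto; lra).
      assert (RInt (sqmod F) (x - 1) (x + 1) <= n) by (apply pos_int_bound; auto; lra).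
      lra.
    + apply Cmod_eq_0; unfold sqmod in Hx.
      apply Rsqr_0_uniq; unfold Rsqr; simpl in Hx; lra.
Qed.

(** * From bounds on the quadratic form to the extremal quotients *)

Lemma ratio_between (a lo hi : R) : 0 < a <= 1 -> 0 <= 1 + lo ->
  (forall f, cts f -> lo * Nrm a f <= Qf a f <= hi * Nrm a f) ->
  forall r, ratios (2 * a) r -> sqrt (1 + lo) <= r <= sqrt (1 + hi).
Proof.
  intros Ha Hlo Hsp r [F [HF [Hnz ->]]].
  destruct (PW_bounds a lo hi Ha Hsp F HF) as [n [w [Hn [Hw Hb]]]].
  assert (np := L2sq_pos (2 * a) F ltac:(lra) HF Hnz n Hn).
  assert (HdF : forall z, cdiff F z) by (intros; apply ex_derive_cdiff, HF).
  assert (cF : forall z, ccont F z) by (intros; apply cdiff_ccont, HdF).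
  assert (cq := sqmod_cts F cF); assert (Hq := sqmod_pos F); assert (cW := cts_W).
  assert (E1 : L2sq F = n) by exact (RInt_gen_is_int (sqmod F) n cq Hq Hn).
  assert (E2 : L2Wsq F = w).
  { unfold L2Wsq; apply (RInt_gen_is_int (fun x => sqmod F x * W x)); [cts_tac | | assumption].
    intros x; apply Rmult_le_pos; [apply Hq | apply W_bounds]. }
  rewrite E1, E2, <- sqrt_div_alt by assumption.
  split; apply sqrt_le_1_alt.
  - apply Rle_div_r; lra.
  - apply Rle_div_l; lra.
Qed.

Lemma ratio_approx (a eta : R) (f : R -> R) : 0 < a <= 1 -> cts f -> 0 < Nrm a f ->
  Qf a f = eta * Nrm a f -> forall e, 0 < e ->
  exists r x, ratios (2 * a) r /\ r = sqrt x /\ Rabs (x - (1 + eta)) <= e.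
Proof.
  intros Ha cf HN HQ e He.
  set (N := Nrm a f) in *.
  assert (He0 := Rabs_pos eta).
  (* The first bound keeps the norm of the cut-off function above [N / 2]; the second makes
     [(1 + |eta|) * e1] at most [e * N / 2]. *)
  set (e1 := Rmin (N / 2) (e * N / (2 * (1 + Rabs eta)))).
  assert (pe1 : 0 < e1).
  { apply Rmin_pos; [lra|]; apply Rdiv_lt_0_compat; [apply Rmult_lt_0_compat|]; lra. }
  assert (He1 : e1 <= N / 2) by apply Rmin_l.
  assert (He2 : e1 * (2 * (1 + Rabs eta)) <= e * N).
  { apply (Rle_div_r e1 (e * N) (2 * (1 + Rabs eta))); [lra | apply Rmin_r]. }
  destruct (cutoff_approx a f Ha cf e1 pe1) as [g [cg [gz [G1 G2]]]]; fold N in G1.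
  destruct (PW_hartleyC a g Ha cg gz) as [P1 [P2 P3]].
  assert (Ng : N / 2 <= Nrm a g) by (apply Rabs_le_between in G1; lra).
  exists (sqrt (L2Wsq (hartleyC g a)) / sqrt (L2sq (hartleyC g a))), ((Nrm a g + Qf a g) / Nrm a g); repeat split.
  - exists (hartleyC g a); split; [assumption|]; split; [|reflexivity].
    (* If the transform vanished identically, Plancherel would make the norm of [g] zero. *)
    apply NNPP; intros Hno.
    assert (Z : forall z, hartleyC g a z = RtoC 0) by (intros z; apply NNPP; intros Hz; apply Hno; exists z; exact Hz).
    destruct (hartley_W_Qf a g Ha cg gz) as [H1 _].
    assert (Nrm a g = 0); [|lra].
    apply (is_int_unique (fun x => hartley g a x ^ 2)); [assumption|].
    apply (is_int_ext (fun _ => 0)).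
    + intros x; rewrite <- sqmod_hartleyC by assumption; unfold sqmod; rewrite Z, Cmod_0; ring.
    + intros d Hd; exists 0; split; [lra|]; intros T HT.
      rewrite RInt_R_const, Rmult_0_r, Rminus_0_r, Rabs_R0; lra.
  - rewrite P2, P3, <- sqrt_div_alt by lra; reflexivity.
  - assert (E : (Nrm a g + Qf a g) / Nrm a g - (1 + eta) = / Nrm a g * ((Qf a g - Qf a f) - eta * (Nrm a g - N))).
    { rewrite HQ; field; lra. }
    rewrite E, Rabs_mult, Rabs_pos_eq by (left; apply Rinv_0_lt_compat; lra).
    rewrite Rmult_comm; apply Rle_div_l; [lra|].
    eapply Rle_trans; [apply Rabs_triang|]; rewrite Rabs_Ropp, Rabs_mult.
    assert (Rabs eta * Rabs (Nrm a g - N) <= Rabs eta * e1) by (apply Rmult_le_compat_l; assumption).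
    assert (e * (N / 2) <= e * Nrm a g) by (apply Rmult_le_compat_l; lra).
    lra.
Qed.

Lemma sup_value (a lo hi : R) (f : R -> R) : 0 < a <= 1 -> 0 <= 1 + lo ->
  (forall f, cts f -> lo * Nrm a f <= Qf a f <= hi * Nrm a f) ->
  cts f -> 0 < Nrm a f -> Qf a f = hi * Nrm a f -> Cplus_is (2 * a) (Finite (sqrt (1 + hi))).
Proof.
  intros Ha Hlo Hsp cf HN HQ; split.
  - intros r Hr; simpl; apply (ratio_between a lo hi Ha Hlo Hsp r Hr).
  - intros u Hu.
    assert (Hlh : lo <= hi) by (specialize (Hsp f cf); nra).
    destruct u as [u| |]; simpl; auto.
    + assert (u0 : 0 <= u).
      { destruct (ratio_approx a hi f Ha cf HN HQ 1 Rlt_0_1) as [r [x [Hr [-> _]]]].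
        specialize (Hu _ Hr); simpl in Hu; eapply Rle_trans; [apply sqrt_pos | exact Hu]. }
      rewrite <- (sqrt_Rsqr u) by assumption; apply sqrt_le_1_alt.
      apply Rle_eps; intros e He.
      destruct (ratio_approx a hi f Ha cf HN HQ e He) as [r [x [Hr [Er Hx]]]].
      specialize (Hu _ Hr); simpl in Hu; rewrite Er in Hu.
      assert (x <= Rsqr u).
      { destruct (Rle_lt_dec x 0); [apply Rle_trans with 0; [assumption | apply Rle_0_sqr]|].
        rewrite <- (Rsqr_sqrt x) by lra; apply Rsqr_incr_1; [assumption | apply sqrt_pos | assumption]. }
      apply Rabs_le_between in Hx; lra.
    + destruct (ratio_approx a hi f Ha cf HN HQ 1 Rlt_0_1) as [r [x [Hr _]]].
      exact (Hu _ Hr).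
Qed.

Lemma inf_value (a lo hi : R) (f : R -> R) : 0 < a <= 1 -> 0 <= 1 + lo ->
  (forall f, cts f -> lo * Nrm a f <= Qf a f <= hi * Nrm a f) ->
  cts f -> 0 < Nrm a f -> Qf a f = lo * Nrm a f -> Cminus_is (2 * a) (Finite (sqrt (1 + lo))).
Proof.
  intros Ha Hlo Hsp cf HN HQ; split.
  - intros r Hr; simpl; apply (ratio_between a lo hi Ha Hlo Hsp r Hr).
  - intros u Hu.
    destruct u as [u| |]; simpl; auto.
    + apply Rnot_lt_le; intros Hlt.
      assert (s0 := sqrt_pos (1 + lo)).
      (* Half the gap between the squares keeps [x] strictly below [u ^ 2]. *)
      assert (He : 0 < (Rsqr u - (1 + lo)) / 2).
      { assert (Rsqr (sqrt (1 + lo)) < Rsqr u) by (apply Rsqr_incrst_1; lra).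
        rewrite Rsqr_sqrt in * by assumption; lra. }
      destruct (ratio_approx a lo f Ha cf HN HQ _ He) as [r [x [Hr [Er Hx]]]].
      specialize (Hu _ Hr); simpl in Hu; rewrite Er in Hu.
      apply Rabs_le_between in Hx.
      assert (sqrt x < u); [|lra].
      (* At nonpositive arguments [sqrt] takes the value 0, which is below [u]. *)
      destruct (Rle_lt_dec x 0); [rewrite sqrt_neg_0 by assumption; lra|].
      rewrite <- (sqrt_Rsqr u) by lra; apply sqrt_lt_1_alt; lra.
    + destruct (ratio_approx a lo f Ha cf HN HQ 1 Rlt_0_1) as [r [x [Hr _]]].
      exact (Hu _ Hr).
Qed.

Theorem theorem16 :
  (forall Delta : R, 0 < Delta <= 1 ->
     Cminus_is Delta (Finite 1) /\ Cplus_is Delta (Finite (sqrt (1 + Delta / 2)))) /\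
  (forall Delta : R, 1 < Delta <= 2 ->
     exists eta_p eta_m : R,
       eta_eq Delta eta_p /\ (forall eta, eta_eq Delta eta -> eta <= eta_p) /\
       eta_eq Delta eta_m /\ (forall eta, eta_eq Delta eta -> eta_m <= eta) /\
       Cminus_is Delta (Finite (sqrt (1 + eta_m))) /\
       Cplus_is Delta (Finite (sqrt (1 + eta_p)))).
Proof.
  split; intros D HD; set (a := D / 2); replace D with (2 * a) by (unfold a; field);
    assert (Ha : 0 < a <= 1) by (unfold a; lra).
  - assert (Ha2 : 0 < a <= / 2) by (unfold a; lra).
    assert (Hsp := fun f => Qf_small_bounds a f Ha2).
    replace (2 * a / 2) with a by field.
    split.
    + replace (Finite 1) with (Finite (sqrt (1 + 0))) by (rewrite Rplus_0_r, sqrt_1; reflexivity).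
      (* An odd function has mean zero, so it lies in the kernel of the rank-one operator. *)
      apply (inf_value a 0 a (fun t => t)); try assumption; try lra; [apply cts_id | |].
      * apply (RInt_c_pos_strict _ _ _ a); [apply cts_pow, cts_id | lra | lra | intros; apply pow2_ge_0 | apply pow_lt; lra].
      * rewrite Qf_small by (assumption || apply cts_id).
        rewrite (RInt_odd (fun t => t)); [ring | apply cts_id | reflexivity].
    (* Constants give equality in Cauchy-Schwarz. *)
    + apply (sup_value a 0 a (fun _ => 1)); try assumption; try lra; [apply cts_const | |].
      * unfold Nrm; rewrite RInt_R_const; lra.
      * rewrite Qf_small by (assumption || apply cts_const); unfold Nrm; rewrite !RInt_R_const; field.
  - assert (Ha2 : / 2 < a <= 1) by (unfold a; lra).
    destruct (spectral_bounds a Ha2) as [ep [em [R1 [R2 [R3 [R4 Hsp]]]]]].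
    exists ep, em; repeat (split; [assumption|]).
    destruct (root_eigenfunction a em Ha2 R3) as [fm [cfm [Nm Qm]]].
    destruct (root_eigenfunction a ep Ha2 R1) as [fp [cfp [Np Qp]]].
    (* The general bound [|Q| <= N], evaluated at the eigenfunction of [em]. *)
    assert (Hlo : 0 <= 1 + em).
    { assert (B := Qf_bound a fm cfm ltac:(lra)); rewrite Qm in B; apply Rabs_le_between in B; nra. }
    split.
    + apply (inf_value a em ep fm); assumption.
    + apply (sup_value a em ep fp); assumption.
Qed.
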